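(* Let $\mathcal{F}$ be a family of non-constant polynomials (with complex coefficients) such that for each $w_0\in J(\mathcal{F})$ there is $P_0\in\mathcal{F}$ such that $P_0-w_0$ has at least three distinct simple roots. Then $J(\mathcal{F})$ is contained in the closure of the set of all repelling fixed points of the polynomials of the form $P\circ Q$, where $P,Q\in\mathcal{F}$.
   Context: A family $\mathcal{F}$ of entire functions is normal on an open set $G\subseteq\mathbb{C}$ if every sequence in $\mathcal{F}$ contains a subsequence that converges locally uniformly on $G$, where the limit is either a holomorphic function or identically $\infty$ (locally uniform convergence to $\infty$ is allowed). $\mathcal{F}$ is normal at a point $z_0\in\mathbb{C}$ if it is normal in some neighborhood of $z_0$. $F(\mathcal{F})$ is the set of points of $\mathbb{C}$ at which $\mathcal{F}$ is normal, and $J(\mathcal{F}):=\mathbb{C}\setminus F(\mathcal{F})$. A point $w\in\mathbb{C}$ is a repelling fixed point of an entire function $g$ if $g(w)=w$ and $|g'(w)|>1$. *)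

(* Defs.v *)
From HB Require Import structures.
From mathcomp Require Import all_boot all_order all_algebra.
From mathcomp Require Import complex.
From mathcomp Require Import all_classical all_reals all_analysis.
Set Implicit Arguments.
Unset Strict Implicit.
Unset Printing Implicit Defensive.
Import Order.TTheory GRing.Theory Num.Theory.
Import numFieldNormedType.Exports.
Local Open Scope classical_set_scope.
Local Open Scope ring_scope.
Local Open Scope complex_scope.

(* The complex plane is R[i] for R : realType, with the topology of its modulus
   and as a normed space over itself: derivability below is thus complex
   differentiability. *)
HB.instance Definition _ (R : realType) := NormedModule.copy R[i] R[i]^o.

Section Normality.
Variable R : realType.
Local Notation C := R[i].

Definition holomorphic_on (G : set C) (g : C -> C) : Prop :=
  forall z : C, G z -> derivable g z 1.

Definition locally_uniformly_cvg
    (G : set C) (f : nat -> C -> C) (g : C -> C) : Prop :=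
  forall z : C, G z -> exists2 U : set C, nbhs z U & {uniform U, f @ \oo --> g}.

Definition locally_uniformly_cvg_infty (G : set C) (f : nat -> C -> C) : Prop :=
  forall z : C, G z -> exists2 U : set C, nbhs z U &
    forall M : R, \forall n \near \oo, forall w : C, U w -> M%:C < `|f n w|.

Definition normal_on (F : set (C -> C)) (G : set C) : Prop :=
  forall f : nat -> C -> C, (forall n, F (f n)) ->
    exists2 phi : nat -> nat, {homo phi : m n / (m < n)%N} &
      (exists2 g : C -> C, holomorphic_on G g &
         locally_uniformly_cvg G (f \o phi) g)
      \/ locally_uniformly_cvg_infty G (f \o phi).

Definition normal_at (F : set (C -> C)) (z : C) : Prop :=
  exists G : set C, [/\ open G, G z & normal_on F G].

Definition fatou_set (F : set (C -> C)) : set C := [set z | normal_at F z].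

Definition julia_set (F : set (C -> C)) : set C := ~` fatou_set F.

Definition repelling_fixed_point (g : C -> C) (w : C) : Prop :=
  g w = w /\ 1 < `|derive1 g w|.

Definition poly_functions (F : set {poly C}) : set (C -> C) :=
  [set horner P | P in F].

Definition simple_root (P : {poly C}) (z : C) : bool := mup z P == 1%N.

Definition three_simple_roots (P : {poly C}) : Prop :=
  exists s : seq C, [/\ uniq s, size s = 3 & all (simple_root P) s].

End Normality.

(* Main.v *)
(* Suppose that no [P \Po Q] has a repelling fixed point near [w0], and let
   [P] have three distinct simple [w0]-points [a1], [a2], [a3].  If the
   spherical derivatives [|f'| / (1 + |f|^2)], [f] in [F], were unbounded near
   [w0], then rescaling almost-maxima of them as in Zalcman's lemma would give
   polynomials [g_n u = f_n (z_n + r_n u)], [z_n --> w0], [r_n --> 0], with a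
   locally uniform limit [G].  Wherever [G u = a_j] with [G' u != 0], Hurwitz's
   theorem gives solutions of [P (g_n u) = z_n + r_n u], that is fixed points of
   [P \Po f_n], with multiplier of size about [1 / r_n], hence repelling.  So
   every [a_j]-point of [G] is multiple, the quotient
   [h = G'^2 / ((G - a1) (G - a2) (G - a3))] is holomorphic, and a
   Schwarz-type bound on [|h 0|] over large discs contradicts
   [|G' 0| = 1 + |G 0|^2].  Finally [|f'| <= M (1 + |f|^2)] makes
   [ln (1 + ln (1 + |f|^2))] equi-Lipschitz, so that a sequence in [F] is either
   locally bounded along a subsequence or tends to infinity.

   No integral is used: Cauchy's estimates come from the mean value property,
   obtained with averages over roots of unity of order [2^k]. *)
Require Import Defs.
From mathcomp Require Import all_boot all_order all_algebra.
From mathcomp Require Import complex ring lra.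
From mathcomp Require Import all_classical all_reals all_analysis.
Import Order.TTheory GRing.Theory Num.Theory.
Import numFieldNormedType.Exports.
Local Open Scope classical_set_scope.
Local Open Scope ring_scope.
Local Open Scope complex_scope.

Set Implicit Arguments.
Unset Strict Implicit.
Unset Printing Implicit Defensive.

(* [lra] slows down with every hypothesis in the context, even irrelevant ones. *)
Ltac linear_arith :=
  repeat match goal with
  | H : ?T |- _ => lazymatch T with
    | is_true (_ <= _) => fail
    | is_true (_ < _) => fail
    | is_true (~~ _) => fail
    | _ = _ :> _ => fail
    | _ => clear H
    end
  end; lra.

(** Why three values, and where the absence of poles enters. Let [Q] be the cubic with roots [a1],
    [a2], [a3]. The metric |dw|^2 / |Q(w)| is flat, with four cone points of angle pi, the fourth at
    infinity. Total ramification alone is therefore no contradiction: a Weierstrass function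
    satisfies G'^2 = 4 Q(G) after an affine change. What rules it out is that [G] is finite, and
    this is used through a single inequality: |G'| d <= |G| ln |G|^2 wherever |G| is large and the
    spherical derivative is under control on a disc of radius d. The equation forces |G'| to be of
    order |G|^(3/2), so |G| cannot be large. The same inequality bounds the rescaled polynomials at
    their centre and makes the iterated logarithm Lipschitz, so meromorphic limits never appear. Two
    values would not do: the cosine is totally ramified over 1 and -1. *)

Notation nc := (@Normc.normc _).

(** * The modulus as a real number *)

Section Modulus.
Variable R : realType.
Local Notation C := R[i].
Implicit Types x y z w : C.

Lemma ncE z : `|z| = (nc z)%:C.
Proof. by rewrite normc_def; case: z. Qed.

Lemma nc_ge0 z : 0 <= nc z.
Proof. by rewrite -ler0c -ncE. Qed.

Lemma ncD x y : nc (x + y) <= nc x + nc y.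
Proof. exact: le_normcD. Qed.

Lemma ncN x : nc (- x) = nc x.
Proof. exact: normcN. Qed.

Lemma ncM x y : nc (x * y) = nc x * nc y.
Proof. exact: Normc.normcM. Qed.

Lemma ncV x : nc x^-1 = (nc x)^-1.
Proof. exact: Normc.normcV. Qed.

Lemma ncX x n : nc (x ^+ n) = nc x ^+ n.
Proof.
elim: n => [|n IH]; first by rewrite !expr0 Normc.normc1.
by rewrite !exprS ncM IH.
Qed.

Lemma ncBC x y : nc (x - y) = nc (y - x).
Proof. by rewrite -ncN opprB. Qed.

Lemma nc_eq0 x : (nc x == 0) = (x == 0).
Proof.
apply/eqP/eqP => [/Normc.eq0_normc//|->]; exact: Normc.normc0.
Qed.

Lemma nc_gt0 x : (0 < nc x) = (x != 0).
Proof. by rewrite lt0r nc_eq0 nc_ge0 andbT. Qed.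

Lemma nc0 : nc (0 : C) = 0.
Proof. exact: Normc.normc0. Qed.

Lemma nc1 : nc (1 : C) = 1.
Proof. exact: Normc.normc1. Qed.

Lemma nc_real (r : R) : nc r%:C = `|r|.
Proof. by rewrite /= expr0n addr0 sqrtr_sqr. Qed.

Lemma nc_nat n : nc (n%:R : C) = n%:R.
Proof.
have -> : (n%:R : C) = (n%:R : R)%:C by rewrite rmorph_nat.
by rewrite nc_real ger0_norm.
Qed.

Lemma ncB x y : nc (x - y) <= nc x + nc y.
Proof. by rewrite (le_trans (ncD _ _))// ncN. Qed.

Lemma nc_distD z x y : nc (x - y) <= nc (x - z) + nc (z - y).
Proof. by have := ncD (x - z) (z - y); rewrite addrA subrK. Qed.

Lemma nc_lerB x y : nc x <= nc y + nc (x - y).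
Proof. by have := ncD y (x - y); rewrite addrCA subrr addr0. Qed.

Lemma nc_sqr z : nc z ^+ 2 = complex.Re z ^+ 2 + complex.Im z ^+ 2.
Proof. by case: z => a b /=; rewrite sqr_sqrtr // addr_ge0 ?sqr_ge0. Qed.

Lemma ler_Re_nc z : `|complex.Re z| <= nc z.
Proof. by rewrite -lecR -ncE normc_ge_Re. Qed.

Lemma Re_le_nc z : complex.Re z <= nc z.
Proof. exact: le_trans (ler_norm _) (ler_Re_nc z). Qed.

Lemma ler_Im_nc z : `|complex.Im z| <= nc z.
Proof.
by rewrite -(@ler_pXn2r _ 2) ?nnegrE ?nc_ge0// real_normK ?num_real// nc_sqr
  lerDr sqr_ge0.
Qed.

Lemma nc_ReIm z : nc z <= `|complex.Re z| + `|complex.Im z|.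
Proof.
case: z => a b; have -> : (a +i* b = a%:C + 'i * b%:C :> C).
  by apply/eqP; rewrite eq_complex /=; apply/andP; split; apply/eqP; ring.
rewrite (le_trans (ncD _ _))// ncM /=.
have -> : a + (0 * b - 1 * 0) = a by ring.
have -> : 0 + (0 * 0 + 1 * b) = b by ring.
by rewrite !expr0n expr1n !addr0 add0r sqrtr1 mul1r !sqrtr_sqr.
Qed.

Lemma nc_sum (I : Type) (r : seq I) (P : pred I) (F : I -> C) :
  nc (\sum_(i <- r | P i) F i) <= \sum_(i <- r | P i) nc (F i).
Proof.
elim/big_rec2: _ => [|i b a _ IH]; first by rewrite nc0.
by rewrite (le_trans (ncD _ _)) ?lerD2l.
Qed.

Lemma ncconj z : nc (conjc z) = nc z.
Proof. by case: z => a b /=; rewrite sqrrN. Qed.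

Lemma mulcJ z : z * (conjc z) = (nc z ^+ 2)%:C.
Proof.
by rewrite nc_sqr; case: z => a b; apply/eqP; rewrite eq_complex /=;
  apply/andP; split; apply/eqP; ring.
Qed.

Lemma ReM x y :
  complex.Re (x * y) = complex.Re x * complex.Re y - complex.Im x * complex.Im y.
Proof. by case: x => ? ?; case: y. Qed.

Lemma ReD x y : complex.Re (x + y) = complex.Re x + complex.Re y.
Proof. by case: x => ? ?; case: y. Qed.

Lemma ReB x y : complex.Re (x - y) = complex.Re x - complex.Re y.
Proof. by case: x => ? ?; case: y. Qed.

Lemma Re_sum (I : Type) (r : seq I) (P : pred I) (F : I -> C) :
  complex.Re (\sum_(i <- r | P i) F i) = \sum_(i <- r | P i) complex.Re (F i).
Proof. by elim/big_rec2: _ => [//|i b a _ <-]; rewrite ReD. Qed.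

Lemma realM (r : R) z : complex.Re (r%:C * z) = r * complex.Re z.
Proof. by rewrite ReM /= mul0r subr0. Qed.

Lemma Mreal (r : R) z : complex.Re (z * r%:C) = complex.Re z * r.
Proof. by rewrite ReM /= mulr0 subr0. Qed.

(** Turns a bound on a modulus into a bound on one real part: after multiplication by [b] the real
    mean value theorem applies. *)
Lemma phase_ex z : exists2 b : C, nc b = 1 & b * z = (nc z)%:C.
Proof.
have [->|z0] := eqVneq z 0; first by exists 1; rewrite ?nc1// mul1r nc0.
have n0 : nc z != 0 by rewrite nc_eq0.
exists ((conjc z) / (nc z)%:C).
  by rewrite ncM ncV ncconj nc_real ger0_norm ?nc_ge0// divff.
rewrite mulrAC (mulrC _ z) mulcJ -fmorphV -rmorphM /=; congr (_ %:C).
by rewrite expr2 mulfK.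
Qed.

End Modulus.

(** * Calculus of complex differentiability with a quadratic remainder *)

Section Quadratic.
Variable R : realType.
Local Notation C := R[i].
Implicit Types (f g : C -> C) (z u v : C).

(* Complex differentiability near [z] with derivative [f'] and a quadratic
   remainder: it is stable under all the operations used below, and all of its
   consequences are quantitative. *)
Definition hd f f' z := exists K r : R, [/\ 0 <= K, 0 < r &
  forall u v, nc (u - z) < r -> nc (v - z) < r ->
    nc (f u - f v - f' v * (u - v)) <= K * nc (u - v) ^+ 2].

Lemma hd_near f f' g g' z (r : R) : 0 < r ->
  (forall u, nc (u - z) < r -> f u = g u /\ f' u = g' u) ->
  hd f f' z -> hd g g' z.
Proof.
move=> r0 fg [K [s [K0 s0 H]]]; exists K, (Num.min r s); split => //.
  by rewrite lt_min r0.
move=> u v; rewrite !lt_min => /andP[ur us] /andP[vr vs].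
have [<- _] := fg _ ur; have [<- <-] := fg _ vr; exact: H.
Qed.

Lemma hd_ext f f' g g' z : f =1 g -> f' =1 g' -> hd f f' z -> hd g g' z.
Proof. by move=> fg fg'; apply: hd_near (@ltr01 _) _. Qed.

Lemma hd_cst (c z : C) : hd (fun=> c) (fun=> 0) z.
Proof.
exists 0, 1; split=> // u v _ _.
by rewrite subrr mul0r subr0 nc0 mul0r.
Qed.

Lemma hd_id z : hd id (fun=> 1) z.
Proof.
exists 0, 1; split=> // u v _ _.
by rewrite mul1r subrr nc0 mul0r.
Qed.

Lemma hd_lipschitz f f' z : hd f f' z -> exists L r : R, [/\ 0 <= L, 0 < r &
  forall u v, nc (u - z) < r -> nc (v - z) < r ->
    [/\ nc (f u - f v) <= L * nc (u - v), nc (f' u - f' v) <= L * nc (u - v),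
        nc (f u) <= L & nc (f' u) <= L]].
Proof.
move=> [K [r [K0 r0 H]]].
pose L := 4 * K * r + 2 * K + nc (f' z) + (4 * K * r + nc (f' z)) * r + nc (f z).
(* The remainders at [(u, v)] and [(v, u)] add up to [(f' u - f' v) * (u - v)]: the two-point form
   of [hd] is what makes [f'] Lipschitz. *)
have K2 u v : nc (u - z) < r -> nc (v - z) < r ->
    nc (f' u - f' v) <= 2 * K * nc (u - v).
  move=> ur vr; have [->|uv] := eqVneq u v; first by rewrite !subrr nc0 mulr0.
  have n0 : 0 < nc (u - v) by rewrite nc_gt0 subr_eq0.
  rewrite -(ler_pM2r n0) -ncM.
  have -> : (f' u - f' v) * (u - v) =
    (f u - f v - f' v * (u - v)) + (f v - f u - f' u * (v - u)) by ring.
  apply: le_trans (ncD _ _) _.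
  have := H _ _ ur vr; have := H _ _ vr ur; rewrite (ncBC v u) => *.
  linear_arith.
have zz : nc (z - z) < r by rewrite subrr nc0.
have Kr : 0 <= K * r by rewrite mulr_ge0 // ltW.
have bd u : nc (u - z) < r -> nc (f' u) <= 2 * K * r + nc (f' z).
  move=> ur; have h1 := K2 _ _ ur zz; have h2 := nc_lerB (f' u) (f' z).
  have h3 : K * nc (u - z) <= K * r by rewrite ler_wpM2l // ltW.
  by linear_arith.
have n0 := nc_ge0 (f' z).
have lf u v : nc (u - z) < r -> nc (v - z) < r ->
    nc (f u - f v) <= (4 * K * r + nc (f' z)) * nc (u - v).
  move=> ur vr.
  have h1 := H _ _ ur vr; have h2 := bd _ vr.
  have h3 := nc_lerB (f u - f v) (f' v * (u - v)); rewrite ncM in h3.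
  have h4 : nc (u - v) <= 2 * r.
    by rewrite (le_trans (nc_distD z _ _))// (ncBC z); linear_arith.
  have h0 := nc_ge0 (u - v).
  have h5 : K * nc (u - v) ^+ 2 <= K * (2 * r) * nc (u - v).
    by rewrite -mulrA expr2 ler_wpM2l // ler_wpM2r.
  have h6 : nc (f' v) * nc (u - v) <= (2 * K * r + nc (f' z)) * nc (u - v).
    by rewrite ler_wpM2r.
  by linear_arith.
have L0 : 0 <= (4 * K * r + nc (f' z)) * r by apply: mulr_ge0; [linear_arith|exact: ltW].
have nf := nc_ge0 (f z).
exists L, r; split; rewrite /L//; first by linear_arith.
move=> u v ur vr; have h0 := nc_ge0 (u - v); split.
- apply: le_trans (lf _ _ ur vr) _; rewrite ler_wpM2r //; linear_arith.
- apply: le_trans (K2 _ _ ur vr) _; rewrite ler_wpM2r //; linear_arith.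
- have h1 := lf _ _ ur zz; have h2 := nc_lerB (f u) (f z).
  have h3 : (4 * K * r + nc (f' z)) * nc (u - z) <= (4 * K * r + nc (f' z)) * r.
    by apply: ler_wpM2l; [linear_arith|exact: ltW].
  by linear_arith.
- have := bd _ ur; linear_arith.
Qed.

Lemma hdD f f' g g' z : hd f f' z -> hd g g' z ->
  hd (fun u => f u + g u) (fun u => f' u + g' u) z.
Proof.
move=> [K [r [K0 r0 H]]] [L [s [L0 s0 G]]].
exists (K + L), (Num.min r s); split; rewrite ?addr_ge0 ?lt_min ?r0 //.
move=> u v; rewrite !lt_min => /andP[ur us] /andP[vr vs].
have -> : f u + g u - (f v + g v) - (f' v + g' v) * (u - v) =
  (f u - f v - f' v * (u - v)) + (g u - g v - g' v * (u - v)) by ring.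
by rewrite (le_trans (ncD _ _))// mulrDl lerD ?H ?G.
Qed.

Lemma hdM f f' g g' z : hd f f' z -> hd g g' z ->
  hd (fun u => f u * g u) (fun u => f' u * g u + f u * g' u) z.
Proof.
move=> hf hg.
have [A [a [A0 a0 lipf]]] := hd_lipschitz hf.
have [B [b [B0 b0 lipg]]] := hd_lipschitz hg.
case: hf => [K [r [K0 r0 H]]]; case: hg => [L [s [L0 s0 G]]].
exists (K * B + A * L + A * B), (Num.min (Num.min r s) (Num.min a b)).
have KB : 0 <= K * B by rewrite mulr_ge0.
have AL : 0 <= A * L by rewrite mulr_ge0.
have AB : 0 <= A * B by rewrite mulr_ge0.
split; [by linear_arith|by rewrite !lt_min r0 s0 a0|].
move=> u v; rewrite !lt_min => /andP[/andP[ur us] /andP[ua ub]].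
move=> /andP[/andP[vr vs] /andP[va vb]].
have [h1 _ _ _] := lipf _ _ ua va; have [h2 _ _ _] := lipg _ _ ub vb.
have [_ _ h3 _] := lipf _ _ va va; have [_ _ h4 _] := lipg _ _ vb vb.
have -> : f u * g u - f v * g v - (f' v * g v + f v * g' v) * (u - v) =
  (f u - f v - f' v * (u - v)) * g v + f v * (g u - g v - g' v * (u - v)) +
  (f u - f v) * (g u - g v) by ring.
apply: le_trans (ncD _ _) _; rewrite (mulrDl (K * B + A * L)) lerD //.
  apply: le_trans (ncD _ _) _; rewrite !ncM (mulrDl (K * B)) lerD //.
    by rewrite mulrAC ler_pM ?nc_ge0 // H.
  by rewrite -mulrA ler_pM ?nc_ge0 // G.
by rewrite ncM expr2 mulrACA ler_pM ?nc_ge0.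
Qed.

Lemma hdV f f' z : f z != 0 -> hd f f' z ->
  hd (fun u => (f u)^-1) (fun u => - f' u / f u ^+ 2) z.
Proof.
move=> fz hf; have [A [a [A0 a0 lipf]]] := hd_lipschitz hf.
case: hf => [K [r [K0 r0 H]]].
have m0 : 0 < nc (f z) by rewrite nc_gt0.
pose m := nc (f z) / 2.
have mp : 0 < m by rewrite divr_gt0.
(* Within this radius the Lipschitz bound keeps [nc (f u)] above half of [nc (f z)]. *)
pose s := m / (A + 1).
have A1 : 0 < A + 1 by linear_arith.
have s0 : 0 < s by rewrite divr_gt0.
have low u : nc (u - z) < a -> nc (u - z) < s -> m <= nc (f u).
  move=> ua us.
  have za : nc (z - z) < a by rewrite subrr nc0.
  have [h _ _ _] := lipf _ _ ua za.
  have h2 := nc_lerB (f z) (f u); rewrite ncBC in h2.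
  have h3 : A * nc (u - z) <= m.
    apply: (@le_trans _ _ ((A + 1) * s)).
      by rewrite ler_pM ?nc_ge0 //; linear_arith.
    by rewrite /s mulrC divfK // gt_eqF.
  by rewrite /m in h3 *; linear_arith.
exists (K * m^-1 ^+ 2 + A ^+ 2 * (m^-1 ^+ 3)), (Num.min r (Num.min a s)).
have mi : 0 <= m^-1 by rewrite invr_ge0 ltW.
split; first by rewrite addr_ge0 ?mulr_ge0 ?exprn_ge0.
  by rewrite !lt_min r0 a0.
move=> u v; rewrite !lt_min => /andP[ur /andP[ua us]] /andP[vr /andP[va vs]].
have fu0 : f u != 0 by rewrite -nc_gt0 (lt_le_trans mp) ?low.
have fv0 : f v != 0 by rewrite -nc_gt0 (lt_le_trans mp) ?low.
have -> : (f u)^-1 - (f v)^-1 - - f' v / f v ^+ 2 * (u - v) =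
   - (f u - f v - f' v * (u - v)) * (f v)^-1 ^+ 2
   + (f u - f v) ^+ 2 * ((f u)^-1 * (f v)^-1 ^+ 2).
  by field; rewrite fu0 fv0.
have iu : (nc (f u))^-1 <= m^-1 by rewrite lef_pV2 ?posrE ?low// (lt_le_trans mp) ?low.
have iv : (nc (f v))^-1 <= m^-1 by rewrite lef_pV2 ?posrE ?low// (lt_le_trans mp) ?low.
have iu0 : 0 <= (nc (f u))^-1 by rewrite invr_ge0 nc_ge0.
have iv0 : 0 <= (nc (f v))^-1 by rewrite invr_ge0 nc_ge0.
have [h _ _ _] := lipf _ _ ua va.
apply: le_trans (ncD _ _) _; rewrite !(ncX, ncM, ncV) ncN mulrDl lerD //.
  rewrite [leRHS]mulrAC ler_pM ?nc_ge0 ?exprn_ge0 //; first exact: H.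
  by rewrite lerXn2r // nnegrE.
rewrite [leRHS]mulrAC -exprMn ler_pM ?exprn_ge0 ?mulr_ge0 ?exprn_ge0 ?nc_ge0 //.
  by rewrite lerXn2r // nnegrE ?nc_ge0 // mulr_ge0 // nc_ge0.
by rewrite [leRHS]exprS ler_pM ?exprn_ge0 // lerXn2r // nnegrE.
Qed.

Lemma hdN f f' z : hd f f' z -> hd (fun u => - f u) (fun u => - f' u) z.
Proof.
move=> hf; have := hdM (hd_cst (-1) z) hf.
by apply: hd_ext => u /=; ring.
Qed.

Lemma hdB f f' g g' z : hd f f' z -> hd g g' z ->
  hd (fun u => f u - g u) (fun u => f' u - g' u) z.
Proof. by move=> hf hg; apply: hdD => //; exact: hdN. Qed.

Lemma hd_affine f f' (a b : C) z : hd f f' (a + b * z) ->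
  hd (fun u => f (a + b * u)) (fun u => b * f' (a + b * u)) z.
Proof.
move=> [K [r [K0 r0 H]]].
have nb := nc_ge0 b; have b1 : 0 < nc b + 1 by linear_arith.
exists (K * nc b ^+ 2), (r / (nc b + 1)); split.
- by rewrite mulr_ge0 ?exprn_ge0.
- by rewrite divr_gt0.
have aux u : nc (u - z) < r / (nc b + 1) -> nc (a + b * u - (a + b * z)) < r.
  rewrite ltr_pdivlMr // => h.
  have -> : a + b * u - (a + b * z) = b * (u - z) by ring.
  by rewrite ncM; have := nc_ge0 (u - z); linear_arith.
move=> u v /aux ur /aux vr; have := H _ _ ur vr.
have -> : a + b * u - (a + b * v) = b * (u - v) by ring.
by rewrite ncM exprMn !mulrA (mulrC b (f' _)).
Qed.

Lemma hd_horner (p : {poly C}) z : hd (horner p) (horner p^`()) z.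
Proof.
elim/poly_ind: p => [|p c IH].
  by apply: hd_ext (hd_cst 0 z) => u; rewrite ?deriv0 horner0.
apply: hd_ext (hdD (hdM IH (hd_id z)) (hd_cst c z)) => u /=.
  by rewrite hornerMXaddC.
by rewrite derivMXaddC !hornerE; ring.
Qed.

Lemma hd_unique f f' g' z : hd f f' z -> hd f g' z -> f' z = g' z.
Proof.
move=> hf hg; have := hdB hf hg; move=> [K [r [K0 r0 H]]].
apply/eqP; rewrite -subr_eq0 -nc_eq0 eq_le nc_ge0 andbT.
apply/ler_addgt0Pl => e e0; rewrite addr0.
pose t := Num.min (r / 2) (e / (K + 1)).
have K1 : 0 < K + 1 by linear_arith.
have t0 : 0 < t by rewrite lt_min !divr_gt0.
have nt : nc t%:C = t by rewrite nc_real gtr0_norm.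
have := H (z + t%:C) z.
rewrite (addrC z) addrK subrr nc0 nt => /(_ _ r0).
have tr : t < r by rewrite gt_min; apply/orP; left; linear_arith.
move=> /(_ tr); rewrite !subrr !sub0r ncN ncM nt expr2 mulrA ler_pM2r //.
move=> /le_trans; apply.
have : t <= e / (K + 1) by rewrite ge_min lexx orbT.
by rewrite ler_pdivlMr // => ?; linear_arith.
Qed.

End Quadratic.

(** * Compactness and mean value inequalities *)

Section UltraLimits.

Lemma nat_ultra_ex : exists U : set_system nat, UltraFilter U /\ \oo `<=` U.
Proof. exact: ultraFilterLemma. Qed.

(** One ultrafilter refining [\oo] serves every bounded sequence, so limits at all points of a disc
    are taken simultaneously, without diagonal extraction. *)
Definition nat_ultra : set_system nat := projT1 (cid nat_ultra_ex).

#[local] Instance nat_ultra_ultra : UltraFilter nat_ultra.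
Proof. by case: (projT2 (cid nat_ultra_ex)). Qed.

Lemma nat_ultra_ge N : nat_ultra [set n | (N <= n)%N].
Proof.
have [_] := projT2 (cid nat_ultra_ex); apply; exact: nbhs_infty_ge.
Qed.

Lemma nat_ultraI A B : nat_ultra A -> nat_ultra B -> nat_ultra (A `&` B).
Proof. exact: filterI. Qed.

Lemma nat_ultraS A B : (forall n, A n -> B n) -> nat_ultra A -> nat_ultra B.
Proof. by move=> AB; apply: filterS. Qed.

Lemma nat_ultra_ex_ge A N : nat_ultra A -> exists2 n, (N <= n)%N & A n.
Proof.
move=> UA; have /filter_ex[n [? ?]] := nat_ultraI (nat_ultra_ge N) UA.
by exists n.
Qed.

Lemma nat_ultraN A : ~ nat_ultra A -> nat_ultra (~` A).
Proof. by move=> nA; have [] := in_ultra_setVsetC A nat_ultra_ultra. Qed.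

Variable R : realType.
Local Notation C := R[i].

(** The limit is the supremum of the levels lying below [x n] for almost every [n]. *)
Lemma real_ulim (x : nat -> R) (B : R) : (forall n, `|x n| <= B) ->
  exists l : R, forall e, 0 < e -> nat_ultra [set n | `|x n - l| < e].
Proof.
move=> xB; pose S := [set t : R | nat_ultra [set n | t <= x n]].
have hS : has_sup S.
  split.
    exists (- B); apply: nat_ultraS (nat_ultra_ge 0) => n _ /=.
    by have := xB n; rewrite ler_norml => /andP[].
  exists B => t /(@nat_ultra_ex_ge _ 0)[n _ /= /le_trans]; apply.
  by rewrite (le_trans (ler_norm _)).
exists (sup S) => e e0.
have [t St tS] := sup_adherent e0 hS.
have nS : ~ nat_ultra [set n | sup S + e / 2 <= x n].
  move=> /(ub_le_sup hS.2); linear_arith.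
have := nat_ultraI St (nat_ultraN nS); apply: nat_ultraS => n [/= h1 /negP].
by rewrite -ltNge => h2; rewrite ltr_distl; apply/andP; split; linear_arith.
Qed.

Lemma complex_ulim (x : nat -> C) (B : R) : (forall n, nc (x n) <= B) ->
  exists l : C, forall e, 0 < e -> nat_ultra [set n | nc (x n - l) < e].
Proof.
move=> xB.
have [a Ha] := @real_ulim (fun n => complex.Re (x n)) B
  (fun n => le_trans (ler_Re_nc _) (xB n)).
have [b Hb] := @real_ulim (fun n => complex.Im (x n)) B
  (fun n => le_trans (ler_Im_nc _) (xB n)).
exists (a +i* b) => e e0.
have e2 : 0 < e / 2 by linear_arith.
apply: nat_ultraS (nat_ultraI (Ha _ e2) (Hb _ e2)) => n [/= h1 h2].
apply: le_lt_trans (nc_ReIm _) _.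
by move: h1 h2; case: (x n) => p q /= *; linear_arith.
Qed.

(** For [s = 0] a closed disc. A positive [s] cuts out the centre, where the difference quotient of
    [cauchy_estimate] is singular. *)
Definition annulus (c : C) (s r : R) : set C := [set z | s <= nc (z - c) <= r].

Implicit Types (z u v c : C) (s r d K : R).

(** A Lebesgue number argument: pairs violating the bound ever more strongly, at ever smaller
    distance, have both components close to one ultralimit in the annulus, against the local bound
    there. *)
Lemma annulus_compact c s r (e : C -> C -> R) :
  (forall z, annulus c s r z -> exists K d : R, 0 < d /\
     forall u v, nc (u - z) < d -> nc (v - z) < d -> e u v <= K) ->
  exists K d : R, [/\ 0 <= K, 0 < d & forall u v,
    annulus c s r u -> annulus c s r v -> nc (u - v) < d -> e u v <= K].
Proof.
move=> loc; apply: contrapT => nK.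
have bad n : exists p : C * C, [/\ annulus c s r p.1, annulus c s r p.2,
    nc (p.1 - p.2) < n.+1%:R^-1 & n%:R < e p.1 p.2].
  apply: contrapT => nb; apply: nK; exists n%:R, n.+1%:R^-1.
  split=> [//||u v Au Av uv]; first by rewrite invr_gt0.
  by rewrite leNgt; apply/negP => ev; apply: nb; exists (u, v).
have [p Hp] := choice bad.
have bnd n : nc ((p n).1) <= r + nc c.
  have [/andP[_ h] _ _ _] := Hp n.
  by have := nc_lerB (p n).1 c; linear_arith.
have [z Hz] := complex_ulim bnd.
have Az : annulus c s r z.
  apply/andP; split; apply/ler_addgt0Pl => d d0;
    have [n _ /= h] := nat_ultra_ex_ge 0 (Hz _ d0);
    have [/andP[h1 h2] _ _ _] := Hp n.
  - by have := nc_distD z (p n).1 c; linear_arith.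
  - by have := nc_distD (p n).1 z c; rewrite (ncBC z (p n).1); linear_arith.
have [K [d [d0 Kd]]] := loc _ Az.
have d2 : 0 < d / 2 by linear_arith.
pose N := maxn (Num.truncn (`|K|)).+1 (Num.truncn (d / 2)^-1).+1.
have [n Nn /= h] := nat_ultra_ex_ge N (Hz _ d2).
have [_ _ h1 h2] := Hp n.
have Kn : K < n%:R.
  apply: le_lt_trans (ler_norm _) _; apply: lt_le_trans (truncnS_gt _) _.
  by rewrite ler_nat (leq_trans _ Nn) // leq_maxl.
have nd : n.+1%:R^-1 < d / 2.
  rewrite -[ltRHS]invrK ltf_pV2 ?posrE ?invr_gt0 //.
  apply: lt_le_trans (truncnS_gt _) _.
  by rewrite ler_nat (leq_trans _ (leqW Nn)) // leq_maxr.
have h3 := nc_distD (p n).1 (p n).2 z.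
rewrite (ncBC (p n).2 (p n).1) in h3.
have {}h1 := lt_trans h1 nd; have h4 : nc ((p n).2 - z) < d by linear_arith.
have h5 : nc ((p n).1 - z) < d by linear_arith.
have := Kd _ _ h5 h4; linear_arith.
Qed.

Lemma hd_unif f f' c s r : (forall z, annulus c s r z -> hd f f' z) ->
  exists K d : R, [/\ 0 <= K, 0 < d & forall u v,
    annulus c s r u -> annulus c s r v -> nc (u - v) < d ->
    nc (f u - f v - f' v * (u - v)) <= K * nc (u - v) ^+ 2].
Proof.
(* On the diagonal this quotient is [0 / 0 = 0], so the local bounds hold there as well. *)
move=> H; pose e u v := nc (f u - f v - f' v * (u - v)) / nc (u - v) ^+ 2.
have [z Az|K [d [K0 d0 Kd]]] := @annulus_compact c s r e.
  have [K [d [K0 d0 h]]] := H z Az; exists K, d; split => // u v uz vz.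
  rewrite /e; have [->|uv] := eqVneq u v.
    by rewrite [v - v]subrr nc0 expr0n /= invr0 mulr0.
  by rewrite ler_pdivrMr ?h // exprn_gt0 // nc_gt0 subr_eq0.
exists K, d; split => // u v Au Av uv; have [->|nuv] := eqVneq u v.
  by rewrite !subrr mulr0 subrr nc0 expr0n mulr0.
by rewrite -ler_pdivrMr ?exprn_gt0 ?nc_gt0 ?subr_eq0// Kd.
Qed.

Lemma hd_bounded f f' c s r : (forall z, annulus c s r z -> hd f f' z) ->
  exists2 B : R, 0 <= B & forall z, annulus c s r z -> nc (f z) <= B /\ nc (f' z) <= B.
Proof.
move=> H.
have [z Az|K [d [K0 d0 Kd]]] := @annulus_compact c s r
    (fun u _ => Num.max (nc (f u)) (nc (f' u))).
  have [L [d [L0 d0 h]]] := hd_lipschitz (H z Az); exists L, d; split => // u v uz _.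
  by rewrite ge_max; have [_ _ -> ->] := h _ _ uz uz.
exists K => // z Az; have := Kd _ _ Az Az; rewrite subrr nc0 => /(_ d0).
by rewrite ge_max => /andP[].
Qed.

End UltraLimits.

Section RealCalculus.
Variable R : realType.
Local Notation C := R[i].

Lemma is_derive_quad (f : R -> R) (t l K d : R) : 0 < d ->
  (forall h, `|h| < d -> `|f (t + h) - f t - l * h| <= K * h ^+ 2) ->
  is_derive t 1 f l.
Proof.
move=> d0 H.
have cv : (fun h : R => h^-1 *: ((f \o shift t) (h *: 1) - f t)) @ 0^' --> l.
  apply/cvgrPdist_le => e e0.
  have K1 : 0 < `|K| + 1 by have := normr_ge0 K; linear_arith.
  have m0 : 0 < Num.min d (e / (`|K| + 1)) by rewrite lt_min d0 divr_gt0.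
  near=> h.
  have h0 : h != 0 by near: h; exact: nbhs_dnbhs_neq.
  have hm : `|h| < Num.min d (e / (`|K| + 1)) by near: h; exact: dnbhs0_lt.
  move: hm; rewrite lt_min => /andP[hd].
  rewrite ltr_pdivlMr // => he.
  have nh : 0 < `|h| by rewrite normr_gt0.
  rewrite /= /GRing.scale /= mulr1 (addrC h) distrC.
  rewrite -(ler_pM2r nh) -normrM mulrBl mulrAC mulVf // mul1r.
  apply: le_trans (H _ hd) _.
  rewrite -real_normK ?num_real // expr2 mulrA ler_pM2r //.
  have := ler_norm K; have := ler_wpM2r (ltW nh) (ler_norm K); linear_arith.
split; first by apply/cvg_ex; exists l.
exact/cvg_lim.
Unshelve. all: by end_near. Qed.

Lemma mvt_le (f df : R -> R) (a b B : R) : a <= b ->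
  (forall t, a <= t <= b -> is_derive t 1 f (df t)) ->
  (forall t, a <= t <= b -> df t <= B) -> f b - f a <= B * (b - a).
Proof.
move=> ab fd dB.
have [||c /itvP cab ->] := @MVT_segment R f df a b ab.
- by move=> x /itvP xab; apply: fd; rewrite !xab.
- apply: derivable_within_continuous => x /itvP xab.
  by have /fd[] : a <= x <= b by rewrite !xab.
by rewrite ler_wpM2r ?subr_ge0 // dB // !cab.
Qed.

Lemma is_derive_line (f f' : C -> C) (a b k : C) (t : R) :
  hd f f' (a + t%:C * b) ->
  is_derive t 1 (fun x : R => complex.Re (k * f (a + x%:C * b)))
    (complex.Re (k * (b * f' (a + t%:C * b)))).
Proof.
move=> h.
have : hd (fun u => k * f (a + b * u)) (fun u => k * (b * f' (a + b * u))) t%:C.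
  apply: hd_ext (hdM (hd_cst k _) (@hd_affine _ f f' a b t%:C _)) => [//|u|].
    by rewrite mul0r add0r.
  by rewrite (mulrC b).
move=> [K [d [K0 d0 H]]]; apply: (is_derive_quad (K := K) d0) => x xd.
have e1 : t%:C + x%:C - t%:C = x%:C :> C by rewrite addrC addrA addNr add0r.
have := H (t%:C + x%:C) t%:C; rewrite e1 subrr nc0 nc_real => /(_ xd d0).
rewrite real_normK ?num_real //; apply: le_trans.
apply: le_trans (ler_Re_nc _); rewrite le_eqVlt; apply/orP; left; apply/eqP.
congr (`| _ |); rewrite !ReB rmorphD /= (mulrC _ b) (mulrC _ b); congr (_ - _ - _).
by rewrite Mreal.
Qed.

Lemma hd_mvt_nc (f f' : C -> C) (z0 z1 : C) (B : R) :
  (forall t : R, 0 <= t <= 1 -> hd f f' (z0 + t%:C * (z1 - z0))) ->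
  (forall t : R, 0 <= t <= 1 -> nc (f' (z0 + t%:C * (z1 - z0))) <= B) ->
  nc (f z1 - f z0) <= B * nc (z1 - z0).
Proof.
move=> H fB; have [k k1 kf] := phase_ex (f z1 - f z0).
have := @mvt_le _ _ 0 1 (B * nc (z1 - z0)) ler01
  (fun t ht => is_derive_line k (H t ht)).
have -> : z0 + 1%:C * (z1 - z0) = z1 by rewrite mul1r addrC subrK.
rewrite mul0r addr0 subr0 mulr1 -ReB -mulrBr kf /=; apply.
move=> t ht; apply: le_trans (Re_le_nc _) _.
by rewrite !ncM k1 mul1r mulrC ler_wpM2r ?nc_ge0 // fB.
Qed.

End RealCalculus.

(** * Mean value property and Cauchy estimates *)

Section MeanValue.
Variable R : realType.
Local Notation C := R[i].
Implicit Types (f : C -> C) (z c w : C) (e r s t B d : R).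

(** The exact order of [w] may be a proper divisor of [N]; [w != 1] is what makes the powers sum to
    zero. *)
Definition rot N (w : C) := [/\ (0 < N)%N, w ^+ N = 1, nc w = 1 & w != 1].

(** Iterated square roots of [-1], taken with nonnegative real part: then [nc (v + 1) ^+ 2 >= 2],
    and the factorisation of [v ^+ 2 - 1] at least halves the squared distance to 1 at each step. No
    trigonometric function is involved. *)
Lemma rot_small (e : R) : 0 < e -> exists N w, rot N w /\ nc (w - 1) < e.
Proof.
move=> e0.
have step k : exists2 w : C, rot (2 ^ k.+1) w & nc (w - 1) ^+ 2 <= 4 / 2 ^+ k.
  elim: k => [|k [w [N0 wN w1 wn1] wk]].
    exists (-1).
      split; rewrite ?expn_gt0 //; first by rewrite expn1 sqrrN expr1n.
        by rewrite ncN nc1.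
      by rewrite eq_sym -addr_eq0 -[1 + 1]/(2%:R) pnatr_eq0.
    rewrite -opprD ncN -[1 + 1]/(2%:R) nc_nat expr0 divr1.
    by rewrite expr2 -natrM.
  have [v v2 v0] : exists2 v : C, v ^+ 2 = w & 0 <= complex.Re v.
    have s2 := sqr_sqrtc w.
    have [h|h] := leP 0 (complex.Re (sqrtc w)); first by exists (sqrtc w).
    exists (- sqrtc w); first by rewrite sqrrN.
    by move: h; case: (sqrtc w) => a b /= h; rewrite oppr_ge0 ltW.
  have nv : nc v = 1.
    have := ncX v 2; rewrite v2 w1 => /esym/eqP; rewrite sqrf_eq1.
    by case/orP => /eqP // hv; have := nc_ge0 v; rewrite hv; linear_arith.
  exists v.
    split; rewrite ?expn_gt0 //; first by rewrite expnS exprM v2.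
    by apply: contra_neq wn1 => v1; rewrite -v2 v1 expr1n.
  have hp : 2 <= nc (v + 1) ^+ 2.
    have := nc_sqr v; rewrite nv expr1n nc_sqr.
    by move: v0; case: (v) => a b /= a0 h; nra.
  have fac : nc (w - 1) ^+ 2 = nc (v - 1) ^+ 2 * nc (v + 1) ^+ 2.
    rewrite -exprMn -ncM -v2; congr (nc _ ^+ 2); ring.
  rewrite fac in wk; have h0 := sqr_ge0 (nc (v - 1)).
  have -> : 4 / 2 ^+ k.+1 = (4 / 2 ^+ k) / 2 :> R by rewrite exprSr invfM mulrA.
  rewrite ler_pdivlMr // (le_trans _ wk) // ler_wpM2l //.
pose k := (Num.truncn (4 / e ^+ 2)).+1.
have [w rw wk] := step k; exists (2 ^ k.+1)%N, w; split => //.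
rewrite -(@ltr_pXn2r _ 2) ?nnegrE ?nc_ge0 ?(ltW e0) //.
apply: le_lt_trans wk _; rewrite ltr_pdivrMr ?exprn_gt0 //.
rewrite mulrC -ltr_pdivrMr ?exprn_gt0 //.
apply: lt_le_trans (truncnS_gt _) _.
by rewrite -natrX ler_nat ltnW // ltn_expl.
Qed.

Definition mean N (w : C) (f : C -> C) (c : C) (t : R) : C :=
  N%:R^-1 * \sum_(j < N) f (c + t%:C * w ^+ j).

Lemma rot_sum N w : rot N w -> \sum_(j < N) w ^+ j = 0.
Proof.
move=> [N0 wN _ w1]; have := subrX1 w N; rewrite wN subrr => /esym/eqP.
by rewrite mulf_eq0 subr_eq0 (negbTE w1) => /eqP.
Qed.

Lemma rotX N w j : rot N w -> nc (w ^+ j) = 1.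
Proof. by move=> [_ _ w1 _]; rewrite ncX w1 expr1n. Qed.

Lemma nc_average N (F : 'I_N -> C) (B : R) : (0 < N)%N ->
  (forall j, nc (F j) <= B) -> nc (N%:R^-1 * \sum_(j < N) F j) <= B.
Proof.
move=> N0 FB; have Nr : (0 : R) < N%:R by rewrite ltr0n.
rewrite ncM ncV nc_nat -(ler_pM2l Nr) mulrA divff ?gt_eqF // mul1r.
apply: le_trans (nc_sum _ _ _) _.
apply: le_trans (ler_sum _ (fun j _ => FB j)) _.
by rewrite sumr_const card_ord -[B *+ N]mulr_natl.
Qed.

Lemma annulus_circle (c w : C) (s r t : R) : nc w = 1 -> 0 <= s -> s <= t <= r ->
  annulus c s r (c + t%:C * w).
Proof.
move=> w1 s0 /andP[st tr]; rewrite /annulus /= addrC addKr ncM nc_real w1 mulr1.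
by rewrite ger0_norm ?st ?tr // (le_trans s0).
Qed.

(* The telescoping sum of [f] around the circle bounds the mean of
   [w^j f'(c + t w^j)], which is the derivative in [t] of the mean of [f]. *)
Lemma mean_value f f' c s r (e : R) : 0 <= s -> s <= r ->
  (forall z, annulus c s r z -> hd f f' z) -> 0 < e ->
  exists2 d : R, 0 < d & forall N w, rot N w -> nc (w - 1) < d ->
    forall t, s <= t <= r -> nc (mean N w f c t - mean N w f c s) <= e.
Proof.
move=> s0 sr H e0; have [K [d [K0 d0 Kd]]] := hd_unif H.
have r0 : 0 <= r by linear_arith.
have M0 : 0 < K * r ^+ 2 + 1 by have := mulr_ge0 K0 (sqr_ge0 r); linear_arith.
have r1 : 0 < r + 1 by linear_arith.
(* The first bound keeps neighbouring points of the circle within the uniformity radius [d]; the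
   second makes [K * r ^+ 2 * nc (w - 1)] at most [e]. *)
exists (Num.min (d / (r + 1)) (e / (K * r ^+ 2 + 1))).
  by rewrite lt_min !divr_gt0.
move=> N w rw; rewrite lt_min !ltr_pdivlMr // => /andP[wd we] t /andP[st tr].
have [N0 wN w1 wn1] := rw.
have n0 : 0 < nc (w - 1) by rewrite nc_gt0 subr_eq0.
have Nr : (0 : R) < N%:R by rewrite ltr0n.
have E x : s <= x <= r ->
    nc (N%:R^-1 * \sum_(j < N) (w ^+ j * f' (c + x%:C * w ^+ j))) <=
    K * r * nc (w - 1).
  move=> /[dup] sxr /andP[sx xr].
  (* The telescoping argument divides by [x]; at radius 0 the sum is a multiple of the vanishing sum
     of the powers of [w]. *)
  have [x0|xn0] := eqVneq x 0.
    rewrite x0; under eq_bigr do rewrite mul0r addr0.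
    by rewrite -mulr_suml (rot_sum rw) mul0r mulr0 nc0 !mulr_ge0 // ltW.
  have x0 : 0 < x by rewrite lt0r xn0 (le_trans s0).
  have := telescope_sumr (fun j => f (c + x%:C * w ^+ j)) (leq0n N).
  rewrite wN expr0 subrr big_mkord => tel.
  have Ab j : annulus c s r (c + x%:C * w ^+ j).
    by apply: annulus_circle => //; exact: rotX rw.
  have step (j : 'I_N) : nc (f (c + x%:C * w ^+ j.+1) - f (c + x%:C * w ^+ j) -
      x%:C * (w - 1) * (w ^+ j * f' (c + x%:C * w ^+ j))) <=
      K * x ^+ 2 * nc (w - 1) ^+ 2.
    have e1 : c + x%:C * w ^+ j.+1 - (c + x%:C * w ^+ j) = x%:C * (w - 1) * w ^+ j.
      by rewrite exprS; ring.
    have n1 : nc (x%:C * (w - 1) * w ^+ j) = x * nc (w - 1).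
      by rewrite !ncM (rotX _ rw) nc_real gtr0_norm ?mulr1.
    have := Kd _ _ (Ab j.+1) (Ab j); rewrite e1 n1.
    have -> : f' (c + x%:C * w ^+ j) * (x%:C * (w - 1) * w ^+ j) =
      x%:C * (w - 1) * (w ^+ j * f' (c + x%:C * w ^+ j)) by ring.
    rewrite exprMn (mulrA K) => -> //; apply: le_lt_trans wd.
    by rewrite mulrC ler_wpM2l ?nc_ge0//; linear_arith.
  have := nc_average N0 step.
  rewrite sumrB tel sub0r -mulr_sumr mulrN ncN mulrCA ncM ncM nc_real gtr0_norm //.
  set S := nc (_ * \sum_(_ < _) _) => h.
  have {}h : S * (x * nc (w - 1)) <= K * x * nc (w - 1) * (x * nc (w - 1)).
    by move: h; rewrite !expr2; linear_arith.
  rewrite ler_pM2r ?mulr_gt0 // in h; apply: le_trans h _.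
  by rewrite ler_wpM2r ?nc_ge0 // ler_wpM2l.
have [k k1 kf] := phase_ex (mean N w f c t - mean N w f c s).
pose F (x : R) := complex.Re (k * mean N w f c x).
pose dF (x : R) := complex.Re (k * (N%:R^-1 * \sum_(j < N) (w ^+ j * f' (c + x%:C * w ^+ j)))).
have dFE (x : R) : s <= x <= t -> is_derive x 1 F (dF x).
  move=> /andP[sx xt].
  have xr : s <= x <= r by rewrite sx (le_trans xt).
  have dj (j : 'I_N) : is_derive x 1
      (fun y : R => complex.Re (k * N%:R^-1 * f (c + y%:C * w ^+ j)))
      (complex.Re (k * N%:R^-1 * (w ^+ j * f' (c + x%:C * w ^+ j)))).
    by apply: is_derive_line; apply: H; apply: annulus_circle => //; exact: rotX rw.
  have := is_derive_sum dj.
  have -> : \sum_(i < N) (fun y : R => complex.Re (k * N%:R^-1 * f (c + y%:C * w ^+ i)))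
     = F.
    apply/funext => y; rewrite fct_sumE /F /mean mulrA mulr_sumr Re_sum.
    by [].
  by rewrite /dF mulrA mulr_sumr Re_sum.
have := @mvt_le _ F dF s t (K * r * nc (w - 1)) st dFE.
rewrite /F -ReB -mulrBr kf /=.
move=> /(_ _)/le_trans; apply.
  move=> x /andP[sx xt]; apply: le_trans (Re_le_nc _) _.
  by rewrite ncM k1 mul1r E // sx (le_trans xt).
have h1 : t - s <= r by linear_arith.
have h2 : 0 <= K * r * nc (w - 1) by rewrite !mulr_ge0 // ltW.
apply: le_trans (ler_wpM2l h2 h1) _; move: we; rewrite expr2; linear_arith.
Qed.

Lemma mean0 N w f (c : C) : (0 < N)%N -> mean N w f c 0 = f c.
Proof.
move=> N0; rewrite /mean; under eq_bigr do rewrite mul0r addr0.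
rewrite sumr_const card_ord -[f c *+ N]mulr_natl mulrA mulVf ?mul1r //.
by rewrite pnatr_eq0 -lt0n.
Qed.

Lemma max_principle f f' c (r B : R) : 0 <= r ->
  (forall z, nc (z - c) <= r -> hd f f' z) ->
  (forall z, nc (z - c) = r -> nc (f z) <= B) -> nc (f c) <= B.
Proof.
move=> r0 H fB; apply/ler_addgt0Pl => e e0.
have [z /andP[_ /H]//|d d0 D] := @mean_value f f' c 0 r e (lexx _) r0 _ e0.
have [N [w [rw wd]]] := rot_small d0; have [N0 _ w1 _] := rw.
have := D _ _ rw wd r; rewrite r0 lexx mean0 // => /(_ isT) h.
have := nc_lerB (f c) (mean N w f c r); rewrite ncBC.
have : nc (mean N w f c r) <= B; last linear_arith.
apply: nc_average => // j; apply: fB.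
by rewrite addrC addKr ncM (rotX _ rw) nc_real ger0_norm // mulr1.
Qed.

(** The mean value property compares the means of the difference quotient [q] at [c] over two
    circles: on a tiny one it is close to [f' c], on the outer one it is at most [2 * B / r],
    because [nc (f z - f c) <= 2 * B]. *)
Lemma cauchy_estimate f f' c (r B : R) : 0 < r ->
  (forall z, nc (z - c) <= r -> hd f f' z) ->
  (forall z, nc (z - c) <= r -> nc (f z) <= B) -> nc (f' c) * r <= 2 * B.
Proof.
move=> r0 H fB.
have cc : nc (c - c) <= r by rewrite subrr nc0 ltW.
pose q z := (f z - f c) * (z - c)^-1.
pose q' z := (f' z - 0) * (z - c)^-1 + (f z - f c) * (- (1 - 0) / (z - c) ^+ 2).
have hq z : 0 < nc (z - c) -> hd f f' z -> hd q q' z.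
  rewrite nc_gt0 => zc fz.
  exact: hdM (hdB fz (hd_cst (f c) z))
    (@hdV _ (fun u => u - c) _ z zc (hdB (hd_id z) (hd_cst c z))).
rewrite mulrC -ler_pdivlMl // mulrC; apply/ler_addgt0Pl => e e0.
have [K [d [K0 d0 Hc]]] := H c cc.
have K1 : 0 < K + 1 by linear_arith.
pose s := Num.min r (Num.min (d / 2) (e / 2 / (K + 1))).
have s0 : 0 < s by rewrite !lt_min r0 !divr_gt0.
have sr : s <= r by rewrite ge_min lexx.
have sd : s < d by rewrite !gt_min; apply/orP; right; apply/orP; left; linear_arith.
have se : s * (K + 1) <= e / 2.
  by rewrite -ler_pdivlMr // !ge_min lexx !orbT.
have e2 : 0 < e / 2 by linear_arith.
have [z /andP[sz zr]|D D0 DN] := @mean_value q q' c s r (e / 2) (ltW s0) sr _ e2.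
  by apply: hq; [exact: lt_le_trans sz|exact: H].
have [N [w [rw wd]]] := rot_small D0; have [N0 _ w1 _] := rw.
have := DN _ _ rw wd r; rewrite sr lexx => /(_ isT) h.
have circ t (j : 'I_N) : 0 <= t -> nc (c + t%:C * w ^+ j - c) = t.
  by move=> t0; rewrite addrC addKr ncM (rotX _ rw) nc_real ger0_norm // mulr1.
have h1 : nc (mean N w q c r) <= 2 * B / r.
  apply: nc_average => // j; rewrite /q ncM ncV circ ?(ltW r0) //.
  rewrite ler_wpM2r ?invr_ge0 ?(ltW r0) //; apply: le_trans (ncB _ _) _.
  by rewrite mulr_natl mulr2n lerD // fB ?circ // ltW.
have h2 : nc (mean N w q c s - f' c) <= e / 2.
  have -> : mean N w q c s - f' c =
      N%:R^-1 * \sum_(j < N) (q (c + s%:C * w ^+ j) - f' c).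
    rewrite sumrB mulrBr sumr_const card_ord -[f' c *+ N]mulr_natl mulrA.
    by rewrite mulVf ?mul1r // pnatr_eq0 -lt0n.
  apply: nc_average => // j; set u := c + _.
  have us : nc (u - c) = s by rewrite circ // ltW.
  have uc0 : u - c != 0 by rewrite -nc_gt0 us.
  have -> : q u - f' c = (f u - f c - f' c * (u - c)) / (u - c).
    by rewrite /q; field.
  rewrite ncM ncV us ler_pdivrMr //.
  have := Hc u c; rewrite us subrr nc0 => /(_ sd d0) /le_trans; apply.
  by rewrite expr2 mulrA ler_pM2r //; linear_arith.
have := nc_distD (mean N w q c s) (f' c) 0.
have := nc_lerB (f' c) (mean N w q c s); rewrite (ncBC (f' c)).
have := nc_lerB (mean N w q c s) (mean N w q c r).
by rewrite (ncBC (mean N w q c s) (mean N w q c r)); linear_arith.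
Qed.

End MeanValue.

(** * Growth of functions with bounded spherical derivative *)

Section Growth.
Variable R : realType.
Local Notation C := R[i].
Implicit Types (f G : C -> C) (z c w : C) (e r s t B d : R).

Lemma is_derive_ln_comp (g : R -> R) t l : 0 < g t -> is_derive t 1 g l ->
  is_derive t 1 (fun x => ln (g x)) ((g t)^-1 * l).
Proof. by move=> g0 hg; exact: (is_derive1_comp (is_derive1_ln g0) hg). Qed.

Lemma is_derive_add1 (g : R -> R) t l : is_derive t 1 g l ->
  is_derive t 1 (fun x => 1 + g x) l.
Proof.
move=> hg; have h := is_deriveD (is_derive_cst (1 : R) t 1) hg.
by apply: is_derive_eq; rewrite add0r.
Qed.

Lemma is_derive_scale (k : R) (g : R -> R) t l : is_derive t 1 g l ->
  is_derive t 1 (fun x => k * g x) (k * l).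
Proof. by move=> hg; exact: (is_deriveZ k hg). Qed.

Lemma is_derive_ncsq G G' (a b : C) t : hd G G' (a + t%:C * b) ->
  is_derive t 1 (fun x : R => nc (G (a + x%:C * b)) ^+ 2)
    (2 * complex.Re ((conjc (G (a + t%:C * b))) * (b * G' (a + t%:C * b)))).
Proof.
move=> hG.
have hX := is_derive_line 1 hG; have hY := is_derive_line (- 'i) hG.
have h := is_deriveD (is_deriveM hX hX) (is_deriveM hY hY).
have -> : (fun x : R => nc (G (a + x%:C * b)) ^+ 2) =
  (fun x : R => complex.Re (1 * G (a + x%:C * b))) *
  (fun x : R => complex.Re (1 * G (a + x%:C * b))) +
  (fun x : R => complex.Re (- 'i * G (a + x%:C * b))) *
  (fun x : R => complex.Re (- 'i * G (a + x%:C * b))).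
  apply/funext => x; rewrite nc_sqr !fctE mul1r.
  by case: (G _) => p q /=; ring.
apply: is_derive_eq.
move: (G (a + t%:C * b)) (b * G' (a + t%:C * b)) => [p q] [p' q'].
by rewrite /GRing.scale /=; ring.
Qed.

Lemma is_derive_ln_ncsq G G' (a b : C) t : G (a + t%:C * b) != 0 ->
  hd G G' (a + t%:C * b) ->
  is_derive t 1 (fun x : R => ln (nc (G (a + x%:C * b)) ^+ 2))
    (2 * complex.Re (b * (G' (a + t%:C * b) / G (a + t%:C * b)))).
Proof.
move=> G0 hG; have n0 : 0 < nc (G (a + t%:C * b)) ^+ 2.
  by rewrite exprn_gt0 // nc_gt0.
have h := @is_derive_ln_comp (fun x : R => nc (G (a + x%:C * b)) ^+ 2) t _ n0
  (is_derive_ncsq hG).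
apply: is_derive_eq.
rewrite mulrCA; congr (2 * _).
have -> : b * (G' (a + t%:C * b) / G (a + t%:C * b)) =
   ((nc (G (a + t%:C * b)) ^+ 2)^-1)%:C *
     ((conjc (G (a + t%:C * b))) * (b * G' (a + t%:C * b))).
  rewrite fmorphV /= -mulcJ invfM.
  have c0 : (conjc (G (a + t%:C * b))) != 0 by rewrite -nc_gt0 ncconj nc_gt0.
  by move: ((conjc (G (a + t%:C * b)))) c0 => X c0; field; rewrite c0 G0.
by rewrite realM.
Qed.

Lemma conjM (x y : C) : (conjc (x * y)) = (conjc x) * (conjc y).
Proof. exact: rmorphM. Qed.

Lemma ReReM (x y : C) :
  2 * (complex.Re x * complex.Re y) = complex.Re (x * y) + complex.Re ((conjc x) * y).
Proof. by case: x => a b; case: y => p q /=; ring. Qed.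

(* The weights [1 - Re (k w^j)] are nonnegative and isolate, in the mean of
   [ln |G|^2], the value and the derivative at the centre. *)
Lemma borel_caratheodory G G' G'' c r : 0 < r ->
  (forall z, nc (z - c) <= r -> [/\ hd G G' z, hd G' G'' z & 1 <= nc (G z)]) ->
  nc (G' c) * r <= nc (G c) * ln (nc (G c) ^+ 2).
Proof.
move=> r0 H.
have cc : nc (c - c) <= r by rewrite subrr nc0 ltW.
have Gc0 z : nc (z - c) <= r -> G z != 0.
  by move=> /H[_ _ h]; rewrite -nc_gt0 (lt_le_trans ltr01).
pose phi z := G' z * (G z)^-1.
(* On the circle of radius [x] these are [x * w ^+ j * phi] and [x ^+ 2 * w ^+ j ^+ 2 * phi]. Both
   vanish at [c], so their means nearly vanish. *)
pose phi1 z := (z - c) * phi z; pose phi2 z := (z - c) * phi1 z.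
pose phi' z := G'' z * (G z)^-1 + G' z * (- G' z / G z ^+ 2).
have hphi z : nc (z - c) <= r -> hd phi phi' z.
  move=> /[dup] /Gc0 z0 /H[h1 h2 _]; exact: hdM h2 (hdV z0 h1).
have hlin z : hd (fun u => u - c) (fun=> 1 - 0) z := hdB (hd_id z) (hd_cst c z).
have hphi1 z (zr : nc (z - c) <= r) := hdM (hlin z) (hphi z zr).
have hphi2 z (zr : nc (z - c) <= r) := hdM (hlin z) (hphi1 z zr).
have ann z : annulus c 0 r z -> nc (z - c) <= r by move=> /andP[].
have [B B0 HB] := hd_bounded (fun z Az => hphi z (ann z Az)).
have [k k1 kf] := phase_ex (phi c).
pose b := (conjc k).
have b1 : nc b = 1 by rewrite ncconj.
have bk : (conjc b) = k by rewrite /b conjcK.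
have nGc : 0 < nc (G c) by rewrite nc_gt0 Gc0.
suff main : nc (phi c) * r <= ln (nc (G c) ^+ 2).
  rewrite -ler_pdivrMl // mulrA (le_trans _ main) // ler_wpM2r ?(ltW r0) //.
  by rewrite /phi ncM ncV mulrC.
apply/ler_addgt0Pl => e e0.
have Bp : 0 < 4 * B + nc (phi c) + 1 by have := nc_ge0 (phi c); linear_arith.
(* The radial integration starts at [s > 0] because the derivative estimate divides by [x]; [s] is
   small enough for the sum at [s] to be close to its value at the centre. *)
pose s := Num.min r (e / 2 / (4 * B + nc (phi c) + 1)).
have s0 : 0 < s by rewrite lt_min r0 !divr_gt0.
have sr : s <= r by rewrite ge_min lexx.
have se : s * (4 * B + nc (phi c) + 1) <= e / 2.
  by rewrite -ler_pdivlMr // ge_min lexx orbT.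
have si : 0 < s^-1 by rewrite invr_gt0.
have W0 : 0 < 2 * s^-1 + s^-1 ^+ 2 + 1.
  by have := exprn_gt0 2 si; linear_arith.
pose e1 := e / 2 / r / (2 * s^-1 + s^-1 ^+ 2 + 1).
have e10 : 0 < e1 by rewrite !divr_gt0.
have [d0 d00 D0] := mean_value (lexx 0) (ltW r0) (fun z Az => hphi z (ann z Az)) e10.
have [d1 d10 D1] := mean_value (lexx 0) (ltW r0) (fun z Az => hphi1 z (ann z Az)) e10.
have [d2 d20 D2] := mean_value (lexx 0) (ltW r0) (fun z Az => hphi2 z (ann z Az)) e10.
have dm : 0 < Num.min d0 (Num.min d1 d2) by rewrite !lt_min d00 d10.
have [N [w [rw]]] := rot_small dm; rewrite !lt_min => /andP[w0 /andP[w1 w2]].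
have [N0 _ _ _] := rw.
have circ t (j : 'I_N) : 0 <= t -> nc (c + t%:C * w ^+ j - c) = t.
  by move=> t0; rewrite addrC addKr ncM (rotX _ rw) nc_real ger0_norm // mulr1.
pose T (x : R) := \sum_(j < N)
  (1 - complex.Re (b * w ^+ j)) * ln (nc (G (c + x%:C * w ^+ j)) ^+ 2).
pose dT (x : R) := \sum_(j < N) (1 - complex.Re (b * w ^+ j)) *
  (2 * complex.Re (w ^+ j * phi (c + x%:C * w ^+ j))).
have wt (j : 'I_N) : 0 <= 1 - complex.Re (b * w ^+ j) <= 2.
  have := ler_Re_nc (b * w ^+ j); rewrite ncM b1 (rotX _ rw) mulr1 ler_norml.
  by move=> /andP[? ?]; apply/andP; split; linear_arith.
have dTE x : 0 <= x <= r -> is_derive x 1 T (dT x).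
  move=> /andP[x0 xr].
  have dj (j : 'I_N) : is_derive x 1
      (fun y : R => (1 - complex.Re (b * w ^+ j)) * ln (nc (G (c + y%:C * w ^+ j)) ^+ 2))
      ((1 - complex.Re (b * w ^+ j)) *
        (2 * complex.Re (w ^+ j * phi (c + x%:C * w ^+ j)))).
    have zr : nc (c + x%:C * w ^+ j - c) <= r by rewrite circ.
    have [h1 _ _] := H _ zr.
    exact: is_derive_scale (is_derive_ln_ncsq (Gc0 _ zr) h1).
  have := is_derive_sum dj.
  by rewrite (_ : \sum_(i < N) _ = T) //; apply/funext => y; rewrite fct_sumE.
have dTle x : s <= x <= r -> dT x <= N%:R * (e / 2 / r - nc (phi c)).
  move=> /andP[sx xr].
  have x0 : 0 < x := lt_le_trans s0 sx.
  have xr0 : 0 <= x <= r by rewrite ltW.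
  (* Product-to-sum with [u = w ^+ j] of modulus 1: the weight times [2 * Re (u * phi)] is [Re (2 *
     u * phi - b * u ^+ 2 * phi - k * phi)]. The first two means are small, and the third is close
     to [k * phi c = nc (phi c)]. *)
  have term (j : 'I_N) : (1 - complex.Re (b * w ^+ j)) *
      (2 * complex.Re (w ^+ j * phi (c + x%:C * w ^+ j))) =
    complex.Re (2 * x%:C^-1 * phi1 (c + x%:C * w ^+ j)
      - b * x%:C^-1 ^+ 2 * phi2 (c + x%:C * w ^+ j) - k * phi (c + x%:C * w ^+ j)).
    have xc0 : x%:C != 0 :> C by rewrite -nc_gt0 nc_real normr_gt0 gt_eqF.
    rewrite /phi2 /phi1; set u := w ^+ j; set z := c + _.
    have -> : z - c = x%:C * u by rewrite /z addrC addKr.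
    rewrite mulrBl mul1r (mulrCA (complex.Re (b * u)) 2) ReReM !ReB opprD addrA; congr (_ - _ - _).
    - have -> : 2 * x%:C^-1 * (x%:C * u * phi z) = 2%:C * (u * phi z).
        by rewrite rmorph_nat; field.
      by rewrite realM.
    - by congr complex.Re; field.
    - congr complex.Re.
      have -> : (conjc (b * u)) * (u * phi z) = (conjc b) * (u * (conjc u)) * phi z.
        by rewrite conjM; ring.
      by rewrite mulcJ (rotX _ rw) expr1n mulr1 bk.
  have -> : dT x = N%:R * complex.Re (2 * x%:C^-1 * mean N w phi1 c x
      - b * x%:C^-1 ^+ 2 * mean N w phi2 c x - k * mean N w phi c x).
    rewrite /dT (eq_bigr _ (fun j _ => term j)) -Re_sum.
    have Nc : N%:R != 0 :> C by rewrite pnatr_eq0 -lt0n.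
    have -> : (N%:R : R) = (N%:R : R) by [].
    rewrite -realM rmorph_nat; congr complex.Re.
    rewrite !sumrB -!mulr_sumr /mean.
    by field; rewrite Nc -nc_eq0 nc_real normr_eq0 gt_eqF.
  rewrite ler_wpM2l ?ler0n // !ReB.
  have h0 := D0 _ _ rw w0 _ xr0; have h1 := D1 _ _ rw w1 _ xr0.
  have h2 := D2 _ _ rw w2 _ xr0.
  rewrite !mean0 // in h0 h1 h2.
  rewrite /phi1 subrr mul0r subr0 in h1.
  rewrite /phi2 /phi1 subrr !mul0r subr0 in h2.
  move: h0 h1 h2; rewrite -/phi1 -/phi2.
  move: (mean N w phi c x) (mean N w phi1 c x) (mean N w phi2 c x) => X X1 X2 h0 h1 h2.
  have xi : x^-1 <= s^-1 by rewrite lef_pV2.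
  have xi0 : 0 <= x^-1 by rewrite invr_ge0 ltW.
  have i1 : complex.Re (2 * x%:C^-1 * X1) <= 2 * s^-1 * e1.
    apply: le_trans (Re_le_nc _) _; rewrite !ncM ncV nc_nat nc_real gtr0_norm //.
    by rewrite ler_pM ?nc_ge0 ?mulr_ge0 // ler_wpM2l.
  have i2 : - complex.Re (b * x%:C^-1 ^+ 2 * X2) <= s^-1 ^+ 2 * e1.
    apply: le_trans (ler_norm _) _; rewrite normrN; apply: le_trans (ler_Re_nc _) _.
    rewrite ncM (ncM b) ncX b1 mul1r ncV nc_real gtr0_norm //.
    by rewrite ler_pM ?nc_ge0 ?exprn_ge0 // lerXn2r // nnegrE // ltW.
  have i3 : - complex.Re (k * X) <= e1 - nc (phi c).
    have -> : nc (phi c) = complex.Re (k * phi c) by rewrite kf.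
    rewrite lerBrDr addrC -ReB -mulrBr; apply: le_trans (Re_le_nc _) _.
    by rewrite ncM k1 mul1r ncBC.
  have : e1 * (2 * s^-1 + s^-1 ^+ 2 + 1) = e / 2 / r by rewrite divfK // gt_eqF.
  by linear_arith.
have Tr0 : 0 <= T r.
  apply: sumr_ge0 => j _; have /andP[h _] := wt j; apply: mulr_ge0 => //.
  apply: ln_ge0; rewrite -[1](expr1n _ 2) lerXn2r ?nnegrE ?nc_ge0 //.
  by have [] := H (c + r%:C * w ^+ j); rewrite ?circ // ltW.
have Ts : T s <= N%:R * (ln (nc (G c) ^+ 2) + 4 * B * s).
  have lnc (j : 'I_N) : ln (nc (G (c + s%:C * w ^+ j)) ^+ 2) <=
      ln (nc (G c) ^+ 2) + 2 * B * s.
    have := @mvt_le _ (fun y : R => ln (nc (G (c + y%:C * w ^+ j)) ^+ 2))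
      (fun x => 2 * complex.Re (w ^+ j * phi (c + x%:C * w ^+ j))) 0 s (2 * B) (ltW s0).
    rewrite subr0 mul0r addr0 lerBlDl; apply.
      move=> x /andP[x0 xs]; apply: is_derive_ln_ncsq.
        by apply: Gc0; rewrite circ // (le_trans xs).
      by have [] := H (c + x%:C * w ^+ j); rewrite ?circ // (le_trans xs).
    move=> x /andP[x0 xs]; rewrite ler_pM2l //; apply: le_trans (Re_le_nc _) _.
    rewrite ncM (rotX _ rw) mul1r.
    have Ax : annulus c 0 r (c + x%:C * w ^+ j).
      by rewrite /annulus /= circ // x0 (le_trans xs).
    by have [] := HB _ Ax.
  have -> : N%:R * (ln (nc (G c) ^+ 2) + 4 * B * s) = \sum_(j < N)
     ((1 - complex.Re (b * w ^+ j)) * ln (nc (G c) ^+ 2) + 4 * B * s).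
    rewrite big_split /= sumr_const card_ord -mulr_suml sumrB sumr_const card_ord.
    rewrite -Re_sum -mulr_sumr (rot_sum rw) mulr0 /= subr0.
    by rewrite -[4 * B * s *+ N]mulr_natl mulrDr.
  apply: ler_sum => j _; have /andP[h1 h2] := wt j.
  apply: le_trans (ler_wpM2l h1 (lnc j)) _; rewrite mulrDr lerD2l.
  have : 0 <= 2 * B * s by rewrite !mulr_ge0 // ltW.
  by move=> /(ler_wpM2r); move=> /(_ _ _ h2); linear_arith.
have dTE' x : s <= x <= r -> is_derive x 1 T (dT x).
  by move=> /andP[sx xr]; apply: dTE; rewrite (le_trans (ltW s0)).
have h := mvt_le sr dTE' dTle.
have Nr : (0 : R) < N%:R by rewrite ltr0n.
have : N%:R * 0 <= N%:R * (ln (nc (G c) ^+ 2) + 4 * B * s +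
    (e / 2 / r - nc (phi c)) * (r - s)).
  by rewrite mulr0; linear_arith.
rewrite ler_pM2l // => {}h.
have h1 : e / 2 / r * (r - s) <= e / 2.
  have e2 : 0 < e / 2 / r by rewrite !divr_gt0.
  apply: (@le_trans _ _ (e / 2 / r * r)); first by rewrite ler_pM2l //; linear_arith.
  by rewrite divfK // gt_eqF.
linear_arith.
Qed.

Lemma segment_in_disc c z0 z1 r t : nc (z0 - c) <= r -> nc (z1 - c) <= r ->
  0 <= t <= 1 -> nc (z0 + t%:C * (z1 - z0) - c) <= r.
Proof.
move=> h0 h1 /andP[t0 t1].
have -> : z0 + t%:C * (z1 - z0) - c = (1 - t)%:C * (z0 - c) + t%:C * (z1 - c).
  by rewrite rmorphB rmorph1; ring.
apply: le_trans (ncD _ _) _; rewrite !ncM !nc_real !ger0_norm ?subr_ge0 //.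
have t1' : 0 <= 1 - t by linear_arith.
have := ler_wpM2l t0 h1; have := ler_wpM2l t1' h0; linear_arith.
Qed.

Lemma Re_conjM_le (x y : C) : complex.Re ((conjc x) * y) <= nc x * nc y.
Proof. by apply: le_trans (Re_le_nc _) _; rewrite ncM ncconj. Qed.

Lemma Re_conjM_ge (x y : C) : - (nc x * nc y) <= complex.Re ((conjc x) * y).
Proof.
have := ler_Re_nc ((conjc x) * y); rewrite ncM ncconj ler_norml => /andP[]; linear_arith.
Qed.

(* [1 / (1 + |f|^2)] is Lipschitz with constant [M]. *)
Lemma large_nearby f f' c d M : 0 < d -> 0 <= M -> M * d <= 4^-1 ->
  (forall z, nc (z - c) <= d -> hd f f' z /\ nc (f' z) <= M * (1 + nc (f z) ^+ 2)) ->
  3 <= nc (f c) ^+ 2 -> forall z, nc (z - c) <= d -> 1 <= nc (f z).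
Proof.
move=> d0 M0 Md H fc z zd.
have cc : nc (c - c) <= d by rewrite subrr nc0 ltW.
pose N (x : R) := nc (f (c + x%:C * (z - c))) ^+ 2.
pose dN (x : R) := 2 * complex.Re ((conjc (f (c + x%:C * (z - c)))) *
   ((z - c) * f' (c + x%:C * (z - c)))).
have N0 x : 0 <= N x by exact: sqr_ge0.
have N1 x : 1 + N x != 0 by rewrite gt_eqF //; have := N0 x; linear_arith.
have seg (x : R) (h : 0 <= x <= 1) := segment_in_disc cc zd h.
have dE (x : R) : 0 <= x <= 1 ->
    is_derive x 1 (fun y => - (1 + N y)^-1) (dN x / (1 + N x) ^+ 2).
  move=> /seg/H[hf _].
  have h1 := is_derive_add1 (is_derive_ncsq hf).
  have h2 := is_deriveN (is_deriveV (f := fun y => 1 + N y) (N1 x) h1).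
  by apply: is_derive_eq; rewrite scaleNr opprK /GRing.scale /= mulrC.
have dle (x : R) : 0 <= x <= 1 -> - (dN x / (1 + N x) ^+ 2) <= 4^-1.
  move=> /[dup] hx /seg/H[_ hM]; set fx := nc (f (c + x%:C * (z - c))) in hM.
  have fx0 : 0 <= fx by exact: nc_ge0.
  have : - dN x <= 2 * (fx * (nc (z - c) * nc (f' (c + x%:C * (z - c))))).
    by rewrite -ncM /dN; have := Re_conjM_ge (f (c + x%:C * (z - c)))
       ((z - c) * f' (c + x%:C * (z - c))); rewrite -/fx; linear_arith.
  have h1 : nc (z - c) * nc (f' (c + x%:C * (z - c))) <= 4^-1 * (1 + fx ^+ 2).
    apply: (@le_trans _ _ (d * (M * (1 + fx ^+ 2)))).
      by rewrite ler_pM ?nc_ge0.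
    by rewrite mulrA (mulrC d) ler_wpM2r // addr_ge0 // sqr_ge0.
  have h2 := ler_wpM2l fx0 h1 => h3.
  rewrite -mulNr ler_pdivrMr; last by rewrite exprn_gt0 // lt0r N1 addr_ge0.
  apply: le_trans h3 _; have -> : N x = fx ^+ 2 by [].
  have : 0 <= (1 + fx ^+ 2) * (fx - 1) ^+ 2.
    by rewrite mulr_ge0 ?sqr_ge0 // addr_ge0 // sqr_ge0.
  have : (1 + fx ^+ 2) * (fx - 1) ^+ 2 = (1 + fx ^+ 2) ^+ 2 - 2 * (fx * (1 + fx ^+ 2)).
    by ring.
  by linear_arith.
have := mvt_le ler01 (fun x hx => is_deriveN (dE x hx)) dle.
rewrite /N !fctE !opprK mul0r addr0 mul1r (addrC c) subrK subr0 mulr1.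
move=> h; rewrite leNgt; apply/negP => f1.
have f1' : nc (f z) ^+ 2 < 1 by rewrite expr_lt1 // nc_ge0.
(* At [c] the function is at most 1/4 and it grows by at most [M * d <= 1/4], whereas [nc (f z) < 1]
   would make it exceed 1/2. *)
have g1 : (1 + nc (f c) ^+ 2)^-1 <= 4^-1.
  by rewrite lef_pV2 ?posrE ?ltr0n //; linear_arith.
have g2 : 2^-1 < (1 + nc (f z) ^+ 2)^-1.
  by rewrite ltf_pV2 ?posrE ?ltr0n //; have := sqr_ge0 (nc (f z)); linear_arith.
linear_arith.
Qed.

(** The spherical bound keeps [f] off the unit disc near [c], so [ln (nc f ^+ 2)] is a nonnegative
    harmonic function there. This improves the a priori growth |f|^2 of the derivative to |f| ln
    |f|, which no function with a pole satisfies. *)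
Lemma growth_bound f f' f'' c d M : 0 < d -> 0 <= M -> M * d <= 4^-1 ->
  (forall z, nc (z - c) <= d -> [/\ hd f f' z, hd f' f'' z &
     nc (f' z) <= M * (1 + nc (f z) ^+ 2)]) ->
  3 <= nc (f c) ^+ 2 -> nc (f' c) * d <= nc (f c) * ln (nc (f c) ^+ 2).
Proof.
move=> d0 M0 Md H fc; apply: (borel_caratheodory (G'' := f'')) => // z zd.
have [h1 h2 _] := H z zd; split=> //.
by apply: (large_nearby (f' := f') d0 M0 Md _ fc zd) => u /H[? _ ?]; split.
Qed.

(** In this scale, unlike in the spherical metric, infinity is infinitely far away: a Lipschitz
    bound carries boundedness, or divergence, from one point to a whole disc. *)
Definition loglog (x : R) := ln (1 + ln (1 + x ^+ 2)).

Lemma le_loglog x y : 0 <= x -> x <= y -> loglog x <= loglog y.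
Proof.
move=> x0 xy; have y0 := le_trans x0 xy.
have pos u : 0 < 1 + u ^+ 2 :> R by have := sqr_ge0 u; linear_arith.
have lpos u : 0 < 1 + ln (1 + u ^+ 2) :> R.
  by have : 0 <= ln (1 + u ^+ 2) by [apply: ln_ge0; rewrite lerDl sqr_ge0]; linear_arith.
rewrite /loglog ler_ln ?posrE // lerD2l ler_ln ?posrE // lerD2l.
by rewrite lerXn2r // nnegrE.
Qed.

Lemma loglog_inv B : exists2 A : R, 0 <= A & forall x, 0 <= x -> loglog x <= B -> x <= A.
Proof.
exists (expR (expR B)); first exact: expR_ge0.
move=> x x0; have pos : 0 < 1 + x ^+ 2 by have := sqr_ge0 x; linear_arith.
have l0 : 0 <= ln (1 + x ^+ 2) by apply: ln_ge0; rewrite lerDl sqr_ge0.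
rewrite /loglog -ler_expR lnK ?posrE; last by linear_arith.
move=> h; have : ln (1 + x ^+ 2) <= expR B by linear_arith.
rewrite -ler_expR lnK ?posrE // => h2.
have := sqr_ge0 (x - 1); have := sqr_ge0 x.
have -> : (x - 1) ^+ 2 = x ^+ 2 - 2 * x + 1 by ring.
linear_arith.
Qed.

(** Where [nc (f z) ^+ 2 >= 3], [growth_bound] on a disc of radius [d] gives the rate [2 / d];
    elsewhere the hypothesis bounds [nc (f' z)] by [4 * M]. *)
Lemma loglog_lipschitz f f' f'' c r d M z0 z1 : 0 < d -> 0 <= M -> M * d <= 4^-1 ->
  (forall z, nc (z - c) <= r + d -> [/\ hd f f' z, hd f' f'' z &
     nc (f' z) <= M * (1 + nc (f z) ^+ 2)]) ->
  nc (z0 - c) <= r -> nc (z1 - c) <= r ->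
  loglog (nc (f z1)) <= loglog (nc (f z0)) + (4 * M + 2 / d) * nc (z1 - z0).
Proof.
move=> d0 M0 Md H h0 h1.
pose N (x : R) := nc (f (z0 + x%:C * (z1 - z0))) ^+ 2.
pose dN (x : R) := 2 * complex.Re ((conjc (f (z0 + x%:C * (z1 - z0)))) *
   ((z1 - z0) * f' (z0 + x%:C * (z1 - z0)))).
have N0 x : 0 <= N x by exact: sqr_ge0.
have N1 x : 0 < 1 + N x by have := N0 x; linear_arith.
have L0 x : 0 <= ln (1 + N x) by apply: ln_ge0; rewrite lerDl.
have L1 x : 0 < 1 + ln (1 + N x) by have := L0 x; linear_arith.
have seg (x : R) (h : 0 <= x <= 1) := segment_in_disc h0 h1 h.
have dE (x : R) : 0 <= x <= 1 ->
    is_derive x 1 (fun y => ln (1 + ln (1 + N y)))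
      ((1 + ln (1 + N x))^-1 * ((1 + N x)^-1 * dN x)).
  move=> /seg hx; have rd : r <= r + d by linear_arith.
  have [hf _ _] := H _ (le_trans hx rd).
  have k1 := is_derive_add1 (is_derive_ncsq hf).
  have k2 := is_derive_add1 (@is_derive_ln_comp (fun y => 1 + N y) x _ (N1 x) k1).
  exact: (@is_derive_ln_comp (fun y => 1 + ln (1 + N y)) x _ (L1 x) k2).
have dle (x : R) : 0 <= x <= 1 ->
   (1 + ln (1 + N x))^-1 * ((1 + N x)^-1 * dN x) <= (4 * M + 2 / d) * nc (z1 - z0).
  move=> /seg hx; set u := z0 + x%:C * (z1 - z0).
  have hu : nc (u - c) <= r + d by apply: le_trans hx _; linear_arith.
  have [_ _ hM] := H _ hu.
  have NE : N x = nc (f u) ^+ 2 by [].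
  have n0 := nc_ge0 (z1 - z0); have nf := nc_ge0 (f u); have nf' := nc_ge0 (f' u).
  have dd0 : 0 < 2 / d by rewrite divr_gt0.
  have dNle : dN x <= 2 * (nc (f u) * nc (f' u)) * nc (z1 - z0).
    by have := Re_conjM_le (f u) ((z1 - z0) * f' u); rewrite ncM /dN -/u; linear_arith.
  rewrite mulrA -invfM ler_pdivrMl ?mulr_gt0 //.
  apply: le_trans dNle _; rewrite [leRHS]mulrA; apply: ler_wpM2r => //.
  have [N3|N3] := leP 3 (N x).
    have k1 : nc (f' u) * d <= nc (f u) * ln (nc (f u) ^+ 2).
      apply: (growth_bound (f'' := f'')) d0 M0 Md _ N3 => z zu; apply: H.
      by have := nc_distD u z c; linear_arith.
    have k2 : ln (nc (f u) ^+ 2) <= ln (1 + N x).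
      by rewrite NE ler_ln ?posrE //; linear_arith.
    have k3 : nc (f u) * (nc (f' u) * d) <= N x * ln (1 + N x).
      rewrite NE expr2 -mulrA ler_wpM2l // (le_trans k1) // ler_wpM2l //.
    have k4 : nc (f u) * nc (f' u) <= N x * ln (1 + N x) / d.
      by rewrite ler_pdivlMr // -mulrA.
    apply: (@le_trans _ _ ((1 + ln (1 + N x)) * (1 + N x) * (2 / d))).
      have k5 : N x * ln (1 + N x) / d <= (1 + ln (1 + N x)) * (1 + N x) / d.
        rewrite ler_pM2r ?invr_gt0 // mulrC ler_pM //; linear_arith.
      by linear_arith.
    rewrite ler_pM2l ?mulr_gt0 //; linear_arith.
  have k1 : nc (f' u) <= M * 4.
    by apply: le_trans hM _; rewrite ler_wpM2l // -NE; linear_arith.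
  have k2 : nc (f u) * nc (f' u) <= nc (f u) * (M * 4) by rewrite ler_wpM2l.
  have k3 : 2 * nc (f u) <= 1 + N x.
    by rewrite NE; have := sqr_ge0 (nc (f u) - 1); rewrite sqrrB1 mulr2n; linear_arith.
  have k4 : 2 * nc (f u) * (M * 4) <= (1 + N x) * (M * 4).
    by rewrite ler_wpM2r // mulr_ge0.
  apply: (@le_trans _ _ (1 * (1 + N x) * (4 * M))); first by linear_arith.
  apply: ler_pM; rewrite ?mulr_ge0 //; last linear_arith.
  - by have := N1 x; linear_arith.
  - by rewrite ler_wpM2r ?(ltW (N1 x)) //; have := L0 x; linear_arith.
have := mvt_le ler01 dE dle.
have -> : N 1 = nc (f z1) ^+ 2 by rewrite /N mul1r addrC subrK.
have -> : N 0 = nc (f z0) ^+ 2 by rewrite /N mul0r addr0.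
by rewrite /loglog; linear_arith.
Qed.

End Growth.

(** * Uniform limits of polynomials *)

Section PolynomialLimits.
Variable R : realType.
Local Notation C := R[i].
Implicit Types (f g q : C -> C) (z c u v : C) (e r s t B d : R) (p : {poly C}).

(** Stands in for holomorphy of the limit functions: derivatives and quotients are obtained for the
    approximating polynomials and passed to the limit by Cauchy estimates. *)
Definition polylim c r g := forall e : R, 0 < e ->
  exists p : {poly C}, forall z, nc (z - c) <= r -> nc (p.[z] - g z) <= e.

Lemma poly_cauchy p c r s B : s < r ->
  (forall z, nc (z - c) <= r -> nc p.[z] <= B) ->
  forall z, nc (z - c) <= s -> nc p^`().[z] * (r - s) <= 2 * B.
Proof.
move=> sr pB z zs; apply: (@cauchy_estimate _ (horner p) (horner p^`())) => [|u _|u us].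
- by rewrite subr_gt0.
- exact: hd_horner.
- by apply: pB; have := nc_distD z u c; linear_arith.
Qed.

(** Two Cauchy estimates, each across half of the gap [r - s], bound the second derivative; each
    costs a factor [4 / (r - s)], whence the 16. *)
Lemma poly_quad p c r s B : s < r ->
  (forall z, nc (z - c) <= r -> nc p.[z] <= B) ->
  forall u v, nc (u - c) <= s -> nc (v - c) <= s ->
  nc (p.[u] - p.[v] - p^`().[v] * (u - v)) <= 16 * B / (r - s) ^+ 2 * nc (u - v) ^+ 2.
Proof.
move=> sr pB u v us vs; pose t := (r + s) / 2.
have tr : t < r by rewrite /t; linear_arith.
have st : s < t by rewrite /t; linear_arith.
have rs0 : 0 < r - s by linear_arith.
have b1 z : nc (z - c) <= t -> nc p^`().[z] <= 4 * B / (r - s).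
  move=> zt; have := poly_cauchy tr pB zt.
  by rewrite ler_pdivlMr // /t; linear_arith.
have b2 z : nc (z - c) <= s -> nc p^`()^`().[z] <= 16 * B / (r - s) ^+ 2.
  move=> zs; have := poly_cauchy st b1 zs.
  rewrite expr2 ler_pdivlMr ?mulr_gt0 // -(ler_pM2r rs0) => h.
  have : 2 * (4 * B / (r - s)) * (r - s) = 8 * B by field; rewrite gt_eqF.
  by rewrite /t in h; linear_arith.
have b3 z : nc (z - c) <= s ->
    nc (p^`().[z] - p^`().[v]) <= 16 * B / (r - s) ^+ 2 * nc (z - v).
  move=> zs; apply: (hd_mvt_nc (f := horner p^`()) (f' := horner p^`()^`())).
    by move=> x _; exact: hd_horner.
  by move=> x hx; apply: b2; exact: segment_in_disc.
have n0 := nc_ge0 (u - v).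
have B0 : 0 <= 16 * B / (r - s) ^+ 2 by apply: le_trans (nc_ge0 _) (b2 v vs).
pose f z := p.[z] - p^`().[v] * z.
have -> : p.[u] - p.[v] - p^`().[v] * (u - v) = f u - f v by rewrite /f; ring.
rewrite expr2 mulrA.
apply: (hd_mvt_nc (f := f) (f' := fun z => p^`().[z] - p^`().[v])) => x hx.
  apply: hd_ext (hdB (hd_horner p _) (hdM (hd_cst p^`().[v] _) (hd_id _))) => w //=.
  by rewrite mul0r add0r mulr1.
have hx' := segment_in_disc vs us hx.
apply: le_trans (b3 _ hx') _; apply: ler_wpM2l => //.
rewrite addrC addKr ncM nc_real ger0_norm; last by case/andP: hx.
by rewrite ler_piMl //; case/andP: hx.
Qed.

Lemma poly_bounded p c r : exists2 B : R, 0 <= B &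
  forall z, nc (z - c) <= r -> nc p.[z] <= B.
Proof.
have [B B0 H] := @hd_bounded _ (horner p) (horner p^`()) c 0 r
  (fun z _ => hd_horner p z).
exists B => // z zr; have Az : annulus c 0 r z by rewrite /annulus /= nc_ge0.
by have [] := H z Az.
Qed.

Lemma polylim_bounded c r g : polylim c r g -> exists2 B : R, 0 <= B &
  forall z, nc (z - c) <= r -> nc (g z) <= B.
Proof.
move=> /(_ 1 ltr01)[p Hp]; have [B B0 HB] := poly_bounded p c r.
exists (B + 1); first by rewrite addr_ge0.
move=> z zr; have := Hp z zr; have := HB z zr.
by have := nc_lerB (g z) p.[z]; rewrite (ncBC (g z)); linear_arith.
Qed.

Lemma inv_succ_small e : 0 < e -> exists N, forall n, (N <= n)%N -> n.+1%:R^-1 < e.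
Proof.
move=> e0; exists (Num.truncn e^-1).+1 => n Nn.
rewrite -[ltRHS]invrK ltf_pV2 ?posrE ?invr_gt0 //.
by apply: lt_le_trans (truncnS_gt _) _; rewrite ler_nat (leq_trans Nn).
Qed.

Lemma polylim_deriv c r g : polylim c r g -> exists g' : C -> C,
  [/\ forall s, s < r -> polylim c s g',
      forall z, nc (z - c) < r -> hd g g' z &
      forall s e p, s < r -> (forall z, nc (z - c) <= r -> nc (p.[z] - g z) <= e) ->
        forall z, nc (z - c) <= s -> nc (p^`().[z] - g' z) * (r - s) <= 2 * e].
Proof.
move=> Hg.
have inv0 n : 0 < n.+1%:R^-1 :> R by rewrite invr_gt0.
have [P HP] := choice (fun n => Hg _ (inv0 n)).
have [B0 B00 gB] := polylim_bounded Hg.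
have inv1 n : n.+1%:R^-1 <= 1 :> R by rewrite invf_le1 // ler1n.
have PB n z : nc (z - c) <= r -> nc (P n).[z] <= B0 + 1.
  move=> zr; have := HP n z zr; have := gB z zr; have := inv1 n.
  by have := nc_lerB (P n).[z] (g z); move: (n.+1%:R^-1) => x; linear_arith.
have lim_ex z : exists l : C, nc (z - c) < r ->
    forall e, 0 < e -> nat_ultra [set n | nc ((P n)^`().[z] - l) < e].
  have [zr|zr] := ltP (nc (z - c)) r; last by exists 0.
  have bd n : nc (P n)^`().[z] <= 2 * (B0 + 1) / (r - nc (z - c)).
    rewrite ler_pdivlMr ?subr_gt0 //.
    exact: poly_cauchy zr (PB n) _ (lexx _).
  by have [l Hl] := complex_ulim bd; exists l.
have [g' Hg'] := choice lim_ex.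
have est s e p : s < r -> (forall z, nc (z - c) <= r -> nc (p.[z] - g z) <= e) ->
    forall z, nc (z - c) <= s -> nc (p^`().[z] - g' z) * (r - s) <= 2 * e.
  move=> sr He z zs; have rs0 : 0 < r - s by linear_arith.
  apply/ler_addgt0Pl => x x0; have x2 : 0 < x / 4 by linear_arith.
  have x3 : 0 < x / 2 / (r - s) by rewrite !divr_gt0.
  have [N HN] := inv_succ_small x2.
  have [n Nn /= hn] := nat_ultra_ex_ge N (Hg' z (le_lt_trans zs sr) _ x3).
  have {}HN := HN n Nn.
  have dif y : nc (y - c) <= r -> nc (p - P n).[y] <= e + x / 4.
    move=> yr; have -> : (p - P n).[y] = (p.[y] - g y) - ((P n).[y] - g y).
      by rewrite !hornerE; ring.
    apply: le_trans (ncB _ _) _; apply: lerD; first exact: He.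
    exact: le_trans (HP n y yr) (ltW HN).
  have := poly_cauchy sr dif zs; rewrite derivB !hornerE => h1.
  have h2 := nc_distD (P n)^`().[z] p^`().[z] (g' z).
  have h3 := ler_wpM2r (ltW rs0) h2.
  move: hn; rewrite ltr_pdivlMr // => hn.
  by linear_arith.
exists g'; split => //.
- move=> s sr e e0; have rs0 : 0 < r - s by linear_arith.
  have e2 : 0 < e * (r - s) / 2 by rewrite divr_gt0 // mulr_gt0.
  have [p Hp] := Hg _ e2; exists p^`() => z zs.
  have h := est _ _ _ sr Hp z zs; rewrite -(ler_pM2r rs0); linear_arith.
- move=> z zr; pose s := (nc (z - c) + r) / 2.
  have sr : s < r by rewrite /s; linear_arith.
  have d0 : 0 < s - nc (z - c) by rewrite /s; linear_arith.
  exists (16 * (B0 + 1) / (r - s) ^+ 2), (s - nc (z - c)); split=> //.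
    by rewrite divr_ge0 ?sqr_ge0 // mulr_ge0 // addr_ge0.
  move=> u v us vs.
  have us' : nc (u - c) <= s by have := nc_distD z u c; linear_arith.
  have vs' : nc (v - c) <= s by have := nc_distD z v c; linear_arith.
  apply/ler_addgt0Pl => x x0.
  have x1 : 0 < x / 4 by linear_arith.
  have n0 := nc_ge0 (u - v); have n1 : 0 < nc (u - v) + 1 by linear_arith.
  have x2 : 0 < x / 4 / (nc (u - v) + 1) by rewrite divr_gt0.
  have [N HN] := inv_succ_small x1.
  have [n Nn /= hn] := nat_ultra_ex_ge N (Hg' v (le_lt_trans vs' sr) _ x2).
  have {}HN := HN n Nn.
  have h := poly_quad sr (PB n) us' vs'.
  have -> : g u - g v - g' v * (u - v) =
     ((P n).[u] - (P n).[v] - (P n)^`().[v] * (u - v)) -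
     (((P n).[u] - g u) - ((P n).[v] - g v) - ((P n)^`().[v] - g' v) * (u - v)) by ring.
  apply: le_trans (ncB _ _) _.
  have k1 := ncB (((P n).[u] - g u) - ((P n).[v] - g v)) (((P n)^`().[v] - g' v) * (u - v)).
  have k2 := ncB ((P n).[u] - g u) ((P n).[v] - g v).
  have k3 := le_trans (HP n u (le_trans us' (ltW sr))) (ltW HN).
  have k4 := le_trans (HP n v (le_trans vs' (ltW sr))) (ltW HN).
  have k5 : nc (((P n)^`().[v] - g' v) * (u - v)) <= x / 4.
    rewrite ncM; move: hn; rewrite ltr_pdivlMr // => hn.
    by have := nc_ge0 ((P n)^`().[v] - g' v); linear_arith.
  by linear_arith.
Qed.

(** The approximants of the quotient are [(p - p.[z0]) / (X - z0)], polynomials by the factor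
    theorem. At distance at least [d] from [z0] the error is divided by at least [d]; closer to [z0]
    the mean value inequality uses the derivative estimate instead. *)
Lemma polylim_div c r g z0 : polylim c r g -> nc (z0 - c) < r -> g z0 = 0 ->
  exists2 q, polylim c r q & forall z, nc (z - c) <= r -> g z = (z - z0) * q z.
Proof.
move=> Hg z0r g0; have [g' [_ hg' est]] := polylim_deriv Hg.
pose q z := if z == z0 then g' z0 else g z / (z - z0).
exists q; last first.
  move=> z _; rewrite /q; case: eqVneq => [->|zz]; first by rewrite g0 subrr mul0r.
  by rewrite mulrC divfK // subr_eq0.
move=> e e0; pose s := (nc (z0 - c) + r) / 2.
have sr : s < r by rewrite /s; linear_arith.
pose d := s - nc (z0 - c); have d0 : 0 < d by rewrite /d /s; linear_arith.
have rs : r - s = d by rewrite /d /s; linear_arith.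
have e1 : 0 < e * d / 2 by rewrite divr_gt0 // mulr_gt0.
have [p Hp] := Hg _ e1.
have rt : root (p - (p.[z0])%:P) z0 by rewrite /root !hornerE subrr.
have /factor_theorem[k kE] := rt.
exists k => z zr.
have kz : k.[z] * (z - z0) = p.[z] - p.[z0].
  by have := congr1 (fun P => P.[z]) kE; rewrite !hornerE => <-.
have dest y : nc (y - c) <= s -> nc (p^`().[y] - g' y) <= e.
  move=> ys; have := est _ _ _ sr Hp y ys; rewrite rs mulrC [leRHS]mulrC divfK //.
  by rewrite mulrC ler_pM2r.
rewrite /q; case: eqVneq => [zz|zz].
  have -> : k.[z] = p^`().[z0].
    have := congr1 (fun P => P^`().[z0]) kE.
    by rewrite derivB derivC derivM derivXsubC !hornerE zz subr0 => ->; ring.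
  by apply: dest; rewrite /s; linear_arith.
have nz : 0 < nc (z - z0) by rewrite nc_gt0 subr_eq0.
rewrite -(ler_pM2r nz) -ncM mulrBl divfK ?subr_eq0 // kz.
have -> : p.[z] - p.[z0] - g z = (p.[z] - g z) - (p.[z0] - g z0) by rewrite g0; ring.
have [zd|zd] := leP d (nc (z - z0)).
  apply: le_trans (ncB _ _) _; apply: (@le_trans _ _ (e * d)).
    by have := Hp z zr; have := Hp z0 (ltW z0r); linear_arith.
  by rewrite ler_pM2l.
apply: (hd_mvt_nc (f := fun y => p.[y] - g y) (f' := fun y => p^`().[y] - g' y)).
  move=> t ht; apply: hdB; first exact: hd_horner.
  apply: hg'; apply: le_lt_trans sr; apply: segment_in_disc ht.
    by rewrite /s; linear_arith.
  by have := nc_distD z0 z c; rewrite /d in zd; linear_arith.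
move=> t ht; apply: dest; apply: segment_in_disc ht; first by rewrite /s; linear_arith.
by have := nc_distD z0 z c; rewrite /d in zd; linear_arith.
Qed.

Lemma expr_small x e : 0 <= x -> x < 1 -> 0 < e -> exists m, x ^+ m < e.
Proof.
move=> x0 x1 e0.
have : (fun n => x ^+ n) @ \oo --> (0 : R) by apply: cvg_expr; rewrite ger0_norm.
move=> /cvgrPdist_lt/(_ e e0)[N _ HN]; exists N.
by have := HN N (leqnn N); rewrite /= sub0r normrN ger0_norm // exprn_ge0.
Qed.

(* A zero of infinite order at [z0] would force [g c = 0] by the maximum
   principle applied to [g / (z - z0)^m]. *)
Lemma polylim_order c r s g z0 : polylim c r g -> g c != 0 ->
  nc (z0 - c) <= s -> 2 * s < r ->
  exists m q, [/\ polylim c r q, q z0 != 0 &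
    forall z, nc (z - c) <= r -> g z = (z - z0) ^+ m * q z].
Proof.
move=> Hg gc zs sr; apply: contrapT => nex.
have s0 : 0 <= s := le_trans (nc_ge0 _) zs.
have fac m : exists2 q, polylim c r q &
    forall z, nc (z - c) <= r -> g z = (z - z0) ^+ m * q z.
  elim: m => [|m [q Hq gq]]; first by exists g => // z _; rewrite mul1r.
  have q0 : q z0 = 0.
    by apply: contrapT => /eqP q0; apply: nex; exists m, q.
  have [|k Hk qk] := polylim_div Hq _ q0; first linear_arith.
  by exists k => // z zr; rewrite gq // qk // exprSr mulrA.
have [B B0 gB] := polylim_bounded Hg.
(* [2 * s < r] leaves room for a circle inside the disc whose distance [t - s] to [z0] exceeds [s];
   the maximum principle then yields the factor [(s / (t - s)) ^+ m], which tends to 0. *)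
pose t := s + r / 2.
have ts : s < t - s by rewrite /t; linear_arith.
have tr : t < r by rewrite /t; linear_arith.
have t0 : 0 <= t by rewrite /t; linear_arith.
have ts0 : 0 < t - s by linear_arith.
have x0 : 0 <= s / (t - s) by rewrite divr_ge0 // ltW.
have x1 : s / (t - s) < 1 by rewrite ltr_pdivrMr // mul1r.
have B1 : 0 < B + 1 by linear_arith.
have ngc : 0 < nc (g c) / (B + 1) by rewrite divr_gt0 // nc_gt0.
have [m] := expr_small x0 x1 ngc; rewrite ltr_pdivlMr // => hm.
have [q Hq gq] := fac m; have [q' [_ hq' _]] := polylim_deriv Hq.
have qc : nc (q c) <= B / (t - s) ^+ m.
  apply: (max_principle (f' := q') t0) => z zt.
    by apply: hq'; exact: le_lt_trans tr.
  rewrite ler_pdivlMr ?exprn_gt0 //.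
  have zr : nc (z - c) <= r by rewrite zt ltW.
  apply: le_trans (gB z zr); rewrite gq // ncM ncX mulrC ler_wpM2r ?nc_ge0 //.
  rewrite lerXn2r ?nnegrE ?nc_ge0 ?(ltW ts0) //.
  by have := nc_distD z0 z c; linear_arith.
have cr : nc (c - c) <= r by rewrite subrr nc0; linear_arith.
have := gq c cr => /(congr1 (fun x => nc x)); rewrite ncM ncX (ncBC c) => gcE.
have h1 : nc (z0 - c) ^+ m <= s ^+ m by rewrite lerXn2r ?nnegrE ?nc_ge0.
have : nc (g c) <= s ^+ m * (B / (t - s) ^+ m).
  by rewrite gcE ler_pM ?nc_ge0 ?exprn_ge0 ?nc_ge0.
have -> : s ^+ m * (B / (t - s) ^+ m) = (s / (t - s)) ^+ m * B.
  by rewrite exprMn exprVn; ring.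
have := exprn_ge0 m x0; linear_arith.
Qed.

(** The pointwise ultralimit inherits the common Lipschitz constant, which makes the convergence
    uniform. Only then is an honest subsequence picked, with the explicit rate [n.+1%:R^-1]. *)
Lemma montel (p : nat -> {poly C}) c r s B : 0 <= s -> s < r ->
  (forall n z, nc (z - c) <= r -> nc (p n).[z] <= B) ->
  exists (phi : nat -> nat) (g : C -> C), {homo phi : m n / (m < n)%N} /\
    forall n z, nc (z - c) <= s -> nc ((p (phi n)).[z] - g z) <= n.+1%:R^-1.
Proof.
move=> s0 sr pB.
have rs0 : 0 < r - s by linear_arith.
have cr : nc (c - c) <= r by rewrite subrr nc0; linear_arith.
have B0 : 0 <= B := le_trans (nc_ge0 _) (pB 0%N c cr).
pose L := 2 * B / (r - s); have L0 : 0 <= L by rewrite divr_ge0 ?mulr_ge0 // ltW.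
have lip n u v : nc (u - c) <= s -> nc (v - c) <= s ->
    nc ((p n).[u] - (p n).[v]) <= L * nc (u - v).
  move=> us vs; apply: (hd_mvt_nc (f := horner (p n)) (f' := horner (p n)^`())).
    by move=> t _; exact: hd_horner.
  move=> t ht; rewrite ler_pdivlMr //; apply: poly_cauchy sr (pB n) _ _.
  exact: segment_in_disc.
have lim_ex z : exists l : C, nc (z - c) <= s ->
    forall e, 0 < e -> nat_ultra [set n | nc ((p n).[z] - l) < e].
  have [zs|zs] := leP (nc (z - c)) s; last by exists 0.
  have [l Hl] := @complex_ulim _ (fun n => (p n).[z]) B
    (fun n => pB n z (le_trans zs (ltW sr))).
  by exists l.
have [g Hg] := choice lim_ex.
have glip u v : nc (u - c) <= s -> nc (v - c) <= s ->
    nc (g u - g v) <= L * nc (u - v).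
  move=> us vs; apply/ler_addgt0Pl => x x0; have x2 : 0 < x / 2 by linear_arith.
  have [n _ [/= h1 h2]] := nat_ultra_ex_ge 0
    (nat_ultraI (Hg u us _ x2) (Hg v vs _ x2)).
  have h3 := lip n _ _ us vs.
  have -> : g u - g v = ((p n).[u] - (p n).[v]) - (((p n).[u] - g u) - ((p n).[v] - g v)).
    by ring.
  apply: le_trans (ncB _ _) _.
  by have := ncB ((p n).[u] - g u) ((p n).[v] - g v); linear_arith.
have unif e : 0 < e -> nat_ultra [set n | forall z, nc (z - c) <= s ->
    nc ((p n).[z] - g z) <= e].
  move=> e0; apply: contrapT => /nat_ultraN nU.
  have bad n : exists z, nc (z - c) <= s /\
      (~ (forall z, nc (z - c) <= s -> nc ((p n).[z] - g z) <= e) ->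
        e < nc ((p n).[z] - g z)).
    have [h|h] := pselect (forall z, nc (z - c) <= s -> nc ((p n).[z] - g z) <= e).
      by exists c; split=> //; rewrite subrr nc0.
    apply: contrapT => nz; apply: h => z zs; rewrite leNgt; apply/negP => ez.
    by apply: nz; exists z.
  have [z Hz] := choice bad.
  have zb n : nc (z n) <= s + nc c.
    by have [h _] := Hz n; have := nc_lerB (z n) c; linear_arith.
  have [y Hy] := complex_ulim zb.
  have ys : nc (y - c) <= s.
    apply/ler_addgt0Pl => x x0; have [n _ /= h] := nat_ultra_ex_ge 0 (Hy _ x0).
    by have [h1 _] := Hz n; have := nc_distD (z n) y c; rewrite (ncBC y (z n)); linear_arith.
  (* One [L] for moving [p n] from [z n] to the limit point [y], one for moving [g] back, and 1 for
     the convergence at [y]. *)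
  have L1 : 0 < 2 * L + 1 by linear_arith.
  have x0 : 0 < e / (2 * L + 1) by rewrite divr_gt0.
  have [n _ [/= h1 [h2 h3]]] := nat_ultra_ex_ge 0
    (nat_ultraI nU (nat_ultraI (Hy _ x0) (Hg y ys _ x0))).
  have [zs /(_ h1) h4] := Hz n.
  move: h2 h3; rewrite !ltr_pdivlMr // => h2 h3.
  have h5 := lip n _ _ zs ys; have h6 := glip _ _ ys zs.
  rewrite (ncBC y) in h6.
  have : nc ((p n).[z n] - g (z n)) * (2 * L + 1) <= e * (2 * L + 1).
    have -> : (p n).[z n] - g (z n) =
      ((p n).[z n] - (p n).[y]) + ((p n).[y] - g y) + (g y - g (z n)) by ring.
    have k1 := ncD (((p n).[z n] - (p n).[y]) + ((p n).[y] - g y)) (g y - g (z n)).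
    have k2 := ncD ((p n).[z n] - (p n).[y]) ((p n).[y] - g y).
    have k3 := ler_wpM2r (ltW L1) (le_trans k1 (lerD k2 (lexx _))).
    have k4 := ler_wpM2r (ltW L1) h5; have k5 := ler_wpM2r (ltW L1) h6.
    have k6 := ler_wpM2l L0 (ltW h2).
    by linear_arith.
  by rewrite ler_pM2r //; linear_arith.
have pick k N : exists2 n, (N <= n)%N & forall z, nc (z - c) <= s ->
    nc ((p n).[z] - g z) <= k.+1%:R^-1.
  by apply: nat_ultra_ex_ge; apply: unif; rewrite invr_gt0.
have pick' (kN : nat * nat) : exists n, (kN.2 <= n)%N /\ forall z, nc (z - c) <= s ->
    nc ((p n).[z] - g z) <= kN.1.+1%:R^-1.
  by have [n ? ?] := pick kN.1 kN.2; exists n.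
have [F HF] := choice pick'.
pose phi := fix phi n := if n is k.+1 then F (k.+1, (phi k).+1) else F (0%N, 0%N).
exists phi, g; split.
  apply: homo_ltn; first exact: ltn_trans.
  by move=> n; have [] := HF (n.+1, (phi n).+1).
by case=> [|n] z zs; [have [_ h] := HF (0%N, 0%N)|have [_ h] := HF (n.+1, (phi n).+1)];
  exact: h.
Qed.

End PolynomialLimits.

(** * The flat orbifold with three cone points *)

Section FlatOrbifold.
Variable R : realType.
Local Notation C := R[i].
Implicit Types (f g h G : C -> C) (z c u v w : C) (e r s t B d x y : R).
Variables a1 a2 a3 : C.
Hypotheses (a12 : a1 != a2) (a13 : a1 != a3) (a23 : a2 != a3).

Definition cubic w := (w - a1) * (w - a2) * (w - a3).
Definition cubic' w :=
  (w - a2) * (w - a3) + (w - a1) * (w - a3) + (w - a1) * (w - a2).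

Lemma hd_cubic g g' z : hd g g' z ->
  hd (fun u => cubic (g u)) (fun u => cubic' (g u) * g' u) z.
Proof.
move=> hg.
have h1 := hdB hg (hd_cst a1 z); have h2 := hdB hg (hd_cst a2 z).
have h3 := hdB hg (hd_cst a3 z).
apply: hd_ext (hdM (hdM h1 h2) h3) => u //; rewrite /cubic'; ring.
Qed.

Let A := nc a1 + nc a2 + nc a3.

Let A0 : 0 <= A. Proof. by rewrite !addr_ge0 ?nc_ge0. Qed.

Let ncBa w : [/\ nc (w - a1) <= nc w + A, nc (w - a2) <= nc w + A &
  nc (w - a3) <= nc w + A].
Proof.
have := nc_ge0 a1; have := nc_ge0 a2; have := nc_ge0 a3.
by split; apply: le_trans (ncB _ _) _; rewrite /A; linear_arith.
Qed.

Let ncBa' w : [/\ nc w - A <= nc (w - a1), nc w - A <= nc (w - a2) &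
  nc w - A <= nc (w - a3)].
Proof.
have := nc_ge0 a1; have := nc_ge0 a2; have := nc_ge0 a3.
have := nc_lerB w a1; have := nc_lerB w a2; have := nc_lerB w a3.
by rewrite /A; split; linear_arith.
Qed.

(** The quartic weight is the square of the spherical density [1 + nc w ^+ 2]: in
    [G' ^+ 2 = h * cubic G], a bounded [h] bounds the spherical derivative of [G]. *)
Lemma cubic_upper w : nc (cubic w) <= 4 * (1 + A) ^+ 3 * (1 + nc w ^+ 2) ^+ 2.
Proof.
have [h1 h2 h3] := ncBa w; have x0 := nc_ge0 w; set x := nc w in h1 h2 h3 x0 *.
have A1 : 0 <= 1 + A by have := A0; linear_arith.
have le x' : x' <= x + A -> x' <= (1 + A) * (1 + x).
  by have := mulr_ge0 A0 x0; have := A0; linear_arith.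
have p1 : nc (cubic w) <= ((1 + A) * (1 + x)) ^+ 3.
  rewrite /cubic !ncM exprS expr2 mulrA.
  by apply: ler_pM; rewrite ?mulr_ge0 ?nc_ge0 //; [apply: ler_pM; rewrite ?nc_ge0 //|];
    exact: le.
have -> : 4 * (1 + A) ^+ 3 * (1 + x ^+ 2) ^+ 2 =
  (1 + A) ^+ 3 * (4 * (1 + x ^+ 2) ^+ 2) by ring.
apply: le_trans p1 _; rewrite exprMn ler_wpM2l ?exprn_ge0 //.
have q1 : 1 + x <= 2 * (1 + x ^+ 2).
  by have := sqr_ge0 x; have := sqr_ge0 (x - 1); rewrite sqrrB1 mulr2n; linear_arith.
have q2 : (1 + x) ^+ 2 <= 2 * (1 + x ^+ 2).
  by have := sqr_ge0 (x - 1); rewrite sqrrB1 sqrrD expr1n mul1r !mulr2n; linear_arith.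
have -> : 4 * (1 + x ^+ 2) ^+ 2 = 2 * (1 + x ^+ 2) * (2 * (1 + x ^+ 2)).
  by rewrite expr2; ring.
by rewrite exprS ler_pM // ?exprn_ge0 // addr_ge0.
Qed.

Lemma cubic_lower w : 2 * A <= nc w -> (nc w / 2) ^+ 3 <= nc (cubic w).
Proof.
have [h1 h2 h3] := ncBa' w => hA; have x0 := nc_ge0 w.
have y0 : 0 <= nc w / 2 by linear_arith.
rewrite /cubic !ncM exprS expr2 mulrA.
by apply: ler_pM; rewrite ?mulr_ge0 //; [apply: ler_pM => //|]; linear_arith.
Qed.

(** Within a quarter of the least root distance [D] of some root the derivative is large; away from
    all three roots every factor is at least [D / 4]. *)
Lemma cubic_no_multiple_root : exists2 m : R, 0 < m &
  forall w, m <= nc (cubic w) + nc (cubic' w).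
Proof.
pose D := Num.min (nc (a1 - a2)) (Num.min (nc (a1 - a3)) (nc (a2 - a3))).
have D0 : 0 < D by rewrite !lt_min !nc_gt0 !subr_eq0 a12 a13 a23.
have D12 : D <= nc (a1 - a2) by rewrite ge_min lexx.
have D13 : D <= nc (a1 - a3) by rewrite !ge_min lexx !orbT.
have D23 : D <= nc (a2 - a3) by rewrite !ge_min lexx !orbT.
have D4 : 0 < D / 4 by rewrite divr_gt0.
exists (Num.min ((D / 4) ^+ 3) (D ^+ 2 / 8)).
  by rewrite lt_min exprn_gt0 // divr_gt0 // exprn_gt0.
move=> w; rewrite ge_min.
have near (x y z : C) : nc (y - x) < D / 4 -> D <= nc (x - z) -> 3 * D / 4 <= nc (y - z).
  by move=> h1 h2; have := nc_distD y x z; rewrite (ncBC x y); linear_arith.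
have est (x y z : C) : nc x <= D / 4 -> 3 * D / 4 <= nc y -> 3 * D / 4 <= nc z ->
    D ^+ 2 / 8 <= nc (y * z + x * z + x * y).
  move=> hx hy hz.
  have -> : y * z + x * z + x * y = y * z - (- (x * z) - x * y) by ring.
  have := nc_lerB (y * z) (- (x * z) - x * y); rewrite (ncBC (y * z)).
  have := ncB (- (x * z)) (x * y); rewrite ncN !ncM.
  have x0 := nc_ge0 x; have y0 := nc_ge0 y; have z0 := nc_ge0 z.
  have k1 : nc x * nc z <= nc y / 3 * nc z by rewrite ler_wpM2r //; linear_arith.
  have k2 : nc x * nc y <= nc z / 3 * nc y by rewrite ler_wpM2r //; linear_arith.
  have k3 : (3 * D / 4) * (3 * D / 4) <= nc y * nc z by rewrite ler_pM //; linear_arith.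
  by have := mulr_gt0 D0 D0; rewrite expr2; linear_arith.
have n0 := nc_ge0 (cubic w); have n0' := nc_ge0 (cubic' w).
have [h1|h1] := ltP (nc (w - a1)) (D / 4).
  apply/orP; right; apply: le_trans (est _ _ _ (ltW h1) (near _ _ _ h1 D12)
    (near _ _ _ h1 D13)) _.
  by rewrite -/(cubic' w); linear_arith.
have [h2|h2] := ltP (nc (w - a2)) (D / 4).
  rewrite ncBC in D12.
  apply/orP; right; apply: le_trans (est _ _ _ (ltW h2) (near _ _ _ h2 D12)
    (near _ _ _ h2 D23)) _.
  have -> : (w - a1) * (w - a3) + (w - a2) * (w - a3) + (w - a2) * (w - a1) = cubic' w.
    by rewrite /cubic'; ring.
  by linear_arith.
have [h3|h3] := ltP (nc (w - a3)) (D / 4).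
  rewrite ncBC in D13; rewrite ncBC in D23.
  apply/orP; right; apply: le_trans (est _ _ _ (ltW h3) (near _ _ _ h3 D13)
    (near _ _ _ h3 D23)) _.
  have -> : (w - a1) * (w - a2) + (w - a3) * (w - a2) + (w - a3) * (w - a1) = cubic' w.
    by rewrite /cubic'; ring.
  by linear_arith.
apply/orP; left; apply: (@le_trans _ _ (nc (cubic w))); last by linear_arith.
rewrite /cubic !ncM exprS expr2 mulrA.
have D40 := ltW D4.
have h12 := ler_pM D40 D40 h1 h2.
exact: ler_pM (mulr_ge0 D40 D40) D40 h12 h3.
Qed.

(** A fourth root, because the exponent has to be below 1/2: [x * ln (x ^+ 2)] must lose against the
    growth x^(3/2) imposed by the cubic. *)
Lemma ln_sqr_le x : 0 < x -> ln (x ^+ 2) <= 8 * Num.sqrt (Num.sqrt x).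
Proof.
move=> x0; have s0 : 0 < Num.sqrt (Num.sqrt x) by rewrite !sqrtr_gt0.
have xE : x = Num.sqrt (Num.sqrt x) ^+ 4.
  rewrite -[4%N]/(2 * 2)%N exprM sqr_sqrtr ?sqr_sqrtr ?sqrtr_ge0 //; exact: ltW.
have -> : ln (x ^+ 2) = 8 * ln (Num.sqrt (Num.sqrt x)).
  by rewrite {1}xE -exprM lnXn // mulr_natl.
by rewrite ler_wpM2l // ltW // ln_sublinear.
Qed.

(** The upper bound on [h] controls the spherical derivative, so [growth_bound] applies and |G'| is
    at most of order |G| ln |G|; the lower bound on [h] forces order |G|^(3/2). The two are
    compatible only while |G| is bounded, independently of the radius. *)
Lemma flat_upper : exists2 B : R, 0 <= B & forall r G G' G'' h,
  (forall z, nc z <= r + 1 -> [/\ hd G G' z, hd G' G'' z,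
     G' z ^+ 2 = h z * cubic (G z) & nc (h z) <= 8]) ->
  (forall z, nc z <= r -> 2^-1 <= nc (h z)) ->
  forall z, nc z <= r -> nc (G z) <= B.
Proof.
have [M ME] : exists M : R, M = 32 * (1 + A) ^+ 3 by eexists.
have M1 : 1 <= M.
  have : 1 <= (1 + A) ^+ 3 by apply: exprn_ege1; have := A0; linear_arith.
  by rewrite ME; linear_arith.
have M0 : 0 <= M by linear_arith.
have [d dE] : exists d : R, d = (4 * M)^-1 by eexists.
have d0 : 0 < d by rewrite dE invr_gt0; linear_arith.
have Md : M * d <= 4^-1 by rewrite dE invfM mulrCA divff ?mulr1 // gt_eqF //; linear_arith.
have d4 : d <= 4^-1 by apply: le_trans Md; rewrite ler_peMl // ltW.
(* [16 * 64]: the 16 inverts [2^-1 * (x / 2) ^+ 3], the 64 is the square of the 8 in [ln_sqr_le].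
   [A1] also exceeds [2 * A] for [cubic_lower] and 2 for [growth_bound]. *)
have [W WE] : exists W : R, W = 32 * 32 by eexists.
have [A1 A1E] : exists A1 : R, A1 = 2 * A + 2 + (W / d ^+ 2) ^+ 2 by eexists.
have A1p : 0 <= (W / d ^+ 2) ^+ 2 by exact: sqr_ge0.
have A10 : 0 <= A1 by rewrite A1E; have := A0; linear_arith.
exists A1 => // rho G G' G'' h H hlow.
have G'b z : nc z <= rho + 1 -> nc (G' z) <= M * (1 + nc (G z) ^+ 2).
  move=> zr; have [_ _ eq h8] := H z zr.
  have x0 : 0 <= 1 + nc (G z) ^+ 2 by rewrite addr_ge0 // sqr_ge0.
  rewrite -(@ler_pXn2r _ 2) ?nnegrE ?nc_ge0 ?mulr_ge0 //.
  rewrite -(ncX (G' z)) eq ncM exprMn.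
  apply: (@le_trans _ _ (M * (1 + nc (G z) ^+ 2) ^+ 2)).
    have := ler_pM (nc_ge0 _) (nc_ge0 _) h8 (cubic_upper (G z)).
    by rewrite ME; linear_arith.
  by rewrite ler_wpM2r ?sqr_ge0 // expr2 ler_peMl.
move=> z zr; rewrite leNgt; apply/negP => big.
set x := nc (G z) in big.
have xA : 2 * A <= x by rewrite A1E in big; linear_arith.
have x2 : 2 < x by rewrite A1E in big; have := A0; linear_arith.
have x0 : 0 < x by linear_arith.
have x3 : 3 <= nc (G z) ^+ 2.
  rewrite -/x; have := ler_pM (ler0n _ 2) (ler0n _ 2) (ltW x2) (ltW x2).
  by rewrite -expr2; linear_arith.
have k1 : nc (G' z) * d <= x * ln (x ^+ 2).
  apply: (growth_bound (f'' := G'') d0 M0 Md _ x3) => u uz.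
  have uz' : nc u <= rho + 1 by have := nc_lerB u z; linear_arith.
  by have [g1 g2 _ _] := H u uz'; split => //; exact: G'b.
have zr' : nc z <= rho + 1 by linear_arith.
have [_ _ eq _] := H z zr'.
have k2 : 2^-1 * (x / 2) ^+ 3 <= nc (G' z) ^+ 2.
  rewrite -ncX eq ncM; apply: ler_pM; rewrite ?exprn_ge0 //.
  - by linear_arith.
  - exact: hlow.
  - exact: cubic_lower.
set y := Num.sqrt x; have y0 : 0 < y by rewrite sqrtr_gt0.
have xy : x = y ^+ 2 by rewrite sqr_sqrtr // ltW.
have ly : ln (x ^+ 2) ^+ 2 <= 64 * y.
  have := ln_sqr_le x0; have l0 : 0 <= ln (x ^+ 2).
    by apply: ln_ge0; apply: exprn_ege1; linear_arith.
  rewrite -/y => hl.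
  have -> : 64 * y = (8 * Num.sqrt y) ^+ 2.
    by rewrite exprMn sqr_sqrtr ?(ltW y0) // -natrX.
  by rewrite lerXn2r // nnegrE // mulr_ge0 // sqrtr_ge0.
have k3 : nc (G' z) ^+ 2 * d ^+ 2 <= x ^+ 2 * (64 * y).
  rewrite -exprMn; apply: le_trans (_ : (x * ln (x ^+ 2)) ^+ 2 <= _).
    have p0 : 0 <= nc (G' z) * d by rewrite mulr_ge0 ?nc_ge0 // ltW.
    by rewrite lerXn2r // nnegrE // (le_trans p0).
  by rewrite exprMn ler_wpM2l // sqr_ge0.
have dd0 : 0 < d ^+ 2 by rewrite exprn_gt0.
have k4 : 2^-1 * (x / 2) ^+ 3 * d ^+ 2 <= x ^+ 2 * (64 * y).
  by apply: le_trans k3; rewrite ler_pM2r.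
have k5 : x * d ^+ 2 <= W * y.
  have xx0 : 0 < x ^+ 2 by rewrite exprn_gt0.
  rewrite -(ler_pM2l xx0).
  have -> : x ^+ 2 * (x * d ^+ 2) = 16 * (2^-1 * (x / 2) ^+ 3 * d ^+ 2) by field.
  by rewrite WE; linear_arith.
have k6 : y <= W / d ^+ 2.
  by rewrite ler_pdivlMr // -(ler_pM2l y0) mulrA -expr2 -xy (mulrC y).
have : x <= (W / d ^+ 2) ^+ 2.
  by rewrite xy lerXn2r // nnegrE ?(ltW y0) // (le_trans _ k6) // ltW.
by rewrite A1E in big; have := A0; linear_arith.
Qed.

(* [G'^2 = h Q(G)] says that [G] pulls back the flat metric with cone points
   of angle pi at the roots of the cubic [Q] and at infinity.  [h] is almost
   constant on a large disc; there the logarithmic growth bound keeps [G] away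
   from infinity, so that [G'] and [G''] are tiny, and differentiating shows
   that [Q] and [Q'] nearly vanish simultaneously. *)
Lemma flat_bounded : exists2 r : R, 0 < r & forall G G' G'' h h',
  (forall z, nc z <= r -> [/\ hd G G' z, hd G' G'' z, hd h h' z,
     G' z ^+ 2 = h z * cubic (G z) & nc (h z) <= 8]) ->
  nc (h 0) = 1 ->
  (forall e, 0 < e -> exists2 z, nc z < e & G' z != 0) -> False.
Proof.
have [m m0 Hm] := cubic_no_multiple_root.
have [A1 A10 upper] := flat_upper.
(* [V * A1] and [32 * A1 ^+ 2] will bound [nc (cubic' (G z))] and [nc (cubic (G z))] times
   [rho ^+ 2], so their sum [K] must stay below [m * rho]. *)
have [V VE] : exists V : R, V = 64 * 32 + 8 by eexists.
have [K KE] : exists K : R, K = 32 * A1 ^+ 2 + V * A1 by eexists.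
have K0 : 0 <= K by rewrite KE VE; have := sqr_ge0 A1; linear_arith.
have [rho rhoE] : exists rho : R, rho = 2 + K / m by eexists.
have rho2 : 2 <= rho by rewrite rhoE lerDl divr_ge0 // ltW.
have rho0 : 0 < rho by linear_arith.
have rhoK : K < m * rho by rewrite rhoE mulrDr [m * (K / m)]mulrC divfK ?gt_eqF //; linear_arith.
(* A Cauchy estimate from radius [64 * rho] gives [nc (h' z) <= 2^-1 / rho] on the disc of radius
   [32 * rho], so [h] moves by at most 1/2 on the disc of radius [rho]. *)
exists (64 * rho); first by linear_arith.
move=> G G' G'' h h' H h01 G'n0.
have z0 : nc (0 - 0 : C) = 0 by rewrite subrr nc0.
have h'b z : nc z <= 32 * rho -> nc (h' z) <= 2^-1 / rho.
  move=> zr; have : nc (h' z) * (32 * rho) <= 2 * 8.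
    apply: (cauchy_estimate (f := h)); first by linear_arith.
      move=> u uz; have [] // := H u _; have := nc_lerB u z; linear_arith.
    move=> u uz; have [] // := H u _; have := nc_lerB u z; linear_arith.
  by rewrite ler_pdivlMr //; linear_arith.
have hlow z : nc z <= rho -> 2^-1 <= nc (h z).
  move=> zr; have : nc (h z - h 0) <= 2^-1 / rho * nc (z - 0).
    have seg (t : R) (ht : 0 <= t <= 1) : nc (0 + t%:C * (z - 0)) <= rho.
      rewrite add0r subr0 ncM nc_real ger0_norm; last by case/andP: ht.
      apply: le_trans zr; rewrite ler_piMl ?nc_ge0 //; by case/andP: ht.
    apply: (hd_mvt_nc (f' := h')) => t ht; have := seg t ht => {}ht.
      by have [] // := H (0 + t%:C * (z - 0)) _; linear_arith.
    by apply: h'b; linear_arith.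
  rewrite subr0 => k1.
  have k2 : 2^-1 / rho * nc z <= 2^-1.
    by rewrite mulrAC ler_pdivrMr // ler_wpM2l.
  have := nc_lerB (h 0) (h z); rewrite ncBC h01; linear_arith.
have Gb z : nc z <= rho -> nc (G z) <= A1.
  apply: (upper rho G G' G'' h) => // u ur.
  by have [] := H u ltac:(linear_arith).
have G'b2 z : nc z <= rho / 2 -> nc (G' z) * rho <= 4 * A1.
  move=> zr; have : nc (G' z) * (rho / 2) <= 2 * A1.
    apply: (cauchy_estimate (f := G)); first by linear_arith.
      move=> u uz; have [] // := H u _; have := nc_lerB u z; linear_arith.
    move=> u uz; apply: Gb; have := nc_lerB u z; linear_arith.
  by linear_arith.
have G''b z : nc z <= rho / 4 -> nc (G'' z) * rho ^+ 2 <= 32 * A1.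
  move=> zr; have : nc (G'' z) * (rho / 4) <= 2 * (4 * A1 / rho).
    apply: (cauchy_estimate (f := G')); first by linear_arith.
      move=> u uz; have [] // := H u _; have := nc_lerB u z; linear_arith.
    move=> u uz; rewrite ler_pdivlMr //; apply: G'b2; have := nc_lerB u z; linear_arith.
  rewrite mulrA ler_pdivlMr // expr2; linear_arith.
have r4 : 0 < rho / 4 by linear_arith.
have [z zr Gz] := G'n0 _ r4.
have zr64 : nc z <= 64 * rho by linear_arith.
have [g1 g2 g3 eq h8] := H z zr64.
have id1 : G'' z * G' z + G' z * G'' z =
    h' z * cubic (G z) + h z * (cubic' (G z) * G' z).
  apply: (@hd_unique _ (fun u => h u * cubic (G u)) (fun u => G'' u * G' u + G' u * G'' u)
    (fun u => h' u * cubic (G u) + h u * (cubic' (G u) * G' u))).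
    apply: hd_near rho0 _ (hdM g2 g2) => u uz; split=> //.
    have ur : nc u <= 64 * rho by have := nc_lerB u z; linear_arith.
    by have [_ _ _ eqr _] := H u ur; rewrite -expr2.
  exact: hdM g3 (hd_cubic g1).
(* Multiply the differentiated equation [2 G' G'' = h' Q + h Q' G'] by [h], replace [h Q] by [G'^2]
   and cancel [G']; the cancellation is why a point with [G' z != 0] was chosen. *)
have id2 : h z ^+ 2 * cubic' (G z) = 2 * h z * G'' z - h' z * G' z.
  apply: (mulfI Gz).
  have -> : G' z * (2 * h z * G'' z - h' z * G' z) =
    h z * (G'' z * G' z + G' z * G'' z) - h' z * G' z ^+ 2 by ring.
  by rewrite id1 eq; ring.
have hz := hlow z ltac:(linear_arith).
have hz2 : 4^-1 <= nc (h z) ^+ 2.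
  have i0 : 0 <= 2^-1 :> R by rewrite invr_ge0.
  by have := ler_pM i0 i0 hz hz; rewrite expr2; linear_arith.
have rr0 : 0 < rho ^+ 2 by rewrite exprn_gt0.
have b1 : nc (cubic (G z)) * rho ^+ 2 <= 32 * A1 ^+ 2.
  have : 2^-1 * nc (cubic (G z)) <= nc (G' z) ^+ 2.
    by rewrite -ncX eq ncM ler_wpM2r ?nc_ge0.
  move=> /(ler_wpM2r (ltW rr0)); rewrite -exprMn.
  have p0 : 0 <= nc (G' z) * rho by rewrite mulr_ge0 ?nc_ge0 // ltW.
  have : (nc (G' z) * rho) ^+ 2 <= (4 * A1) ^+ 2.
    have g4 : nc (G' z) * rho <= 4 * A1 by apply: G'b2; linear_arith.
    by rewrite lerXn2r // nnegrE // (le_trans p0).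
  by rewrite (exprMn 2 4); linear_arith.
have b2 : nc (cubic' (G z)) * rho ^+ 2 <= V * A1.
  have k1 : 4^-1 * nc (cubic' (G z)) <= nc (2 * h z * G'' z - h' z * G' z).
    by rewrite -id2 ncM ncX ler_wpM2r ?nc_ge0.
  have k2 : nc (2 * h z * G'' z) * rho ^+ 2 <= 16 * (32 * A1).
    have q1 : 2 * nc (h z) <= 16 by linear_arith.
    have q2 : nc (G'' z) * rho ^+ 2 <= 32 * A1 by apply: G''b; linear_arith.
    rewrite !ncM nc_nat -mulrA; apply: ler_pM q1 q2.
      by rewrite mulr_ge0 ?nc_ge0.
    exact: mulr_ge0 (nc_ge0 _) (ltW rr0).
  have k3 : nc (h' z * G' z) * rho ^+ 2 <= 2^-1 * (4 * A1).
    have q1 : nc (h' z) <= 2^-1 / rho by apply: h'b; linear_arith.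
    rewrite ler_pdivlMr // in q1.
    have q2 : nc (G' z) * rho <= 4 * A1 by apply: G'b2; linear_arith.
    rewrite ncM expr2 mulrACA; apply: ler_pM => //;
      by rewrite mulr_ge0 ?nc_ge0 // ltW.
  have := ler_wpM2r (ltW rr0) (le_trans k1 (ncB _ _)).
  by rewrite VE; linear_arith.
have := ler_wpM2r (ltW rr0) (Hm (G z)).
have : m * rho <= m * rho ^+ 2.
  by rewrite ler_pM2l // expr2 ler_peMr ?(ltW rho0) //; linear_arith.
by rewrite KE in rhoK; linear_arith.
Qed.

(* Rescaling at an almost maximum of [(r - |z - c|)^2 |h z|]. *)
Lemma flat_schwarz : exists2 K : R, 0 < K & forall c r g g' g'' h h', 0 < r ->
  (forall z, nc (z - c) <= r -> [/\ hd g g' z, hd g' g'' z, hd h h' z &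
     g' z ^+ 2 = h z * cubic (g z)]) ->
  (forall z e, nc (z - c) <= r -> 0 < e -> exists2 u, nc (u - z) < e & g' u != 0) ->
  nc (h c) * r ^+ 2 <= K.
Proof.
have [r0 r00 flat] := flat_bounded.
(* A supremum above [8 * r0 ^+ 2] gives [d ^+ 2 * nc (h z1) > 4 * r0 ^+ 2] at the almost-maximum,
   which is the inequality [l * r0 < d / 2] after rescaling. *)
exists (8 * r0 ^+ 2); first by rewrite mulr_gt0 // exprn_gt0.
move=> c r g g' g'' h h' rp H nd.
rewrite leNgt; apply/negP => big.
have cr : nc (c - c) <= r by rewrite subrr nc0 ltW.
pose mu z := (r - nc (z - c)) ^+ 2 * nc (h z).
have hh z (Az : annulus c 0 r z) : hd h h' z.
  by have /andP[_ zr] := Az; have [] := H z zr.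
have [B B0 HB] := hd_bounded hh.
pose S := [set mu z | z in [set z | nc (z - c) <= r]].
have Sc : S (mu c) by exists c.
have hS : has_sup S.
  split; first by exists (mu c).
  exists (r ^+ 2 * B) => _ [z /= zr <-].
  have n0 := nc_ge0 (z - c).
  have Az : annulus c 0 r z by rewrite /annulus /= n0.
  have [hB _] := HB z Az; apply: ler_pM; rewrite ?sqr_ge0 ?nc_ge0 //.
  by rewrite lerXn2r ?nnegrE //; linear_arith.
have muc : mu c = nc (h c) * r ^+ 2 by rewrite /mu subrr nc0 subr0 mulrC.
have supc : mu c <= sup S by apply: ub_le_sup => //; exact: hS.2.
have r02 : 0 < r0 ^+ 2 by rewrite exprn_gt0.
have S0 : 0 < sup S by rewrite muc in supc; linear_arith.
have S2 : 0 < sup S / 2 by rewrite divr_gt0.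
have [_ [z1 /= z1r <-] hz1] := sup_adherent S2 hS.
have n1 := nc_ge0 (h z1).
pose d := r - nc (z1 - c).
have hz1' : sup S < 2 * (d ^+ 2 * nc (h z1)) by rewrite -/(mu z1); linear_arith.
have d0 : 0 < d.
  rewrite lt0r subr_ge0 z1r andbT; apply/eqP => d0.
  by move: hz1'; rewrite d0 expr0n /= mul0r mulr0; linear_arith.
have dd0 : 0 < d ^+ 2 by rewrite exprn_gt0.
have hp : 0 < nc (h z1).
  rewrite lt0r n1 andbT; apply/eqP => h0.
  by move: hz1'; rewrite h0 !mulr0; linear_arith.
(* Halving the distance to the boundary costs a factor 4, almost-maximality a factor 2: this is the
   8 of [flat_bounded]. *)
have hle z : nc (z - z1) <= d / 2 -> nc (z - c) <= r /\ nc (h z) <= 8 * nc (h z1).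
  move=> zz; have k1 := nc_distD z1 z c.
  have zr : nc (z - c) <= r by rewrite /d in zz; linear_arith.
  split=> //; have : mu z <= sup S.
    by apply: ub_le_sup; [exact: hS.2|exists z].
  move=> k3; have k2 : (d / 2) ^+ 2 * nc (h z) <= mu z.
    rewrite ler_wpM2r ?nc_ge0 // lerXn2r ?nnegrE //; rewrite /d in zz *; linear_arith.
  rewrite -(ler_pM2l dd0); have -> : d ^+ 2 * nc (h z) = 4 * ((d / 2) ^+ 2 * nc (h z)).
    by field.
  by linear_arith.
(* [h] transforms like a quadratic differential, with [l ^+ 2] under a rescaling by [l], so this [l]
   normalises it to modulus 1 at the centre. *)
pose l := (Num.sqrt (nc (h z1)))^-1.
have sp : 0 < Num.sqrt (nc (h z1)) by rewrite sqrtr_gt0.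
have lp : 0 < l by rewrite invr_gt0.
have l2 : l ^+ 2 * nc (h z1) = 1.
  by rewrite /l exprVn sqr_sqrtr // mulVf // gt_eqF.
have small : l * r0 <= d / 2.
  rewrite leNgt; apply/negP => h1.
  have h2 : (d / 2) ^+ 2 < (l * r0) ^+ 2.
    have p1 : 0 <= d / 2 by linear_arith.
    have p2 : 0 <= l * r0 by rewrite mulr_ge0 // ltW.
    by rewrite ltr_pXn2r ?nnegrE.
  have h3 : (d / 2) ^+ 2 * nc (h z1) < r0 ^+ 2.
    have -> : r0 ^+ 2 = (l * r0) ^+ 2 * nc (h z1).
      by rewrite (exprMn 2 l) mulrAC l2 mul1r.
    by rewrite ltr_pM2r.
  have : d ^+ 2 * nc (h z1) = 4 * ((d / 2) ^+ 2 * nc (h z1)) by field.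
  by rewrite muc in supc; linear_arith.
have disc z : nc z <= r0 -> nc (z1 + l%:C * z - z1) <= d / 2.
  move=> zr; apply: le_trans small.
  by rewrite addrC addKr ncM nc_real gtr0_norm // ler_pM2l.
apply: (flat (fun z => g (z1 + l%:C * z)) (fun z => l%:C * g' (z1 + l%:C * z))
  (fun z => l%:C * (l%:C * g'' (z1 + l%:C * z)))
  (fun z => (l ^+ 2)%:C * h (z1 + l%:C * z))
  (fun z => (l ^+ 2)%:C * (l%:C * h' (z1 + l%:C * z)))).
- move=> z /disc/hle[zr h8]; have [g1 g2 h3 eq] := H _ zr; split.
  + exact: hd_affine.
  + apply: hd_ext (hdM (hd_cst l%:C z) (hd_affine g2)) => u //.
    by rewrite mul0r add0r.
  + apply: hd_ext (hdM (hd_cst (l ^+ 2)%:C z) (hd_affine h3)) => u //.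
    by rewrite mul0r add0r.
  + by rewrite exprMn eq rmorphXn /= mulrA.
  + rewrite ncM nc_real ger0_norm ?sqr_ge0 //.
    have := ler_wpM2l (sqr_ge0 l) h8; have := l2; linear_arith.
- by rewrite mulr0 addr0 ncM nc_real ger0_norm ?sqr_ge0.
- move=> e e0; have le0 : 0 < l * e by rewrite mulr_gt0.
  have [u uz gu] := nd z1 (l * e) z1r le0.
  have lc : l%:C != 0 :> C by rewrite -nc_gt0 nc_real normr_gt0 gt_eqF.
  exists ((u - z1) / l%:C).
    by rewrite ncM ncV nc_real gtr0_norm // ltr_pdivrMr // mulrC.
  have -> : z1 + l%:C * ((u - z1) / l%:C) = u.
    by rewrite [l%:C * _]mulrC divfK // addrC subrK.
  by rewrite mulf_neq0.
Qed.

End FlatOrbifold.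

(** * Totally ramified values *)

Section Ramified.
Variable R : realType.
Local Notation C := R[i].
Implicit Types (f g h q : C -> C) (z c u v w a b : C) (e r s t B d x y : R).

Lemma hd_open f f' z : hd f f' z -> exists2 d : R, 0 < d &
  forall u, nc (u - z) < d -> hd f f' u.
Proof.
move=> [K [r [K0 r0 H]]]; exists (r / 2); first by rewrite divr_gt0.
move=> u uz; exists K, (r / 2); split; rewrite ?divr_gt0 // => v w vu wu.
by apply: H; [have := nc_distD u v z|have := nc_distD u w z]; linear_arith.
Qed.

(** Merges local derivatives into one function, as needed for the glued quotient in
    [ramified_bound]: [hd_unique] forces the values to agree. *)
Lemma hd_choose h : exists h' : C -> C, forall z k', hd h k' z -> hd h h' z.
Proof.
have ex u : exists l : C, forall k', hd h k' u -> k' u = l.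
  have [[k' hk]|no] := pselect (exists k', hd h k' u).
    by exists (k' u) => l' hl; apply: hd_unique hl hk.
  by exists 0 => k' hk; case: no; exists k'.
have [h' Hh'] := choice ex; exists h' => z k' hk.
have [d d0 Hd] := hd_open hk.
by apply: hd_near d0 _ hk => u /Hd hu; split=> //; exact: Hh'.
Qed.

Lemma hd_expn (c : C) m z :
  hd (fun u => (u - c) ^+ m) (fun u => m%:R * (u - c) ^+ m.-1) z.
Proof.
have hp := hd_horner (('X - c%:P) ^+ m) z.
apply: hd_ext hp => u; first by rewrite !hornerE.
rewrite deriv_exp derivXsubC mul1r hornerMn !hornerE.
by rewrite -[_ *+ m]mulr_natl.
Qed.

Lemma hd_nonzero f f' z : hd f f' z -> f z != 0 -> exists2 d : R, 0 < d &
  forall u, nc (u - z) < d -> f u != 0.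
Proof.
move=> hf fz; have [L [r [L0 r0 lip]]] := hd_lipschitz hf.
have n0 : 0 < nc (f z) by rewrite nc_gt0.
have L1 : 0 < L + 1 by linear_arith.
exists (Num.min r (nc (f z) / (L + 1))); first by rewrite lt_min r0 divr_gt0.
move=> u; rewrite lt_min ltr_pdivlMr // => /andP[ur uL].
have zz : nc (z - z) < r by rewrite subrr nc0.
have [h _ _ _] := lip _ _ ur zz; rewrite -nc_gt0.
have := nc_lerB (f z) (f u); rewrite (ncBC (f z)).
have := nc_ge0 (u - z); linear_arith.
Qed.

(* [g'^2] vanishes at [z0] to order [2 (m - 1) >= m]. *)
Lemma multiple_root_quotient a b c r g g' z0 m q : a != b -> a != c ->
  nc z0 < r -> (forall z, nc z < r -> hd g g' z) ->
  polylim 0 r q -> q z0 != 0 ->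
  (forall z, nc z <= r -> g z - a = (z - z0) ^+ m * q z) ->
  g z0 = a -> g' z0 = 0 ->
  exists H H' d, [/\ 0 < d, hd H H' z0 & forall u, nc (u - z0) < d ->
    H u * ((g u - a) * (g u - b) * (g u - c)) = g' u ^+ 2 /\
    (u != z0 -> (g u - a) * (g u - b) * (g u - c) != 0)].
Proof.
move=> ab ac z0r hg Hq q0 gq ga g'0.
pose s := (nc z0 + r) / 2.
have sr : s < r by rewrite /s; linear_arith.
have zs : nc z0 < s by rewrite /s; linear_arith.
have [q' [Hq' hq' _]] := polylim_deriv Hq.
have [q'' [_ hq'' _]] := polylim_deriv (Hq' _ sr).
have z00 : nc (z0 - 0) < r by rewrite subr0.
have z0s : nc (z0 - 0) < s by rewrite subr0.
have d1 : 0 < r - nc z0 by rewrite subr_gt0.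
have inr u : nc (u - z0) < r - nc z0 -> nc u < r by have := nc_lerB u z0; linear_arith.
have g'E u : nc (u - z0) < r - nc z0 ->
    g' u = m%:R * (u - z0) ^+ m.-1 * q u + (u - z0) ^+ m * q' u.
  move=> /inr ur.
  have hgu := hdB (hg _ ur) (hd_cst a u).
  have hpq := hdM (hd_expn z0 m u) (hq' u ltac:(by rewrite subr0)).
  have r0 : 0 < r - nc u by rewrite subr_gt0.
  have := @hd_near _ _ _ (fun v => (v - z0) ^+ m * q v) (fun v => g' v - 0) u _ r0 _ hgu.
  move=> /(_ _)/(hd_unique hpq); rewrite /= subr0 => -> //.
  move=> v vu; split=> //; apply: gq; have := nc_lerB v u; linear_arith.
case: m gq g'E => [|[|k]] gq g'E.
- have := gq z0 (ltW z0r); rewrite ga subrr mul1r => /esym/eqP.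
  by rewrite (negbTE q0).
- have := g'E z0; rewrite subrr nc0 => /(_ d1).
  rewrite g'0 mul1r expr0 mul1r expr1 mul0r addr0 => /esym/eqP.
  by rewrite (negbTE q0).
(* Here [g' u = (u - z0) ^+ k.+1 * S u] and the product of the three factors is
   [(u - z0) ^+ k.+2 * D u], so the quotient keeps the exponent [2 * k.+1 - k.+2 = k]. *)
pose S u := k.+2%:R * q u + (u - z0) * q' u.
pose D u := q u * ((g u - b) * (g u - c)).
have D0 : D z0 != 0 by rewrite /D ga !mulf_neq0 // subr_eq0.
have hlin := hdB (hd_id z0) (hd_cst z0 z0).
have hS := hdD (hdM (hd_cst k.+2%:R z0) (hq' _ z00)) (hdM hlin (hq'' _ z0s)).
have hD := hdM (hq' _ z00) (hdM (hdB (hg _ z0r) (hd_cst b z0)) (hdB (hg _ z0r) (hd_cst c z0))).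
have [d2 d20 Hd2] := hd_nonzero hD D0.
have hH := hdM (hdM (hd_expn z0 k z0) (hdM hS hS)) (hdV D0 hD).
exists (fun u => (u - z0) ^+ k * (S u * S u) * (D u)^-1); eexists.
exists (Num.min d2 (r - nc z0)); split; last 1 first.
- move=> u; rewrite lt_min => /andP[/Hd2 Du ud].
  have gu := gq u (ltW (inr u ud)).
  split.
    rewrite gu (g'E u ud) /=.
    have -> : (u - z0) ^+ k.+2 * q u * (g u - b) * (g u - c) =
       (u - z0) ^+ k.+2 * (q u * ((g u - b) * (g u - c))) by ring.
    have -> X P : X / D u * (P * (q u * ((g u - b) * (g u - c)))) = X * P.
      by change (X / D u * (P * D u) = X * P); rewrite mulrA mulrAC divfK.
    by rewrite /S !exprS; ring.
  move=> uz; rewrite gu.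
  have -> : (u - z0) ^+ k.+2 * q u * (g u - b) * (g u - c) =
    (u - z0) ^+ k.+2 * (q u * ((g u - b) * (g u - c))) by ring.
  have uz0 : u - z0 != 0 by rewrite subr_eq0.
  exact: mulf_neq0 (expf_neq0 _ uz0) Du.
- by rewrite lt_min d20.
- exact: hH.
Qed.

Variables a1 a2 a3 : C.
Hypotheses (a12 : a1 != a2) (a13 : a1 != a3) (a23 : a2 != a3).
Local Notation cubic := (cubic a1 a2 a3).

Lemma ramified_bound : exists2 K : R, 0 < K & forall r s g g' e, 0 < s -> 2 * s < r ->
  r < e -> polylim 0 e g ->
  polylim 0 r g' -> (forall z, nc z < e -> hd g g' z) -> g' 0 != 0 ->
  (forall z, nc z <= s -> cubic (g z) = 0 -> g' z = 0) ->
  nc (g' 0) ^+ 2 * s ^+ 2 <= K * nc (cubic (g 0)).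
Proof.
have [K K0 schwarz] := flat_schwarz a12 a13 a23.
exists K => // r s g g' e s0 sr re Hg Hg' hg g'n0 ram.
have g00 : cubic (g 0) != 0.
  apply/eqP => g0; move/eqP: g'n0; apply; apply: ram => //.
  by rewrite nc0 ltW.
have [g'' [_ hg' _]] := polylim_deriv Hg'.
have {}hg' z : nc z < r -> hd g' g'' z by move=> zr; apply: hg'; rewrite subr0.
(* Zeros of [g'] have finite order, hence are isolated; this supplies the nearby points with
   [g' u != 0] required by [flat_schwarz]. *)
have iso z0 : nc z0 <= s -> exists2 d, 0 < d & forall u, nc (u - z0) < d ->
    u != z0 -> g' u != 0.
  move=> z0s; have z0s' : nc (z0 - 0) <= s by rewrite subr0.
  have [m [q [Hq q0 gq]]] := polylim_order Hg' g'n0 z0s' sr.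
  have [q' [_ hq _]] := polylim_deriv Hq.
  have z0r : nc (z0 - 0) < r by rewrite subr0; linear_arith.
  have [d d0 Hd] := hd_nonzero (hq _ z0r) q0.
  exists (Num.min d s); first by rewrite lt_min d0.
  move=> u; rewrite lt_min => /andP[ud us] uz.
  have ur : nc (u - 0) <= r by rewrite subr0; have := nc_lerB u z0; linear_arith.
  by rewrite gq // mulf_neq0 ?Hd // expf_neq0 // subr_eq0.
have root_case a b c z0 : a != b -> a != c -> g 0 != a -> nc z0 <= s -> g z0 = a ->
   g' z0 = 0 -> exists H H' d, [/\ 0 < d, hd H H' z0 & forall u, nc (u - z0) < d ->
    H u * ((g u - a) * (g u - b) * (g u - c)) = g' u ^+ 2 /\
    (u != z0 -> (g u - a) * (g u - b) * (g u - c) != 0)].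
  move=> ab ac ga z0s gz0 g'z0.
  have Hga : polylim 0 r (fun z => g z - a).
    move=> x x0; have [p Hp] := Hg x x0; exists (p - a%:P) => z zr.
    have -> : (p - a%:P).[z] - (g z - a) = p.[z] - g z by rewrite !hornerE; ring.
    by apply: Hp; linear_arith.
  have z0s' : nc (z0 - 0) <= s by rewrite subr0.
  have ga0 : g 0 - a != 0 by rewrite subr_eq0.
  have [m [q [Hq q0 gq]]] := polylim_order Hga ga0 z0s' sr.
  apply: (@multiple_root_quotient a b c r g g' z0 m q) => //.
  - by linear_arith.
  - by move=> z zr; apply: hg; linear_arith.
  - by move=> z zr; apply: gq; rewrite subr0.
have loc z0 : nc z0 <= s -> exists H H' d, [/\ 0 < d, hd H H' z0 &
    forall u, nc (u - z0) < d -> H u * cubic (g u) = g' u ^+ 2 /\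
    (u != z0 -> cubic (g u) != 0)].
  move=> z0s; have z0e : nc z0 < e by linear_arith.
  have hc := hd_cubic a1 a2 a3 (hg _ z0e).
  have [cz|cz] := eqVneq (cubic (g z0)) 0; last first.
    have [d d0 Hd] := hd_nonzero hc cz.
    have hg'0 := hg' z0 ltac:(linear_arith).
    have hH := hdM (hdM hg'0 hg'0) (@hdV _ (fun u => cubic (g u)) _ z0 cz hc).
    eexists; eexists; exists d; split => //; first exact: hH.
    move=> u /Hd cu; split=> //=; by rewrite divfK.
  have g'z0 := ram z0 z0s cz.
  move: g00; rewrite /cubic !mulf_eq0 !subr_eq0 !negb_or => /andP[/andP[n1 n2] n3].
  move/eqP: cz; rewrite /cubic !mulf_eq0 !subr_eq0 => /orP[/orP[]|] /eqP gz0.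
  - exact: root_case gz0 g'z0.
  - have [H [H' [d [d0 hH Hd]]]] : exists H H' d, [/\ 0 < d, hd H H' z0 &
       forall u, nc (u - z0) < d ->
       H u * ((g u - a2) * (g u - a1) * (g u - a3)) = g' u ^+ 2 /\
      (u != z0 -> (g u - a2) * (g u - a1) * (g u - a3) != 0)].
      by apply: root_case gz0 g'z0; rewrite // eq_sym.
    exists H, H', d; split=> // u /Hd.
    by rewrite [(g u - a2) * (g u - a1)]mulrC.
  - have [H [H' [d [d0 hH Hd]]]] : exists H H' d, [/\ 0 < d, hd H H' z0 &
       forall u, nc (u - z0) < d ->
       H u * ((g u - a3) * (g u - a1) * (g u - a2)) = g' u ^+ 2 /\
      (u != z0 -> (g u - a3) * (g u - a1) * (g u - a2) != 0)].
      by apply: root_case gz0 g'z0; rewrite // eq_sym.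
    exists H, H', d; split=> // u /Hd.
    by rewrite -mulrA [(g u - a3) * _]mulrC.
have loc' z0 : exists H : C -> C, nc z0 <= s -> exists H' d, [/\ 0 < d, hd H H' z0 &
    forall u, nc (u - z0) < d -> H u * cubic (g u) = g' u ^+ 2 /\
    (u != z0 -> cubic (g u) != 0)].
  have [/loc[H h]|z0s] := leP (nc z0) s; first by exists H.
  by exists (fun=> 0).
have [H HH] := choice loc'.
(* At a zero of [cubic (g u)] the value is that of the local extension centred at [u] itself. Such
   zeros are isolated, so near any [z0] this agrees with [H z0]. *)
pose h u := if cubic (g u) == 0 then H u u else g' u ^+ 2 / cubic (g u).
have hh z0 : nc z0 <= s -> exists2 k', hd h k' z0 & h z0 * cubic (g z0) = g' z0 ^+ 2.
  move=> z0s; have [H' [d [d0 hH Hd]]] := HH z0 z0s.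
  have hE u : nc (u - z0) < d -> h u = H z0 u.
    move=> /Hd[eq nz]; rewrite /h; case: eqVneq => [cu|cu].
      by have [->//|/nz] := eqVneq u z0; rewrite cu eqxx.
    by rewrite -eq mulfK.
  have zz : nc (z0 - z0) < d by rewrite subrr nc0.
  exists H'; last by rewrite hE //; have [] := Hd z0 zz.
  by apply: hd_near d0 _ hH => u ud; rewrite hE.
have [h' Hh'] := hd_choose h.
have := schwarz 0 s g g' g'' h h' s0.
have fin : nc (h 0) = nc (g' 0) ^+ 2 / nc (cubic (g 0)).
  by rewrite /h (negbTE g00) ncM ncX ncV.
rewrite fin mulrAC ler_pdivrMr ?nc_gt0 //; apply.
- move=> z; rewrite subr0 => zs; have [k' hk eq] := hh z zs; split=> //.
  + by apply: hg; linear_arith.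
  + by apply: hg'; linear_arith.
  + exact: Hh' hk.
- move=> z x; rewrite subr0 => zs x0; have [d d0 Hd] := iso z zs.
  have m0 : 0 < Num.min d x by rewrite lt_min d0.
  pose t := Num.min d x / 2.
  have t0 : 0 < t by rewrite divr_gt0.
  have tm : t < Num.min d x by rewrite /t; linear_arith.
  have nt : nc (z + t%:C - z) = t by rewrite addrC addKr nc_real gtr0_norm.
  move: tm; rewrite lt_min => /andP[td tx].
  exists (z + t%:C); rewrite ?nt // Hd ?nt // -subr_eq0 -nc_gt0 nt //.
Qed.

(* If [p] had no zero near [z0], then [1/p] would violate the maximum principle. *)
Lemma hurwitz k k' z0 s : hd k k' z0 -> k z0 = 0 -> k' z0 != 0 -> 0 < s ->
  exists t e, [/\ 0 < t, t <= s, 0 < e & forall p : {poly C},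
    (forall z, nc (z - z0) <= t -> nc (p.[z] - k z) <= e) ->
    exists2 z, nc (z - z0) <= t & p.[z] = 0].
Proof.
move=> [K [d [K0 d0 H]]] k0 k'0 s0.
have n0 : 0 < nc (k' z0) by rewrite nc_gt0.
have K1 : 0 < 2 * K + 1 by linear_arith.
(* On the circle of radius [t] the quadratic remainder is at most half of the linear term. With the
   tolerance chosen below, [nc p.[z]] is at least 3/8 of [nc (k' z0) * t] there, but at most 1/8 of
   it at the centre. *)
pose t := Num.min s (Num.min (d / 2) (nc (k' z0) / (2 * K + 1))).
have t0 : 0 < t by rewrite !lt_min s0 !divr_gt0.
have ts : t <= s by rewrite ge_min lexx.
have td : t < d by rewrite !gt_min; apply/orP; right; apply/orP; left; linear_arith.
have tK : t * (2 * K + 1) <= nc (k' z0).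
  by rewrite -ler_pdivlMr // !ge_min lexx !orbT.
exists t, (nc (k' z0) * t / 8); split=> //; first by rewrite divr_gt0 // mulr_gt0.
move=> p Hp; apply: contrapT => nz.
have pn0 z : nc (z - z0) <= t -> p.[z] != 0.
  by move=> zt; apply/eqP => pz; apply: nz; exists z.
have zz : nc (z0 - z0) <= t by rewrite subrr nc0 ltW.
have zd : nc (z0 - z0) < d by linear_arith.
have circ z : nc (z - z0) = t -> nc (k' z0) * t * 3 / 8 <= nc p.[z].
  move=> zt; have h1 := H z z0; rewrite k0 subr0 zt in h1.
  have {}h1 := h1 td zd.
  have h2 := nc_lerB (k' z0 * (z - z0)) (k z); rewrite ncBC ncM zt in h2.
  have zt' : nc (z - z0) <= t by rewrite zt.
  have h3 := Hp z zt'; have h4 := nc_lerB (k z) p.[z]; rewrite (ncBC (k z)) in h4.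
  have h5 : K * t ^+ 2 <= nc (k' z0) * t / 2.
    have := ler_wpM2r (ltW t0) tK; rewrite expr2; have := mulr_gt0 t0 t0; linear_arith.
  by linear_arith.
have kt0 : 0 < nc (k' z0) * t by rewrite mulr_gt0.
have := @max_principle _ (fun u => (p.[u])^-1) _ z0 t (8 / 3 / (nc (k' z0) * t)) (ltW t0)
  (fun z zt => hdV (pn0 z zt) (hd_horner p z)).
move=> /(_ _)/wrap[].
  move=> z zt; rewrite ncV -[leRHS]invrK lef_pV2 ?posrE ?invr_gt0 ?divr_gt0 //.
    by rewrite invf_div; have := circ z zt; linear_arith.
  by rewrite nc_gt0 pn0 // zt.
rewrite ncV; have := Hp z0 zz; rewrite k0 subr0 => h1.
have p0 : 0 < nc p.[z0] by rewrite nc_gt0 pn0.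
rewrite -[leRHS]invrK lef_pV2 ?posrE ?invr_gt0 ?divr_gt0 //.
by rewrite invf_div; linear_arith.
Qed.

End Ramified.

(** * Rescaling *)

Section Rescaling.
Variable R : realType.
Local Notation C := R[i].
Implicit Types (z c u v w : C) (e r s t B d x y M : R) (p f : {poly C}).

Definition rescale f z r : {poly C} := f \Po (r%:C%:P * 'X + z%:P).

Lemma rescaleE f z r u : (rescale f z r).[u] = f.[z + r%:C * u].
Proof. by rewrite horner_comp !hornerE addrC. Qed.

Lemma deriv_rescaleE f z r u :
  (rescale f z r)^`().[u] = r%:C * f^`().[z + r%:C * u].
Proof.
rewrite deriv_comp hornerM horner_comp derivD derivM derivC derivX derivC.
have -> : ((r%:C)%:P * 'X + z%:P).[u] = z + r%:C * u by rewrite !hornerE addrC.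
by rewrite mul0r add0r mulr1 addr0 hornerC mulrC.
Qed.

(** The weight [n^-1 - nc (z - w0)] vanishes on the boundary, which pushes almost-maxima inside. The
    factor 4 combines almost-maximality with halving the weight. *)
Lemma rescaling_lemma (F : set {poly C}) w0 :
  (forall r M, 0 < r -> exists f z, [/\ F f, nc (z - w0) <= r &
     M * (1 + nc f.[z] ^+ 2) < nc f^`().[z]]) ->
  forall N : nat, exists f z r, [/\ F f, 0 < r, r <= N.+1%:R^-1,
     nc (z - w0) <= N.+1%:R^-1 &
     let g := rescale f z r in nc g^`().[0] = 1 + nc g.[0] ^+ 2 /\
     forall u, nc u <= N%:R -> nc g^`().[u] <= 4 * (1 + nc g.[u] ^+ 2)].
Proof.
move=> nF N; have N0 : 0 < N.+1%:R :> R by [].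
have [n nE] : exists n : R, n = N.+1%:R by exists N.+1%:R.
rewrite -nE in N0 *.
have Nn : N%:R = n - 1 :> R by rewrite nE -natr1 addrK.
have n1 : 1 <= n by rewrite nE ler1n.
have d0 : 0 < n^-1 by rewrite invr_gt0.
(* At [y] the weight is at least [n^-1 / 2], so the supremum is at least [4 * n] and the scale
   satisfies [2 * n * r <= d]: a rescaled disc of radius [n] stays within [d / 2] of the new
   centre. *)
have [f [y [Ff yd fy]]] := nF (n^-1 / 2) (8 * n ^+ 2) ltac:(linear_arith).
pose sph z := nc f^`().[z] / (1 + nc f.[z] ^+ 2).
have D0 z : 0 < 1 + nc f.[z] ^+ 2 by have := sqr_ge0 (nc f.[z]); linear_arith.
have D1 z : 1 <= 1 + nc f.[z] ^+ 2 by have := sqr_ge0 (nc f.[z]); linear_arith.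
have sph0 z : 0 <= sph z by rewrite divr_ge0 ?nc_ge0 // ltW.
pose mu z := (n^-1 - nc (z - w0)) * sph z.
pose S := [set mu z | z in [set z | nc (z - w0) <= n^-1]].
have [B B0 HB] := poly_bounded f^`() w0 n^-1.
have yd' : nc (y - w0) <= n^-1 by linear_arith.
have Sy : S (mu y) by exists y.
have hS : has_sup S.
  split; first by exists (mu y).
  exists (n^-1 * B) => _ [z /= zr <-].
  have z0 := nc_ge0 (z - w0).
  apply: ler_pM => //; [linear_arith|linear_arith|].
  by rewrite ler_pdivrMr // (le_trans (HB z zr)) // ler_peMr.
have muS z : nc (z - w0) <= n^-1 -> mu z <= sup S.
  by move=> zr; apply: ub_le_sup; [exact: hS.2|exists z].
have sy : 8 * n ^+ 2 < sph y by rewrite ltr_pdivlMr.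
have S4 : 4 * n <= sup S.
  apply: le_trans (muS y yd'); have h : n^-1 / 2 <= n^-1 - nc (y - w0) by linear_arith.
  have n20 : 0 <= 8 * n ^+ 2 by rewrite mulr_ge0 // sqr_ge0.
  have n22 : 0 <= n^-1 / 2 by linear_arith.
  apply: le_trans (ler_pM n22 n20 h (ltW sy)).
  by rewrite le_eqVlt; apply/orP; left; apply/eqP; field; rewrite gt_eqF.
have S0 : 0 < sup S by linear_arith.
have S2 : 0 < sup S / 2 by linear_arith.
have [_ [z1 /= z1r <-] hz1] := sup_adherent S2 hS.
pose d := n^-1 - nc (z1 - w0).
have dn : d <= n^-1 by rewrite /d; have := nc_ge0 (z1 - w0); linear_arith.
have hz1' : sup S < 2 * (d * sph z1) by rewrite -/(mu z1); linear_arith.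
have dp : 0 < d.
  rewrite lt0r subr_ge0 z1r andbT; apply/eqP => d00.
  by move: hz1'; rewrite d00 mul0r mulr0; linear_arith.
have sp : 0 < sph z1.
  rewrite lt0r sph0 andbT; apply/eqP => s0.
  by move: hz1'; rewrite s0 !mulr0; linear_arith.
have near z : nc (z - z1) <= d / 2 -> sph z <= 4 * sph z1.
  move=> zz; have k1 := nc_distD z1 z w0.
  have zr : nc (z - w0) <= n^-1 by rewrite /d in zz; linear_arith.
  have k2 : d / 2 * sph z <= mu z.
    have h : d / 2 <= n^-1 - nc (z - w0) by rewrite /d in zz *; linear_arith.
    exact: ler_wpM2r (sph0 z) _ _ h.
  have := muS z zr => k3; rewrite -(ler_pM2l dp); linear_arith.
pose r := (sph z1)^-1.
have rp : 0 < r by rewrite invr_gt0.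
have rs : r * sph z1 = 1 by rewrite mulVf // gt_eqF.
have rd : 2 * n * r <= d.
  have e : 2 * n * r * sph z1 = 2 * n by rewrite -(mulrA (2 * n)) rs mulr1.
  rewrite -(ler_pM2r sp) e; linear_arith.
exists f, z1, r; split => //.
  apply: le_trans dn; apply: le_trans rd; rewrite -[leLHS]mul1r ler_pM2r //; linear_arith.
have rC : 0 <= r := ltW rp.
split.
  rewrite rescaleE deriv_rescaleE mulr0 addr0 ncM nc_real ger0_norm //.
  have : nc f^`().[z1] = sph z1 * (1 + nc f.[z1] ^+ 2) by rewrite divfK // gt_eqF.
  by move=> ->; rewrite mulrA rs mul1r.
move=> u; rewrite Nn => uN; rewrite rescaleE deriv_rescaleE ncM nc_real ger0_norm //.
set z := z1 + _; have zz : nc (z - z1) <= d / 2.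
  rewrite /z addrC addKr ncM nc_real ger0_norm //.
  have : r * nc u <= r * n by rewrite ler_wpM2l //; linear_arith.
  by linear_arith.
have := near z zz; rewrite ler_pdivrMr // => h.
have := ler_wpM2l rC h; rewrite mulrA (mulrCA r 4) rs mulr1; linear_arith.
Qed.

End Rescaling.

(** * Repelling fixed points and the bound on spherical derivatives *)

Section SphericalBound.
Variable R : realType.
Local Notation C := R[i].
Implicit Types (z c u v w : C) (e r s t B d x y M : R) (p f : {poly C}).

Lemma hd_horner_comp p (g g' : C -> C) z : hd g g' z ->
  hd (fun u => p.[g u]) (fun u => p^`().[g u] * g' u) z.
Proof.
move=> hg; elim/poly_ind: p => [|p c IH].
  by apply: hd_ext (hd_cst 0 z) => u; rewrite ?deriv0 horner0 ?mul0r.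
apply: hd_ext (hdD (hdM IH hg) (hd_cst c z)) => u /=.
  by rewrite hornerMXaddC.
by rewrite derivMXaddC !hornerE; ring.
Qed.

Lemma homo_ge_id (phi : nat -> nat) : {homo phi : m n / (m < n)%N} ->
  forall n, (n <= phi n)%N.
Proof. by move=> H; elim=> // n IH; apply: leq_ltn_trans IH (H _ _ _). Qed.

(** Keeps infinity away from the rescaled centre: the normalised derivative is of order |p(0)|^2,
    whereas [growth_bound] allows only |p(0)| ln |p(0)|. The radius [16^-1] is the largest
    admissible for the spherical bound 4. *)
Lemma rescaled_center_bounded : exists2 A : R, 0 <= A & forall p,
  nc p^`().[0] = 1 + nc p.[0] ^+ 2 ->
  (forall u, nc u <= 1 -> nc p^`().[u] <= 4 * (1 + nc p.[u] ^+ 2)) -> nc p.[0] <= A.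
Proof.
have [W WE] : exists W : R, W = 8 * 16 by eexists.
have W0 : 0 <= W by rewrite WE; linear_arith.
exists (2 + W ^+ 2); first by have := sqr_ge0 W; linear_arith.
move=> p p0 pu; rewrite leNgt; apply/negP => big.
set x := nc p.[0] in p0 big *.
have x2 : 2 < x by have := sqr_ge0 W; linear_arith.
have x0 : 0 < x by linear_arith.
have x3 : 3 <= x ^+ 2.
  have := ler_pM (ler0n _ 2) (ler0n _ 2) (ltW x2) (ltW x2).
  by rewrite -expr2; linear_arith.
have d0 : 0 < 16^-1 :> R by rewrite invr_gt0.
have Md : 4 * 16^-1 <= 4^-1 :> R by linear_arith.
have : nc p^`().[0] * 16^-1 <= x * ln (x ^+ 2).
  apply: (@growth_bound _ (horner p) (horner p^`()) (horner p^`()^`()) 0 16^-1 4) => //.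
  move=> z; rewrite subr0 => zd; split; [exact: hd_horner|exact: hd_horner|].
  by apply: pu; linear_arith.
have := ln_sqr_le x0; set y := Num.sqrt x.
have y0 : 0 < y by rewrite sqrtr_gt0.
have xy : x = y ^+ 2 by rewrite sqr_sqrtr // ltW.
have y1 : 1 <= y by rewrite -sqrtr1 ler_wsqrtr //; linear_arith.
have yy : Num.sqrt y <= y.
  have s1 : 1 <= Num.sqrt y by rewrite -sqrtr1 ler_wsqrtr.
  have := ler_wpM2l (sqrtr_ge0 y) s1; rewrite mulr1 -expr2 sqr_sqrtr //; exact: ltW.
move=> h1 h2; rewrite p0 in h2.
have h3 : x * ln (x ^+ 2) <= x * (8 * y).
  by rewrite ler_wpM2l ?(ltW x0) //; linear_arith.
have h4 : x * x <= x * (W * y) by rewrite WE; rewrite expr2 in h2; linear_arith.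
rewrite ler_pM2l // in h4.
have h5 : y <= W by rewrite -(ler_pM2r y0) -expr2 -xy.
have h6 : x <= W ^+ 2 by rewrite xy lerXn2r // nnegrE // ltW.
linear_arith.
Qed.

(** The polynomial [q = P \Po p - (zn + rn X)] is close to [P \o G - w0], and its zeros are fixed
    points of [P \Po f] in the rescaled variable. Its derivative there is [rn] times the multiplier
    minus 1, and stays near a nonzero number while [rn] is small. *)
Lemma fixed_point_near_limit P w0 G G' z r B eps :
  (forall u, nc u < r -> hd G G' u) -> nc z + 1 <= r -> 0 <= B ->
  P.[G z] = w0 -> P^`().[G z] != 0 -> G' z != 0 -> 0 < eps ->
  exists e, 0 < e /\ forall f zn rn, 0 < rn -> rn <= e -> nc (zn - w0) <= e ->
    (forall u, nc u <= r -> nc (rescale f zn rn).[u] <= B /\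
       nc ((rescale f zn rn).[u] - G u) <= e) ->
    exists Z, [/\ nc (Z - w0) < eps, P.[f.[Z]] = Z &
      1 < nc (P^`().[f.[Z]] * f^`().[Z])].
Proof.
move=> hG zr B0 Pz P'z G'z eps0.
have zz0 := nc_ge0 z; have r0 : 0 <= r by linear_arith.
pose k u := P.[G u] - w0; pose k' u := P^`().[G u] * G' u - 0.
have hk u : nc u < r -> hd k k' u.
  by move=> ur; apply: hdB (hd_cst w0 u); apply: hd_horner_comp; exact: hG.
have kz : k z = 0 by rewrite /k Pz subrr.
have k'z : k' z != 0 by rewrite /k' subr0 mulf_neq0.
have n0 : 0 < nc (k' z) by rewrite nc_gt0.
have zr' : nc z < r by linear_arith.
have [t [e [t0 [t4 k't] e0 hur]]] : exists t e, [/\ 0 < t, t <= 4^-1 /\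
    (forall u, nc (u - z) <= t -> nc (k' u - k' z) <= nc (k' z) / 4), 0 < e &
    forall p : {poly C}, (forall z0, nc (z0 - z) <= t -> nc (p.[z0] - k z0) <= e) ->
    exists2 z0, nc (z0 - z) <= t & p.[z0] = 0].
  have [L [r1 [L0 r10 lip]]] := hd_lipschitz (hk z zr').
  have L1 : 0 < L + 1 by linear_arith.
  pose s2 := Num.min 4^-1 (Num.min (r1 / 2) (nc (k' z) / 4 / (L + 1))).
  have s20 : 0 < s2 by rewrite !lt_min invr_gt0 !divr_gt0 ?ltr0n.
  have s2h : s2 <= 4^-1 by rewrite ge_min lexx.
  have s2r : s2 < r1 by rewrite !gt_min; apply/orP; right; apply/orP; left; linear_arith.
  have s2L : s2 * (L + 1) <= nc (k' z) / 4.
    by rewrite -ler_pdivlMr // !ge_min lexx !orbT.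
  have [t [e [t0 ts e0 hur]]] := hurwitz (hk z zr') kz k'z s20.
  exists t, e; split=> //; split=> [|x xt]; first exact: le_trans s2h.
  have xr : nc (x - z) < r1 by linear_arith.
  have zr1 : nc (z - z) < r1 by rewrite subrr nc0.
  have [_ h _ _] := lip _ _ xr zr1; apply: le_trans h _.
  have := ler_wpM2l L0 (le_trans xt ts); linear_arith.
have [L2 L20 HL2] := poly_bounded P^`() 0 (B + 1).
(* [D * i] bounds [nc (q.[u] - k u)]: [L2] for moving the argument of [P], 1 for the centre [zn],
   and [r] for the term [rn * u]. *)
have [D DE] : exists D : R, D = L2 + r + 1 by eexists.
have D1 : 1 <= D by linear_arith.
have D0 : 0 < D by linear_arith.
have m0 : 0 < Num.min (Num.min e eps) (nc (k' z) / 24) / (2 * D).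
  by rewrite divr_gt0 ?mulr_gt0 // !lt_min e0 eps0 divr_gt0.
have [i [i0 i1 [ie ieps ik]]] : exists i : R, [/\ 0 < i, i <= 1 &
    [/\ 2 * (D * i) <= e, 2 * (D * i) <= eps & 2 * (D * i) <= nc (k' z) / 24]].
  exists (Num.min 1 (Num.min (Num.min e eps) (nc (k' z) / 24) / (2 * D))).
  have le : forall i : R, i <= Num.min (Num.min e eps) (nc (k' z) / 24) / (2 * D) ->
    [/\ 2 * (D * i) <= e, 2 * (D * i) <= eps & 2 * (D * i) <= nc (k' z) / 24].
    move=> i; rewrite ler_pdivlMr ?mulr_gt0 // mulrC -mulrA !le_min.
    by move=> /andP[/andP[? ?] ?].
  split; first by rewrite lt_min ltr01.
    by rewrite ge_min lexx.
  by apply: le; rewrite ge_min lexx orbT.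
move: m0 => _; exists i; split=> // f zn rn rn0 rni zni.
set p := rescale f zn rn => Hp.
have iD : i <= D * i by rewrite ler_peMl // ltW.
pose q := P \Po p - (zn%:P + rn%:C%:P * 'X).
have qE u : q.[u] = P.[p.[u]] - (zn + rn%:C * u).
  by rewrite /q !hornerE horner_comp.
have shift u x : nc u <= x -> nc (rn%:C * u) <= i * x.
  by move=> ux; rewrite ncM nc_real gtr0_norm // ler_pM ?nc_ge0 // ltW.
have qk u : nc u <= r -> nc (q.[u] - k u) <= D * i.
  move=> ur; have [pA pu] := Hp u ur.
  have Gu : nc (G u) <= B + 1.
    by have := nc_lerB (G u) p.[u]; rewrite (ncBC (G u)); linear_arith.
  have hP : nc (P.[p.[u]] - P.[G u]) <= L2 * nc (p.[u] - G u).
    apply: (hd_mvt_nc (f := horner P) (f' := horner P^`())).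
      by move=> x _; exact: hd_horner.
    move=> x hx; apply: HL2; apply: segment_in_disc hx; rewrite subr0 //.
    by apply: le_trans pA _; rewrite lerDl.
  have -> : q.[u] - k u = (P.[p.[u]] - P.[G u]) - ((zn - w0) + rn%:C * u).
    by rewrite qE /k; ring.
  apply: le_trans (ncB _ _) _.
  have h1 := ncD (zn - w0) (rn%:C * u).
  have h2 := shift u r ur.
  have h3 := ler_wpM2l L20 pu.
  have -> : D * i = L2 * i + (i + i * r) by rewrite DE; ring.
  apply: lerD; first exact: le_trans hP h3.
  exact: le_trans h1 (lerD zni h2).
have [|x xt qx] := hur q.
  move=> u ut; apply: le_trans (qk u _) _.
    by apply: le_trans zr; have := nc_lerB u z; linear_arith.
  by apply: le_trans ie; rewrite ler_peMl ?mulr_ge0 ?(ltW D0) ?(ltW i0) // ler1n.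
have xs : nc x <= nc z + 4^-1 by have := nc_lerB x z; linear_arith.
have {ie}k'x := k't x xt.
have Px : P.[p.[x]] = zn + rn%:C * x.
  by move/eqP: qx; rewrite qE subr_eq0 => /eqP.
have pf : p.[x] = f.[zn + rn%:C * x] by rewrite /p rescaleE.
have qd : q^`().[x] = rn%:C * (P^`().[p.[x]] * f^`().[zn + rn%:C * x]) - rn%:C.
  have -> : q^`() = (P^`() \Po p) * p^`() - rn%:C%:P.
    by rewrite /q derivB deriv_comp derivD derivC derivM derivC derivX mul0r !add0r mulr1.
  by rewrite !hornerE horner_comp /p deriv_rescaleE mulrCA mulrA.
exists (zn + rn%:C * x); rewrite -pf; split=> //.
  have -> : zn + rn%:C * x - w0 = (zn - w0) + rn%:C * x by ring.
  apply: le_lt_trans (ncD _ _) _.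
  have xr : nc x <= r by linear_arith.
  apply: le_lt_trans (lerD zni (shift x r xr)) _.
  have h3 : i + i * r <= D * i.
    have -> : D * i = L2 * i + (i + i * r) by rewrite DE; ring.
    by rewrite lerDr mulr_ge0 // ltW.
  by apply: le_lt_trans h3 _; have := mulr_gt0 D0 i0; linear_arith.
rewrite ltNge; apply/negP => fixle.
have qd' : nc q^`().[x] <= 2 * (D * i).
  rewrite qd; apply: le_trans (ncB _ _) _; rewrite ncM nc_real gtr0_norm //.
  by have := ler_wpM2l (ltW rn0) fixle; linear_arith.
have cau : nc (q^`().[x] - k' x) * 2^-1 <= 2 * (D * i).
  apply: (@cauchy_estimate _ (fun u => q.[u] - k u) (fun u => q^`().[u] - k' u)).
  - by rewrite invr_gt0.
  - move=> u ux; apply: hdB; first exact: hd_horner.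
    by apply: hk; have := nc_lerB u x; linear_arith.
  - by move=> u ux; apply: qk; have := nc_lerB u x; linear_arith.
have g1 := nc_lerB (k' z) (k' x); rewrite (ncBC (k' z)) in g1.
have g2 := nc_lerB (k' x) q^`().[x]; rewrite (ncBC (k' x)) in g2.
linear_arith.
Qed.

Lemma spherical_bounded (F : set {poly C}) w0 (P : {poly C}) a1 a2 a3 eps :
  a1 != a2 -> a1 != a3 -> a2 != a3 -> 0 < eps ->
  (forall a, a \in [:: a1; a2; a3] -> P.[a] = w0 /\ P^`().[a] != 0) ->
  (forall f z, F f -> nc (z - w0) < eps -> P.[f.[z]] = z ->
     nc (P^`().[f.[z]] * f^`().[z]) <= 1) ->
  exists r M, 0 < r /\ forall f z, F f -> nc (z - w0) <= r ->
    nc f^`().[z] <= M * (1 + nc f.[z] ^+ 2).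
Proof.
move=> a12 a13 a23 eps0 Pa nofix; apply: contrapT => nb.
have nF r M : 0 < r -> exists f z, [/\ F f, nc (z - w0) <= r &
     M * (1 + nc f.[z] ^+ 2) < nc f^`().[z]].
  move=> r0; apply: contrapT => no; apply: nb; exists r, M; split=> // f z Ff zr.
  by rewrite leNgt; apply/negP => h; apply: no; exists f, z.
have ex N : exists T : {poly C} * C * R, let f := T.1.1 in let z := T.1.2 in let r := T.2 in
    [/\ F f, 0 < r, r <= N.+1%:R^-1, nc (z - w0) <= N.+1%:R^-1 &
     let g := rescale f z r in nc g^`().[0] = 1 + nc g.[0] ^+ 2 /\
     forall u, nc u <= N%:R -> nc g^`().[u] <= 4 * (1 + nc g.[u] ^+ 2)].
  by have [f [z [r H]]] := rescaling_lemma nF N; exists (f, z, r).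
have [T HT] := choice ex => {ex nF nb}.
have [K K0 ram] := ramified_bound a12 a13 a23.
have [A A0 HA] := rescaled_center_bounded.
have [CU CU0 HCU] := @hd_bounded _ (cubic a1 a2 a3) _ 0 0 A
  (fun z _ => hd_cubic a1 a2 a3 (hd_id z)).
(* With [nc (G' 0) >= 1], [ramified_bound] will give [s ^+ 2 <= K * CU = s - 1], impossible for
   [s >= 1]. *)
have [s sE] : exists s : R, s = 1 + K * CU by eexists.
have KC0 : 0 <= K * CU by rewrite mulr_ge0 // ltW.
have s1 : 1 <= s by linear_arith.
have s23 : 2 * s < 3 * s by linear_arith.
have s31 : 3 * s < 3 * s + 1 by linear_arith.
have [A2 A20 HA2] := loglog_inv (loglog A + (4 * 4 + 2 / 16^-1) * (3 * s + 2)).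
(* Skipping [N0] terms makes the derivative bounds valid up to radius [3 * s + 3]. The nested radii
   are then [3 * s + 2] for boundedness, [3 * s + 1] for the limit, [3 * s] for its derivative and
   [s] for ramification. *)
pose N0 := (Num.truncn (3 * s + 3)).+1.
pose g n := rescale (T (n + N0)%N).1.1 (T (n + N0)%N).1.2 (T (n + N0)%N).2.
have N0le n : 3 * s + 3 <= (n + N0)%:R.
  apply: le_trans (ltW (truncnS_gt _)) _; by rewrite ler_nat leq_addl.
have gder n u : nc u <= 3 * s + 3 -> nc (g n)^`().[u] <= 4 * (1 + nc (g n).[u] ^+ 2).
  by move=> us; have [_ _ _ _ [_]] := HT (n + N0)%N; apply; exact: le_trans (N0le n).
have gcenter n : nc (g n)^`().[0] = 1 + nc (g n).[0] ^+ 2.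
  by have [_ _ _ _ [->]] := HT (n + N0)%N.
have gA n : nc (g n).[0] <= A.
  by apply: HA => // u u1; apply: gder; linear_arith.
have gA2 n z : nc (z - 0) <= 3 * s + 2 -> nc (g n).[z] <= A2.
  move=> zs; apply: HA2; first exact: nc_ge0.
  have d0 : 0 < 16^-1 :> R by rewrite invr_gt0.
  have Md : 4 * 16^-1 <= 4^-1 :> R by linear_arith.
  have c0 : nc (0 - 0 : C) <= 3 * s + 2 by rewrite subrr nc0; linear_arith.
  have := @loglog_lipschitz _ (horner (g n)) (horner (g n)^`()) (horner (g n)^`()^`())
    0 (3 * s + 2) 16^-1 4 0 z d0 (ler0n _ _) Md.
  move=> /(_ _ c0 zs)/le_trans; apply.
    move=> u; rewrite subr0 => us; split; [exact: hd_horner|exact: hd_horner|].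
    by apply: gder; linear_arith.
  apply: lerD; first exact: le_loglog (nc_ge0 _) (gA n).
  by apply: ler_wpM2l => //; rewrite addr_ge0 // divr_ge0 // invr_ge0.
have [|//|phi [G [phiH HG]]] := @montel _ g 0 (3 * s + 2) (3 * s + 1) A2 _ _ gA2.
- by linear_arith.
- by linear_arith.
have plG : polylim 0 (3 * s + 1) G.
  move=> e e0; have [N HN] := inv_succ_small e0; exists (g (phi N)) => z zr.
  exact: le_trans (HG N z zr) (ltW (HN N (leqnn N))).
have [G' [plG' hG' est]] := polylim_deriv plG.
have small e : 0 < e -> exists n : nat, n.+1%:R^-1 <= e.
  by move=> e0; have [N HN] := inv_succ_small e0; exists N; exact: ltW (HN N _).
have GA : nc (G 0) <= A.
  apply/ler_addgt0Pl => e /small[n ne]; have := HG n 0.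
  rewrite subrr nc0 => /(_ ltac:(linear_arith))/le_trans/(_ ne) h.
  have := nc_lerB (G 0) (g (phi n)).[0]; rewrite (ncBC (G 0)).
  by have := gA (phi n); linear_arith.
have G'1 : 1 <= nc (G' 0).
  apply/ler_addgt0Pl => e e0; have e2 : 0 < e / 2 by linear_arith.
  have [n ne] := small _ e2.
  have sr : 0 < 3 * s + 1 by linear_arith.
  have := est 0 _ (g (phi n)) sr (HG n) 0; rewrite subrr nc0 lexx subr0 => /(_ isT) h.
  have n0 := nc_ge0 ((g (phi n))^`().[0] - G' 0).
  have h2 : nc ((g (phi n))^`().[0] - G' 0) <= e.
    have {}h : nc ((g (phi n))^`().[0] - G' 0) * (3 * s + 1) <= 2 * (e / 2).
      by apply: le_trans h _; rewrite ler_pM2l.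
    by apply: le_trans (_ : _ <= 2 * (e / 2)) _; [apply: le_trans h; rewrite ler_peMr //|]; linear_arith.
  have := nc_lerB (g (phi n))^`().[0] (G' 0); rewrite gcenter.
  by have := sqr_ge0 (nc (g (phi n)).[0]); linear_arith.
have ramG z : nc z <= s -> cubic a1 a2 a3 (G z) = 0 -> G' z = 0.
  move=> zs cz; apply: contrapT => /eqP G'z.
  have [Pz P'z] : P.[G z] = w0 /\ P^`().[G z] != 0.
    apply: Pa; move/eqP: cz; rewrite /cubic !mulf_eq0 !subr_eq0 !inE.
    by rewrite orbA.
  have zs1 : nc z + 1 <= 3 * s + 1 by linear_arith.
  have hG2 u : nc u < 3 * s + 1 -> hd G G' u by move=> us; apply: hG'; rewrite subr0.
  have [i [i0 Hi]] := fixed_point_near_limit hG2 zs1 A20 Pz P'z G'z eps0.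
  have [n ni] := small i i0.
  have gE : g (phi n) = rescale (T (phi n + N0)%N).1.1 (T (phi n + N0)%N).1.2
    (T (phi n + N0)%N).2 by [].
  have [Ff rn0 rni zni _] := HT (phi n + N0)%N.
  have inle : (phi n + N0).+1%:R^-1 <= i.
    apply: le_trans ni; rewrite lef_pV2 ?posrE //.
    by rewrite ler_nat ltnS (leq_trans (homo_ge_id phiH n)) // leq_addr.
  have close u : nc u <= 3 * s + 1 -> nc (g (phi n)).[u] <= A2 /\
      nc ((g (phi n)).[u] - G u) <= i.
    move=> us; have us' : nc (u - 0) <= 3 * s + 1 by rewrite subr0.
    split; last exact: le_trans (HG n u us') ni.
    by apply: gA2; apply: le_trans us' _; linear_arith.
  rewrite gE in close.
  have [Z [Zw fixZ rep]] := Hi _ _ _ rn0 (le_trans rni inle) (le_trans zni inle) close.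
  by have := nofix _ _ Ff Zw fixZ; rewrite leNgt rep.
have sp : 0 < s by linear_arith.
have G'0 : G' 0 != 0 by rewrite -nc_gt0 (lt_le_trans ltr01).
have hG'2 z : nc z < 3 * s + 1 -> hd G G' z by move=> zs; apply: hG'; rewrite subr0.
have plG'3 : polylim 0 (3 * s) G' by apply: plG'.
have := ram (3 * s) s G G' (3 * s + 1) sp s23 s31 plG plG'3 hG'2 G'0 ramG.
clear - s1 GA G'1 HCU K0 sE KC0 sp.
move=> fin.
have A0' : annulus 0 0 A (G 0) by rewrite /annulus /= subr0 nc_ge0.
have [c1 _] := HCU _ A0'.
have c2 := ler_wpM2l (ltW K0) c1.
have c3 : 1 <= nc (G' 0) ^+ 2 by apply: exprn_ege1.
have c4 : s <= s ^+ 2 by rewrite expr2 ler_peMl // ltW.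
have c5 : s ^+ 2 <= nc (G' 0) ^+ 2 * s ^+ 2 by rewrite ler_peMl // sqr_ge0.
linear_arith.
Qed.

End SphericalBound.

(** * Normality *)

Section Topology.
Variable R : realType.
Local Notation C := R[i].
Implicit Types (z c u v w : C) (e r s t B d x y M : R) (p f : {poly C}).

Lemma nbhs_ncP z (U : set C) :
  nbhs z U <-> exists2 r, 0 < r & forall u, nc (u - z) < r -> U u.
Proof.
split.
  case/nbhs_normP => e /= e0 He.
  have [eR ep] : e = (complex.Re e)%:C /\ 0 < complex.Re e.
    move: e0; rewrite ltcE /= => /andP[/eqP e0 h]; split=> //.
    by case: (e) e0 => a b /= ->.
  exists (complex.Re e) => // u uz; apply: He.
  by rewrite /ball_ /= eR ncE ncBC ltcR.
case=> r r0 H; apply/nbhs_normP; exists r%:C; first by rewrite /= ltcR.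
by move=> u; rewrite /ball_ /= ncE ncBC ltcR => /H.
Qed.

Lemma nbhs_disc z r : 0 < r -> nbhs z [set u : C | nc (u - z) < r].
Proof. by move=> r0; apply/nbhs_ncP; exists r. Qed.

Lemma open_disc c r : open [set u : C | nc (u - c) < r].
Proof.
rewrite openE => z /= zr; apply/nbhs_ncP; exists (r - nc (z - c)); first linear_arith.
by move=> u uz /=; have := nc_distD z u c; linear_arith.
Qed.

Lemma hd_is_derive (g g' : C -> C) z : hd g g' z -> is_derive z 1 g (g' z).
Proof.
move=> [K [r [K0 r0 H]]].
have cv : (fun h : C => h^-1 *: ((g \o shift z) (h *: 1) - g z)) @ 0^' --> g' z.
  apply/cvgrPdist_le => e' e'0.
  have [eR e0] : e' = (complex.Re e')%:C /\ 0 < complex.Re e'.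
    move: e'0; rewrite ltcE /= => /andP[/eqP e0 h]; split=> //.
    by case: (e') e0 => a b /= ->.
  rewrite eR; set e := complex.Re e' in e0 *.
  have K1 : 0 < K + 1 by linear_arith.
  have m0 : 0 < Num.min r (e / (K + 1)) by rewrite lt_min r0 divr_gt0.
  rewrite near_withinE; apply: filterS (nbhs_disc 0 m0) => h /=.
  rewrite subr0 lt_min => /andP[hr hK] hn0.
  have zz : nc (z - z) < r by rewrite subrr nc0.
  have hz : nc (h + z - z) < r by rewrite addrK.
  have := H _ _ hz zz; rewrite addrK => le.
  have n0 : 0 < nc h by rewrite nc_gt0.
  rewrite ncE lecR /= ncBC.
  have -> : h^-1 *: (g (h *: 1 + z) - g z) - g' z =
    h^-1 * (g (h + z) - g z - g' z * h).
    transitivity (h^-1 * (g (h * 1 + z) - g z) - g' z); first by [].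
    by rewrite mulr1; field.
  rewrite ncM ncV mulrC ler_pdivrMr //; apply: le_trans le _.
  rewrite expr2 mulrA ler_pM2r //.
  by move: hK; rewrite ltr_pdivlMr //; have := nc_ge0 h; linear_arith.
split; first by apply/cvg_ex; exists (g' z).
exact: cvg_lim cv.
Qed.

Lemma derive1_horner p z : derive1 (horner p) z = p^`().[z].
Proof. by rewrite derive1E; have [_ ->] := hd_is_derive (hd_horner p z). Qed.

Lemma cvg_uniform_on (U : set C) (h : nat -> C -> C) (g : C -> C) :
  (forall e, 0 < e -> exists N, forall n u, (N <= n)%N -> U u -> nc (h n u - g u) < e) ->
  {uniform U, h @ \oo --> g}.
Proof.
move=> H P /=; rewrite uniform_nbhs => -[E [entE EP]].
have [e' /= e'0 He] : exists2 e' : C, 0 < e' & forall a b : C, `|a - b| < e' -> E (a, b).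
  move: entE; rewrite -entourage_ballE => -[e' /= e'0 He]; exists e' => // a b ab.
  by apply: He; rewrite /= -ball_normE.
have [eR e0] : e' = (complex.Re e')%:C /\ 0 < complex.Re e'.
  move: e'0; rewrite ltcE /= => /andP[/eqP e0 h0]; split=> //.
  by case: (e') e0 => a b /= ->.
have [N HN] := H _ e0; exists N => // n /= Nn; apply: EP => u Uu /=.
by apply: He; rewrite eR ncE ncBC ltcR; exact: HN.
Qed.

Lemma spherical_bounded_normal (F : set {poly C}) w0 r M : 0 < r ->
  (forall f z, F f -> nc (z - w0) <= r -> nc f^`().[z] <= M * (1 + nc f.[z] ^+ 2)) ->
  normal_at (poly_functions F) w0.
Proof.
move=> r0 HM.
have [M' M'0 {}HM] : exists2 M', 0 <= M' & forall f z, F f -> nc (z - w0) <= r ->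
    nc f^`().[z] <= M' * (1 + nc f.[z] ^+ 2).
  exists `|M| => // f z Ff zr; apply: le_trans (HM f z Ff zr) _.
  by rewrite ler_wpM2r ?ler_norm // addr_ge0 // sqr_ge0.
have [d [d0 dr Md]] : exists d, [/\ 0 < d, d <= r / 4 & M' * d <= 4^-1].
  exists (Num.min (r / 4) (4^-1 / (M' + 1))); have M1 : 0 < M' + 1 by linear_arith.
  split; [by rewrite lt_min !divr_gt0|by rewrite ge_min lexx|].
  have h : Num.min (r / 4) (4^-1 / (M' + 1)) <= 4^-1 / (M' + 1).
    by rewrite ge_min lexx orbT.
  apply: le_trans (ler_wpM2l M'0 h) _; rewrite mulrA ler_pdivrMr //; linear_arith.
have lip f z0 z1 : F f -> nc (z0 - w0) <= r / 2 -> nc (z1 - w0) <= r / 2 ->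
    loglog (nc f.[z1]) <= loglog (nc f.[z0]) + (4 * M' + 2 / d) * r.
  move=> Ff h0 h1; have h2 := nc_distD w0 z1 z0; rewrite (ncBC w0) in h2.
  have q0 : 0 <= 4 * M' + 2 / d by rewrite addr_ge0 ?mulr_ge0 ?invr_ge0 // ltW.
  have h3 : nc (z1 - z0) <= r by linear_arith.
  have := @loglog_lipschitz _ (horner f) (horner f^`()) (horner f^`()^`())
    w0 (r / 2) d M' z0 z1 d0 M'0 Md.
  move=> /(_ _ h0 h1)/le_trans; apply.
    move=> u us; split; [exact: hd_horner|exact: hd_horner|].
    by apply: HM => //; linear_arith.
  by rewrite lerD2l ler_wpM2l.
set L := (4 * M' + 2 / d) * r in lip.
have c0 : nc (w0 - w0) <= r / 2 by rewrite subrr nc0; linear_arith.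
have r4 : 0 < r / 4 by linear_arith.
exists [set u : C | nc (u - w0) < r / 4]; split; first exact: open_disc.
  by rewrite /= subrr nc0.
move=> h Fh.
have exq n : exists q, F q /\ horner q = h n by have [q Fq qh] := Fh n; exists q.
have [p Hp] := choice exq.
have Fp n : F (p n) by have [] := Hp n.
have hE n : h n = horner (p n) by have [_ ->] := Hp n.
(* The alternative concerns the values at [w0] only: if no subsequence is bounded there, the whole
   sequence tends to infinity at [w0]. The Lipschitz bound on [loglog] spreads either behaviour over
   the disc. *)
have [[B HB]|nB] := pselect (exists B, forall N, exists2 n, (N <= n)%N & nc (p n).[w0] <= B).
  have [nx Hnx] := choice (fun N => let: ex_intro2 n h1 h2 := HB N in
    ex_intro (fun n => (N <= n)%N /\ nc (p n).[w0] <= B) n (conj h1 h2)).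
  pose psi := fix psi n := if n is m.+1 then nx (psi m).+1 else nx 0%N.
  have psiS n : (psi n < psi n.+1)%N by have [] := Hnx (psi n).+1.
  have psiH : {homo psi : m n / (m < n)%N}.
    by apply: homo_ltn => [? ? ?|]; [exact: ltn_trans|].
  have psiB n : nc (p (psi n)).[w0] <= B.
    by case: n => [|n]; [have [] := Hnx 0%N|have [] := Hnx (psi n).+1].
  have [A A0 HA] := loglog_inv (loglog B + L).
  have pA n z : nc (z - w0) <= r / 2 -> nc (p (psi n)).[z] <= A.
    move=> zr; apply: HA (nc_ge0 _) _; apply: le_trans (lip _ w0 z (Fp _) c0 zr) _.
    by rewrite lerD2r le_loglog ?nc_ge0.
  have r42 : r / 4 < r / 2 by linear_arith.
  have [phi [g [phiH HG]]] := montel (p := fun n => p (psi n)) (ltW r4) r42 pA.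
  exists (psi \o phi); first by move=> m n mn; apply: psiH; exact: phiH.
  left; exists g.
    have plg : polylim w0 (r / 4) g.
      move=> e e0; have [N HN] := inv_succ_small e0; exists (p (psi (phi N))) => z zr.
      exact: le_trans (HG N z zr) (ltW (HN N (leqnn N))).
    have [g' [_ hg _]] := polylim_deriv plg.
    by move=> z zr; have [] := hd_is_derive (hg z zr).
  move=> z zr; exists [set u : C | nc (u - w0) < r / 4].
    exact: open_disc.
  apply: cvg_uniform_on => e e0; have [N HN] := inv_succ_small e0.
  exists N => n u Nn /= ur; rewrite hE.
  exact: le_lt_trans (HG n u (ltW ur)) (HN n Nn).
exists id => //; right=> z zr; exists [set u : C | nc (u - w0) < r / 4].
  exact: open_disc.
(* [Num.max 0 T], because [T] may be negative and [loglog] is monotone only on nonnegative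
   arguments. *)
move=> T; have [A A0 HA] := loglog_inv (loglog (Num.max 0 T) + L).
have [N HN] : exists N, forall n, (N <= n)%N -> A < nc (p n).[w0].
  apply: contrapT => no; apply: nB; exists A => N; apply: contrapT => no2.
  apply: no; exists N => n Nn; rewrite ltNge; apply/negP => h2.
  by apply: no2; exists n.
exists N => // n /= /HN hn u ur; rewrite /= hE ncE ltcR ltNge; apply/negP => hT.
have uT : nc (p n).[u] <= Num.max 0 T by rewrite le_max hT orbT.
have ur2 : nc (u - w0) <= r / 2 by move: ur => /=; linear_arith.
suff : nc (p n).[w0] <= A by rewrite leNgt hn.
apply: HA (nc_ge0 _) _; apply: le_trans (lip _ u w0 (Fp _) ur2 c0) _.
by rewrite lerD2r le_loglog ?nc_ge0.
Qed.

Lemma simple_root_deriv p z : simple_root p z -> p.[z] = 0 /\ p^`().[z] != 0.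
Proof.
rewrite /simple_root => /eqP m1.
have p0 : p != 0.
  (* [mup] is a maximum over exponents at most [size p], hence 0 for the zero polynomial. *)
  apply/eqP => p0; move: m1; rewrite /mup; case: arg_maxnP => [|i _ _ i1].
    by rewrite expr0 dvd1p.
  by have := ltn_ord i; rewrite i1 p0 size_poly0.
have pz : p.[z] = 0.
  by apply/rootP; rewrite -dvdp_XsubCl XsubC_dvd // m1.
split=> //; apply/eqP => p'z.
have /factor_theorem[q pq] : root p z by apply/rootP.
have q0 : q.[z] = 0.
  by move: p'z; rewrite pq derivM derivXsubC !hornerE subrr; rewrite ?(mulr0, mulr1, add0r, addr0).
have /factor_theorem[s qs] : root q z by apply/rootP.
have : (('X - z%:P) ^+ 2 %| p)%R by rewrite pq qs -mulrA -expr2 dvdp_mulIr.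
by rewrite -mup_geq // m1.
Qed.

End Topology.

Theorem theorem1p6 (R : realType) (F : set {poly R[i]})
    (nonconst : forall P : {poly R[i]}, F P -> (1 < size P)%N)
    (simple3 : forall w0 : R[i], julia_set (poly_functions F) w0 ->
       exists2 P0 : {poly R[i]}, F P0 & three_simple_roots (P0 - w0%:P)) :
  julia_set (poly_functions F) `<=`
    closure [set w : R[i] | exists P Q : {poly R[i]},
               [/\ F P, F Q & repelling_fixed_point (horner (P \Po Q)) w]].
Proof.
move=> w0 Jw0 B /nbhs_ncP[eps eps0 HB]; apply: contrapT => no.
have [P FP [s [us ss Ps]]] := simple3 w0 Jw0.
have [a1 [a2 [a3 sE]]] : exists a1 a2 a3, s = [:: a1; a2; a3].
  by case: s ss {us Ps} => [|a1 [|a2 [|a3 []]]] // _; exists a1, a2, a3.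
move: us; rewrite sE /= !inE negb_or andbT => /andP[/andP[a12 a13] a23].
have Pa a : a \in [:: a1; a2; a3] -> P.[a] = w0 /\ P^`().[a] != 0.
  rewrite -sE => /(allP Ps)/simple_root_deriv[].
  by rewrite derivB derivC subr0 !hornerE => /eqP; rewrite subr_eq0 => /eqP.
(* The outer polynomial [P] is fixed by [w0], only the inner one runs through the family; by the
   chain rule the multiplier is the derivative of [P \Po f]. *)
have [f z Ff zw Pz|r [M [r0 HM]]] := @spherical_bounded _ F w0 P a1 a2 a3 eps a12 a13 a23 eps0 Pa _.
  rewrite leNgt; apply/negP => rep; apply: no; exists z; split; last exact: HB.
  exists P, f; split=> //; split; first by rewrite horner_comp.
  by rewrite derive1_horner deriv_comp hornerM horner_comp ncE ltcR.
exact: Jw0 (spherical_bounded_normal r0 HM).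
Qed.
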